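(* Let $n\ge 1$ and let $P_1(z)=a_nz^n+a_{n-1}z^{n-1}+\cdots+a_0$ and $P_0(z)=b_nz^n+b_{n-1}z^{n-1}+\cdots+b_0$ be non-constant polynomials with complex coefficients, $a_n\neq 0$, $b_n\neq 0$. Let $h_1$ and $h_0$ be entire functions, not identically zero, satisfying $\rho(h_1)<\deg P_1$ and $\rho(h_0)<\deg P_0$. Suppose that $P_1(z)-cP_0(z)$ is a constant for some real $c\geq 1$, that $h_1$ has Fabry gaps, and that $\mu(h_0)>\rho(h_1)$. Then every non-constant solution $f$ of the differential equation $$f''+h_1(z)e^{P_1(z)}f'+h_0(z)e^{P_0(z)}f=0$$ has infinite order.
   Context: All solutions of this equation are entire functions. For an entire function $g$, with $M(r,g)=\max_{|z|=r}|g(z)|$, the order is $\rho(g)=\limsup_{r\to\infty}\frac{\log^+\log^+ M(r,g)}{\log r}$ and the lower order is $\mu(g)=\liminf_{r\to\infty}\frac{\log^+\log^+ M(r,g)}{\log r}$. An entire function $g(z)=\sum_{n=0}^\infty a_{\lambda_n}z^{\lambda_n}$ (with $\lambda_n$ increasing) is said to have Fabry gaps if $\lambda_n/n\to\infty$ as $n\to\infty$. *)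

(* Defs.v *)
From Stdlib Require Import Reals.
From Coquelicot Require Import Coquelicot.
Open Scope R_scope.

Definition cexp (z : C) : C :=
  (exp (Re z) * cos (Im z), exp (Re z) * sin (Im z)).

Definition cpoly (a : nat -> C) (n : nat) (z : C) : C :=
  sum_n (fun k => (a k * pow_n z k)%C) n.

Definition entire (g : C -> C) : Prop :=
  forall z : C, @ex_derive C_AbsRing C_NormedModule g z.

Definition maxmod (g : C -> C) (r : R) : Rbar :=
  Rbar_lub (fun v => exists z : C, Cmod z = r /\ v = Finite (Cmod (g z))).

Definition logplus (x : R) : R := Rmax 0 (ln x).

Definition ord_quot (g : C -> C) (r : R) : R :=
  logplus (logplus (real (maxmod g r))) / ln r.

Definition limsup_infty (phi : R -> R) : Rbar :=
  Rbar_glb (fun y => exists R0 : R,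
    y = Rbar_lub (fun v => exists r : R, R0 <= r /\ v = Finite (phi r))).
Definition liminf_infty (phi : R -> R) : Rbar :=
  Rbar_lub (fun y => exists R0 : R,
    y = Rbar_glb (fun v => exists r : R, R0 <= r /\ v = Finite (phi r))).

Definition order (g : C -> C) : Rbar := limsup_infty (ord_quot g).
Definition lower_order (g : C -> C) : Rbar := liminf_infty (ord_quot g).

Definition fabry_gaps (g : C -> C) : Prop :=
  exists (a : nat -> C) (lam : nat -> nat),
    (forall z : C, @is_pseries C_AbsRing C_NormedModule a z (g z)) /\
    (forall m, (lam m < lam (S m))%nat) /\
    (forall k, (forall m, lam m <> k) -> a k = 0%C) /\
    is_lim_seq (fun m => INR (lam m) / INR m) p_infty.

(* Main.v *)
Require Import Defs.
From Stdlib Require Import Reals.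
From Coquelicot Require Import Coquelicot.
From Stdlib Require Import ZArith Lra Lia Psatz Classical ClassicalEpsilon List.
Open Scope R_scope.

(* Suppose that f is a non-constant solution of finite order.  Then f'/f and f''/f are at most
   r^K = |z|^K on suitable circles around any point far out.

   If c = 1, then e^(P1 - P0) is constant and the equation gives |h0| <= e^(-Re P0) |f''/f| + C |h1 f'/f|,
   so log |h0| = O(r^beta) with rho(h1) < beta < mu(h0) wherever Re P0 is positive.  The remaining
   sectors have opening just above pi / n and rho(h0) < n, so Phragmen-Lindelof extends this bound to
   the whole plane, contradicting beta < mu(h0).

   If c > 1, then f'/f is tiny where Re P0 is positive, so f = O(r^(1/2)) and f' tends to 0 there.  Where
   Re P0 is negative both coefficients of the equation are exponentially small and f' = O(r^(1/2)).
   Phragmen-Lindelof in thin sectors around the critical rays gives f' = O(r^(1/2)) everywhere, so f' is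
   constant, hence 0. *)

(** * Complex differentiability and compactness *)

(** The obstacle is the zeros of [f] and [h1]: [f'/f] and [1/h1] are controlled only away from them,
    and their position is unknown. Their number grows at most like a power of [r], so every point
    [z0] with [|z0| = r] is the centre of a circle free of them whose radius is a small multiple of
    [r]. On its disc [Re P0] keeps its sign and its size [r^n], and the maximum principle returns
    from the circle to [z0]. Hence no exceptional directions or radii remain, and Phragmen-Lindelof
    can be used along any ray. If [c > 1], a solution can be expected to be of linear size where
    [Re P0] is negative, so the argument runs on [f']. The exponent 1/2 comes from
    [|f'| <= |f| / (2 r)] and from an energy with [E' <= E / r]; what matters is that it is below 1.
    The thin sectors can be adapted to any finite order of [f], whereas the wide sectors of the case
    [c = 1] have a forced opening, and there [rho(h0) < n] is decisive. Cauchy's integral formula is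
    bypassed: derivatives are bounded by a maximum principle for divided differences. *)

Lemma Cmod_sub_sym (x y : C) : Cmod (x - y) = Cmod (y - x).
Proof. rewrite <- (Cmod_opp (x - y)); f_equal; ring. Qed.

Lemma Cmod_triangle_sub (x y : C) : Cmod x - Cmod y <= Cmod (x - y).
Proof.
assert (H := Cmod_triangle (x - y) y); replace (x - y + y)%C with x in H by ring; lra.
Qed.

Lemma Cmod_triangle_minus (x y : C) : Cmod (x - y) <= Cmod x + Cmod y.
Proof. assert (H := Cmod_triangle x (- y)); rewrite Cmod_opp in H; exact H. Qed.

Lemma Cmod_dist_triangle (x y z : C) : Cmod (x - z) <= Cmod (x - y) + Cmod (y - z).
Proof. replace (x - z)%C with ((x - y) + (y - z))%C by ring; apply Cmod_triangle. Qed.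

Lemma Cmod_dist_bounds (z w : C) : Cmod z - Cmod (w - z) <= Cmod w <= Cmod z + Cmod (w - z).
Proof.
assert (T1 := Cmod_triangle_sub w z); assert (T2 := Cmod_triangle_sub z w).
rewrite (Cmod_sub_sym z w) in T2; lra.
Qed.

Lemma Cmod_self (z : C) : Cmod (z - z) = 0.
Proof. replace (z - z)%C with (RtoC 0) by ring; apply Cmod_0. Qed.

Lemma Rmin_spec (x y : R) : Rmin x y <= x /\ Rmin x y <= y.
Proof. split; [apply Rmin_l|apply Rmin_r]. Qed.

Lemma Rmax_spec (x y : R) : x <= Rmax x y /\ y <= Rmax x y.
Proof. split; [apply Rmax_l|apply Rmax_r]. Qed.

(** Increment form with [<=], so that [h = 0] is no exception and estimates are made directly on
    [Cmod]. *)
Definition cdiff (g : C -> C) (z l : C) : Prop :=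
  forall eps : R, 0 < eps -> exists delta : R, 0 < delta /\
    forall h : C, Cmod h < delta ->
      Cmod (g (z + h) - g z - l * h)%C <= eps * Cmod h.

Lemma cdiff_is_derive (g : C -> C) (z l : C) :
  cdiff g z l <-> @is_derive C_AbsRing C_NormedModule g z l.
Proof.
split.
- intros H; split; [apply is_linear_scal_l|].
  intros x Hx eps.
  apply (is_filter_lim_locally_unique (V := AbsRing_NormedModule C_AbsRing)) in Hx.
  subst x.
  destruct (H eps (cond_pos eps)) as [d [Hd Hg]].
  exists (mkposreal d Hd).
  change (forall y : C, Cmod (y - z)%C < d ->
    Cmod ((g y - g z) - (y - z) * l)%C <= eps * Cmod (y - z)%C).
  intros y Hy.
  specialize (Hg (y - z)%C Hy).
  replace (z + (y - z))%C with y in Hg by ring.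
  now replace ((y - z) * l)%C with (l * (y - z))%C by ring.
- intros [_ H] eps Heps.
  destruct (H z (fun P H => H) (mkposreal eps Heps)) as [[d Hd] Hg].
  exists d; split; [exact Hd|]; intros h Hh.
  assert (Hb : Cmod ((z + h) - z)%C < d) by (replace (z + h - z)%C with h by ring; exact Hh).
  specialize (Hg (z + h)%C Hb).
  change (Cmod ((g (z + h) - g z) - ((z + h) - z) * l)%C <= eps * Cmod ((z + h) - z)%C) in Hg.
  replace (z + h - z)%C with h in Hg by ring.
  now replace (l * h)%C with (h * l)%C by ring.
Qed.

(** [C] is a normed module over itself in two presentations; the rules for products and for the
    inner function of a composition are stated with this one. *)
Lemma cdiff_is_derive' (g : C -> C) (z l : C) :
  cdiff g z l <-> @is_derive C_AbsRing (AbsRing_NormedModule C_AbsRing) g z l.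
Proof.
rewrite cdiff_is_derive.
split; intros [_ H]; (split; [apply is_linear_scal_l|exact H]).
Qed.

Lemma cdiff_eq (g : C -> C) (z l l' : C) : cdiff g z l -> l = l' -> cdiff g z l'.
Proof. now intros H <-. Qed.

Lemma cdiff_const (c z : C) : cdiff (fun _ => c) z 0.
Proof.
intros eps He; exists 1; split; [lra|]; intros h _.
replace (c - c - 0 * h)%C with (RtoC 0) by ring.
rewrite Cmod_0; apply Rmult_le_pos; [lra|apply Cmod_ge_0].
Qed.

Lemma cdiff_id (z : C) : cdiff (fun w => w) z 1.
Proof.
intros eps He; exists 1; split; [lra|]; intros h _.
replace (z + h - z - 1 * h)%C with (RtoC 0) by ring.
rewrite Cmod_0; apply Rmult_le_pos; [lra|apply Cmod_ge_0].
Qed.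

Lemma cdiff_plus (f g : C -> C) (z a b : C) :
  cdiff f z a -> cdiff g z b -> cdiff (fun w => f w + g w)%C z (a + b)%C.
Proof.
rewrite !cdiff_is_derive; intros Hf Hg.
exact (is_derive_plus (K := C_AbsRing) (V := C_NormedModule) f g z a b Hf Hg).
Qed.

Lemma cdiff_mult (f g : C -> C) (z a b : C) :
  cdiff f z a -> cdiff g z b -> cdiff (fun w => f w * g w)%C z (a * g z + f z * b)%C.
Proof.
rewrite !cdiff_is_derive'; intros Hf Hg.
exact (is_derive_mult (K := C_AbsRing) f g z a b Hf Hg Cmult_comm).
Qed.

Lemma cdiff_comp (f g : C -> C) (z a b : C) :
  cdiff f (g z) a -> cdiff g z b -> cdiff (fun w => f (g w)) z (b * a)%C.
Proof.
rewrite (cdiff_is_derive f), (cdiff_is_derive' g), cdiff_is_derive; intros Hf Hg.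
exact (is_derive_comp (K := C_AbsRing) (V := C_NormedModule) f g z a b Hf Hg).
Qed.

Lemma cdiff_ext_loc (f g : C -> C) (z l : C) (d : R) : 0 < d ->
  (forall w, Cmod (w - z) < d -> f w = g w) -> cdiff f z l -> cdiff g z l.
Proof.
intros Hd He Hf eps Heps.
destruct (Hf eps Heps) as [e [He0 H]].
exists (Rmin d e); split; [now apply Rmin_glb_lt|]; intros h Hh.
assert (h1 := Rmin_spec d e).
rewrite <- !He; [apply H; lra| |].
- replace (z - z)%C with (RtoC 0) by ring; rewrite Cmod_0; lra.
- replace (z + h - z)%C with h by ring; lra.
Qed.

Lemma cdiff_scal (c : C) (g : C -> C) (z l : C) :
  cdiff g z l -> cdiff (fun w => c * g w)%C z (c * l)%C.
Proof.
intros H; eapply cdiff_eq; [apply (cdiff_mult (fun _ => c)); [apply cdiff_const|exact H]|]; ring.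
Qed.

Lemma cdiff_opp (g : C -> C) (z l : C) : cdiff g z l -> cdiff (fun w => - g w)%C z (- l)%C.
Proof.
intros H; apply (cdiff_ext_loc (fun w => -(1) * g w)%C _ _ _ 1); [lra|intros; ring|].
eapply cdiff_eq; [apply cdiff_scal, H|ring].
Qed.

Lemma cdiff_minus (f g : C -> C) (z a b : C) :
  cdiff f z a -> cdiff g z b -> cdiff (fun w => f w - g w)%C z (a - b)%C.
Proof. intros Hf Hg; apply (cdiff_plus f (fun w => - g w)%C); [exact Hf|now apply cdiff_opp]. Qed.

Lemma cdiff_inv_id (z : C) : z <> 0%C -> cdiff (fun w => / w)%C z (- / (z * z))%C.
Proof.
intros Hz eps He.
assert (Hm : 0 < Cmod z) by now apply Cmod_gt_0.
set (m := Cmod z) in *.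
exists (Rmin (m / 2) (eps * (m * m * m) / 2)); split.
{ apply Rmin_glb_lt; [lra|]. repeat apply Rmult_lt_0_compat; lra. }
intros h Hh.
assert (h1 := Rmin_spec (m / 2) (eps * (m * m * m) / 2)).
assert (Hzh : m / 2 <= Cmod (z + h)).
{ assert (T := Cmod_triangle_sub z (- h)); rewrite Cmod_opp in T.
  replace (z - - h)%C with (z + h)%C in T by ring; fold m in T; lra. }
assert (Hzh0 : (z + h <> 0)%C) by (apply Cmod_gt_0; lra).
replace (/ (z + h) - / z - - / (z * z) * h)%C with (h * h * / (z * z * (z + h)))%C
  by (field; split; assumption).
rewrite !Cmod_mult, Cmod_inv, !Cmod_mult by (repeat apply Cmult_neq_0; assumption).
fold m.
assert (H0 := Cmod_ge_0 h).
assert (Hi : / (m * m * Cmod (z + h)) <= 2 / (m * m * m)).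
{ replace (2 / (m * m * m)) with (/ (m * m * (m / 2))) by (field; lra).
  apply Rinv_le_contravar; [repeat apply Rmult_lt_0_compat; lra|].
  apply Rmult_le_compat_l; [nra|lra]. }
apply Rle_trans with (Cmod h * Cmod h * (2 / (m * m * m))).
{ apply Rmult_le_compat_l; [nra|exact Hi]. }
replace (Cmod h * Cmod h * (2 / (m * m * m))) with ((Cmod h * (2 / (m * m * m))) * Cmod h) by ring.
apply Rmult_le_compat_r; [exact H0|].
apply Rle_trans with ((eps * (m * m * m) / 2) * (2 / (m * m * m))).
{ apply Rmult_le_compat_r; [|lra].
  apply Rlt_le, Rdiv_lt_0_compat; [lra|repeat apply Rmult_lt_0_compat; lra]. }
right; field; lra.
Qed.

Lemma cdiff_inv (g : C -> C) (z l : C) : g z <> 0%C ->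
  cdiff g z l -> cdiff (fun w => / g w)%C z (- l / (g z * g z))%C.
Proof.
intros Hz H; eapply cdiff_eq; [apply (cdiff_comp (fun w => / w)%C g); [now apply cdiff_inv_id|exact H]|].
field; exact Hz.
Qed.

Lemma cdiff_div (f g : C -> C) (z a b : C) : g z <> 0%C ->
  cdiff f z a -> cdiff g z b ->
  cdiff (fun w => f w / g w)%C z ((a * g z - f z * b) / (g z * g z))%C.
Proof.
intros Hz Hf Hg; eapply cdiff_eq;
 [apply cdiff_mult; [exact Hf|apply cdiff_inv; [exact Hz|exact Hg]]|].
cbv beta; field; exact Hz.
Qed.

Lemma cdiff_shift (g : C -> C) (z h l : C) :
  cdiff g (z + h) l -> cdiff (fun w => g (w + h)%C) z l.
Proof.
intros H; eapply cdiff_eq; [apply (cdiff_comp g (fun w => w + h)%C); [exact H|]|].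
- apply cdiff_plus; [apply cdiff_id|apply cdiff_const].
- ring.
Qed.

Definition ccont (g : C -> C) (z : C) : Prop :=
  forall eps : R, 0 < eps -> exists delta : R, 0 < delta /\
    forall w : C, Cmod (w - z) < delta -> Cmod (g w - g z) < eps.

Lemma cdiff_ccont (g : C -> C) (z l : C) : cdiff g z l -> ccont g z.
Proof.
intros H eps He.
destruct (H 1 Rlt_0_1) as [d [Hd Hg]].
assert (Hl := Cmod_ge_0 l).
assert (Hq : 0 < eps / (Cmod l + 2)) by (apply Rdiv_lt_0_compat; lra).
exists (Rmin d (eps / (Cmod l + 2))); split; [now apply Rmin_glb_lt|].
intros w Hw.
assert (h1 := Rmin_spec d (eps / (Cmod l + 2))).
specialize (Hg (w - z)%C ltac:(lra)).
replace (z + (w - z))%C with w in Hg by ring.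
assert (T := Cmod_triangle (g w - g z - l * (w - z)) (l * (w - z))).
replace (g w - g z - l * (w - z) + l * (w - z))%C with (g w - g z)%C in T by ring.
rewrite Cmod_mult in T.
assert (Hw0 := Cmod_ge_0 (w - z)).
apply Rle_lt_trans with (Cmod (w - z) * (Cmod l + 1)); [lra|].
apply Rle_lt_trans with (eps / (Cmod l + 2) * (Cmod l + 1)).
- apply Rmult_le_compat_r; lra.
- replace eps with (eps / (Cmod l + 2) * (Cmod l + 2)) at 2 by (field; lra).
  apply Rmult_lt_compat_l; lra.
Qed.

(** * Boxes, bisection and compactness *)

Record box := Box { xmin : R; xmax : R; ymin : R; ymax : R }.
Definition box_wf (Q : box) := xmin Q <= xmax Q /\ ymin Q <= ymax Q.
Definition in_box (Q : box) (z : C) := xmin Q <= Re z <= xmax Q /\ ymin Q <= Im z <= ymax Q.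
Definition box_size (Q : box) := (xmax Q - xmin Q) + (ymax Q - ymin Q).
Definition xmid (Q : box) := (xmin Q + xmax Q) / 2.
Definition ymid (Q : box) := (ymin Q + ymax Q) / 2.
Definition quarter_sw Q := Box (xmin Q) (xmid Q) (ymin Q) (ymid Q).
Definition quarter_se Q := Box (xmid Q) (xmax Q) (ymin Q) (ymid Q).
Definition quarter_nw Q := Box (xmin Q) (xmid Q) (ymid Q) (ymax Q).
Definition quarter_ne Q := Box (xmid Q) (xmax Q) (ymid Q) (ymax Q).
Definition quarters Q := quarter_sw Q :: quarter_se Q :: quarter_nw Q :: quarter_ne Q :: nil.
Definition is_quarter Q' Q := In Q' (quarters Q).
Definition sub_box (Q' Q : box) := xmin Q <= xmin Q' /\ xmax Q' <= xmax Q /\ ymin Q <= ymin Q' /\ ymax Q' <= ymax Q.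

Lemma quarter_props Q' Q : box_wf Q -> is_quarter Q' Q ->
  box_wf Q' /\ sub_box Q' Q /\ box_size Q' = box_size Q / 2.
Proof.
unfold box_wf, sub_box, box_size; intros HQ [H|[H|[H|[H|[]]]]]; subst Q';
 unfold quarter_sw, quarter_se, quarter_nw, quarter_ne, xmid, ymid; simpl; lra.
Qed.

(** Choosing a quarter again and again gives nested boxes; the suprema of their left and lower ends
    are the coordinates of the point. The extreme value theorem, uniform continuity and Goursat's
    theorem are all obtained this way. *)
Lemma bisect_point (P : box -> Prop) (Q : box) :
  box_wf Q -> P Q ->
  (forall Q', box_wf Q' -> sub_box Q' Q -> P Q' -> exists Q'', is_quarter Q'' Q' /\ P Q'') ->
  exists z, in_box Q z /\ forall eta, 0 < eta ->
    exists Q', box_wf Q' /\ sub_box Q' Q /\ in_box Q' z /\ box_size Q' < eta /\ P Q'.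
Proof.
intros HQ HP Hstep.
(* Boxes are packed with their invariants, so that dependent choice becomes recursion on [nat]. *)
set (T := {Q' : box | box_wf Q' /\ sub_box Q' Q /\ P Q'}).
assert (Hs : forall t : T, {t' : T | is_quarter (proj1_sig t') (proj1_sig t)}).
{ intros [Q' [h1 [h2 h3]]]; apply constructive_indefinite_description; simpl.
  destruct (Hstep Q' h1 h2 h3) as [Q'' [Hq HP'']].
  destruct (quarter_props _ _ h1 Hq) as [k1 [k2 _]].
  assert (K : sub_box Q'' Q) by (unfold sub_box in *; lra).
  now exists (exist _ Q'' (conj k1 (conj K HP''))). }
assert (H0 : box_wf Q /\ sub_box Q Q /\ P Q) by (unfold sub_box; repeat split; try lra; apply HQ || exact HP).
set (s := fix s (n : nat) : T := match n with O => exist _ Q H0 | S n => proj1_sig (Hs (s n)) end).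
set (b := fun n => proj1_sig (s n)).
assert (Hb : forall n, box_wf (b n) /\ sub_box (b n) Q /\ P (b n)) by (intros n; exact (proj2_sig (s n))).
assert (Hq : forall n, is_quarter (b (S n)) (b n)) by (intros n; exact (proj2_sig (Hs (s n)))).
assert (Hm : forall n k, sub_box (b (n + k)%nat) (b n)).
{ intros n k; induction k as [|k IH].
  - rewrite Nat.add_0_r; unfold sub_box; lra.
  - rewrite Nat.add_succ_r.
    destruct (quarter_props _ _ (proj1 (Hb (n + k)%nat)) (Hq (n + k)%nat)) as [_ [H _]].
    unfold sub_box in *; lra. }
assert (Hx : forall n m, xmin (b n) <= xmax (b m) /\ ymin (b n) <= ymax (b m)).
{ intros n m; assert (A := Hm n m); assert (B := Hm m n).
  rewrite (Nat.add_comm m n) in B; destruct (Hb (n + m)%nat) as [W _].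
  unfold box_wf, sub_box in *; lra. }
assert (Hsz : forall n, box_size (b n) = box_size Q * (/ 2) ^ n).
{ induction n as [|n IH]; [simpl; unfold b; simpl; ring|].
  destruct (quarter_props _ _ (proj1 (Hb n)) (Hq n)) as [_ [_ ->]].
  rewrite IH; simpl; field. }
destruct (completeness (fun x => exists n, x = xmin (b n))) as [x [Hx1 Hx2]].
{ exists (xmax Q); intros y [n ->]; exact (proj1 (Hx n 0%nat)). }
{ exists (xmin (b 0%nat)); now exists 0%nat. }
destruct (completeness (fun x => exists n, x = ymin (b n))) as [y [Hy1 Hy2]].
{ exists (ymax Q); intros y [n ->]; exact (proj2 (Hx n 0%nat)). }
{ exists (ymin (b 0%nat)); now exists 0%nat. }
assert (Hin : forall n, in_box (b n) (x, y)).
{ intros n; unfold in_box; simpl; repeat split.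
  - apply Hx1; now exists n.
  - apply Hx2; intros u [m ->]; apply Hx.
  - apply Hy1; now exists n.
  - apply Hy2; intros u [m ->]; apply Hx. }
exists (x, y); split; [exact (Hin 0%nat)|].
intros eta He.
assert (Hs0 : 0 <= box_size Q) by (unfold box_wf, box_size in *; lra).
destruct (pow_lt_1_zero (/ 2) ltac:(rewrite Rabs_pos_eq; lra) (eta / (box_size Q + 1))
  ltac:(apply Rdiv_lt_0_compat; lra)) as [N HN].
specialize (HN N (le_n N)).
exists (b N); split; [apply Hb|split; [apply Hb|split; [apply Hin|split; [|apply Hb]]]].
rewrite Hsz.
assert (p0 : 0 < (/ 2) ^ N) by (apply pow_lt; lra).
rewrite Rabs_pos_eq in HN by lra.
apply Rle_lt_trans with ((box_size Q + 1) * (/ 2) ^ N); [nra|].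
apply Rlt_le_trans with ((box_size Q + 1) * (eta / (box_size Q + 1))).
- apply Rmult_lt_compat_l; lra.
- right; field; lra.
Qed.

Lemma Cmod_le_Re_Im (z : C) : Cmod z <= Rabs (Re z) + Rabs (Im z).
Proof.
destruct z as [x y]; simpl.
replace (x, y) with (RtoC x + Ci * RtoC y)%C
  by (unfold RtoC, Ci, Cplus, Cmult; simpl; f_equal; ring).
eapply Rle_trans; [apply Cmod_triangle|].
rewrite Cmod_mult, Cmod_Ci, !Cmod_R; lra.
Qed.

Lemma im_le_Cmod (z : C) : Rabs (Im z) <= Cmod z.
Proof. eapply Rle_trans; [apply Rmax_r|apply (Rmax_Cmod z)]. Qed.

Lemma in_box_dist (Q : box) (z w : C) : in_box Q z -> in_box Q w -> Cmod (w - z) <= box_size Q.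
Proof.
intros Hz Hw; eapply Rle_trans; [apply Cmod_le_Re_Im|].
unfold in_box, box_size in *; destruct z, w; simpl in *.
apply Rplus_le_compat; apply Rabs_le; lra.
Qed.

Lemma quarter_cover Q z : in_box Q z -> exists Q', is_quarter Q' Q /\ in_box Q' z.
Proof.
intros [Hx Hy].
destruct (Rle_dec (Re z) (xmid Q)) as [h|h]; destruct (Rle_dec (Im z) (ymid Q)) as [k|k].
- exists (quarter_sw Q); unfold in_box, is_quarter; simpl; split; [tauto|lra].
- exists (quarter_nw Q); unfold in_box, is_quarter; simpl; split; [tauto|lra].
- exists (quarter_se Q); unfold in_box, is_quarter; simpl; split; [tauto|lra].
- exists (quarter_ne Q); unfold in_box, is_quarter; simpl; split; [tauto|lra].
Qed.

Definition cclosed (K : C -> Prop) := forall z, (forall e, 0 < e -> exists w, K w /\ Cmod (w - z) < e) -> K z.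
Definition cbounded (K : C -> Prop) := exists B, forall z, K z -> Cmod z <= B.

Lemma in_box_centred (B : R) (z : C) : Cmod z <= B -> in_box (Box (-B) B (-B) B) z.
Proof.
intros H; assert (a := re_le_Cmod z); assert (b := im_le_Cmod z).
assert (Rabs (Re z) <= B) as c by lra; assert (Rabs (Im z) <= B) as d by lra.
apply Rabs_le_between in c; apply Rabs_le_between in d; unfold in_box; simpl; lra.
Qed.

(** Bisection of a square containing [K], with the property that every value of [phi] on [K] is
    dominated by a value taken in the box. If all four quarters lost it, the best of their four
    undominated points would contradict it for the whole box. The supremum of [phi] never
    appears. *)
Lemma extreme_value (K : C -> Prop) (phi : C -> R) :
  cclosed K -> cbounded K -> (exists z, K z) ->
  (forall z, K z -> forall eps, 0 < eps -> exists d, 0 < d /\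
     forall w, K w -> Cmod (w - z) < d -> Rabs (phi w - phi z) < eps) ->
  exists z, K z /\ forall w, K w -> phi w <= phi z.
Proof.
intros HK [B HB] [z0 Hz0] Hc.
set (P := fun Q => forall z, K z -> exists w, K w /\ in_box Q w /\ phi z <= phi w).
destruct (bisect_point P (Box (-B) B (-B) B)) as [z [_ Hz]].
- assert (h := HB _ Hz0); assert (h' := Cmod_ge_0 z0); unfold box_wf; simpl; lra.
- intros z Hz; exists z; split; [exact Hz|split; [now apply in_box_centred, HB|lra]].
- intros Q _ _ HQ.
  apply NNPP; intros Hn.
  assert (Hf : forall Q', is_quarter Q' Q -> exists z, K z /\ forall w, K w -> in_box Q' w -> phi w < phi z).
  { intros Q' Hq; apply NNPP; intros Hn'; apply Hn; exists Q'; split; [exact Hq|].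
    intros z Hz; apply NNPP; intros Hn2; apply Hn'; exists z; split; [exact Hz|].
    intros w Hw Hb; apply Rnot_le_lt; intros Hl; apply Hn2; now exists w. }
  assert (Hall : forall l, (forall Q', In Q' l -> is_quarter Q' Q) ->
    exists z, K z /\ forall Q' w, In Q' l -> K w -> in_box Q' w -> phi w < phi z).
  { induction l as [|Q' l IH]; intros Hl.
    - exists z0; split; [exact Hz0|intros ? ? []].
    - destruct IH as (u & Ku & Hu); [intros; apply Hl; now right|].
      destruct (Hf Q' (Hl Q' (or_introl eq_refl))) as (v & Kv & Hv).
      destruct (Rle_dec (phi u) (phi v)) as [h|h]; [exists v|exists u]; split; try assumption;
        intros Q'' w [<-|Hin] Kw Hw.
      + now apply Hv.
      + specialize (Hu Q'' w Hin Kw Hw); lra.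
      + specialize (Hv w Kw Hw); lra.
      + now apply (Hu Q''). }
  destruct (Hall (quarters Q) (fun Q' H => H)) as (v & Kv & Hv).
  destruct (HQ v Kv) as (w & Kw & bw & Hw).
  destruct (quarter_cover Q w bw) as (Q' & Hq & hb).
  specialize (Hv Q' w Hq Kw hb); lra.
- assert (Kz : K z).
  { apply HK; intros e He; destruct (Hz e He) as [Q' [_ [_ [hb [hs hP]]]]].
    destruct (hP z0 Hz0) as [w [hw [bw _]]]; exists w; split; [exact hw|].
    assert (t := in_box_dist _ _ _ hb bw); lra. }
  exists z; split; [exact Kz|].
  intros u Hu; apply Rnot_lt_le; intros Hl.
  destruct (Hc z Kz (phi u - phi z)) as [d [hd Hd]]; [lra|].
  destruct (Hz d hd) as [Q' [_ [_ [hb [hs hP]]]]].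
  destruct (hP u Hu) as [w [hw [bw l]]].
  assert (t := in_box_dist _ _ _ hb bw).
  assert (A := Hd w hw ltac:(lra)); apply Rabs_lt_between in A; lra.
Qed.

(** Bisection on the failure of uniformity. The point [w] may lie outside the box, since [ccont]
    looks at a full neighbourhood; the difference quotients in [derivative_differentiable] use
    this. *)
Lemma uniform_continuity_box (Q : box) (g : C -> C) : box_wf Q ->
  (forall z, in_box Q z -> ccont g z) ->
  forall eps, 0 < eps -> exists d, 0 < d /\
    forall z w, in_box Q z -> Cmod (w - z) < d -> Cmod (g w - g z) < eps.
Proof.
intros HQ Hc eps He; apply NNPP; intros Hn.
set (P := fun Q' => ~ exists d, 0 < d /\
    forall z w, in_box Q' z -> Cmod (w - z) < d -> Cmod (g w - g z) < eps).
destruct (bisect_point P Q HQ Hn) as [z [Hin Hz]].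
- intros Q' _ _ HP; apply NNPP; intros Hn'; apply HP.
  assert (Hf : forall Q'', is_quarter Q'' Q' -> exists d, 0 < d /\
    forall z w, in_box Q'' z -> Cmod (w - z) < d -> Cmod (g w - g z) < eps).
  { intros Q'' Hq; apply NNPP; intros K; apply Hn'; now exists Q''. }
  assert (Hall : forall l, (forall Q'', In Q'' l -> is_quarter Q'' Q') -> exists d, 0 < d /\
    forall Q'' z w, In Q'' l -> in_box Q'' z -> Cmod (w - z) < d -> Cmod (g w - g z) < eps).
  { induction l as [|Q'' l IH]; intros Hl.
    - exists 1; split; [lra|intros ? ? ? []].
    - destruct IH as (d & Hd & Fd); [intros; apply Hl; now right|].
      destruct (Hf Q'' (Hl Q'' (or_introl eq_refl))) as (d' & Hd' & Fd').
      assert (m := Rmin_spec d d').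
      exists (Rmin d d'); split; [now apply Rmin_glb_lt|]; intros Q3 u w [<-|Hin] Hu Hw.
      + apply Fd'; [exact Hu|lra].
      + apply (Fd Q3); [exact Hin|exact Hu|lra]. }
  destruct (Hall (quarters Q') (fun Q'' H => H)) as (d & Hd & Fd).
  exists d; split; [exact Hd|]; intros u w Hu Hw.
  destruct (quarter_cover Q' u Hu) as (Q'' & Hq & hb); now apply (Fd Q'').
- destruct (Hc z Hin (eps / 2)) as [d [hd Hd]]; [lra|].
  destruct (Hz (d / 2)) as [Q' [_ [_ [hb [hs hP]]]]]; [lra|].
  apply hP; exists (d / 2); split; [lra|].
  intros u w Hu Hw.
  assert (t := in_box_dist _ _ _ hb Hu).
  assert (A := Hd u ltac:(lra)).
  assert (T := Cmod_triangle (w - u) (u - z)).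
  replace (w - u + (u - z))%C with (w - z)%C in T by ring.
  assert (A' := Hd w ltac:(lra)).
  assert (T' := Cmod_triangle (g w - g z) (- (g u - g z))).
  rewrite Cmod_opp in T'; replace (g w - g z + - (g u - g z))%C with (g w - g u)%C in T' by ring.
  lra.
Qed.

Lemma dist_Re_Im (z w : C) (r : R) : Cmod (w - z) < r ->
  Re z - r < Re w < Re z + r /\ Im z - r < Im w < Im z + r.
Proof.
intros H; assert (X := re_le_Cmod (w - z)); assert (Y := im_le_Cmod (w - z)).
apply Rle_lt_trans with (2 := H) in X; apply Rle_lt_trans with (2 := H) in Y.
apply Rabs_lt_between in X; apply Rabs_lt_between in Y; destruct z, w; simpl in *; lra.
Qed.

Definition in_interior (Q : box) (z : C) := xmin Q < Re z < xmax Q /\ ymin Q < Im z < ymax Q.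

Lemma in_interior_in_box Q z : in_interior Q z -> in_box Q z.
Proof. unfold in_interior, in_box; lra. Qed.

Lemma in_interior_open Q z : in_interior Q z -> exists d, 0 < d /\ forall w, Cmod (w - z) < d -> in_interior Q w.
Proof.
intros Hz.
set (x := Rmin (Re z - xmin Q) (xmax Q - Re z)); set (y := Rmin (Im z - ymin Q) (ymax Q - Im z)).
exists (Rmin x y); split; [unfold in_interior in Hz; repeat apply Rmin_glb_lt; lra|]; intros w Hw.
assert (m := Rmin_spec x y).
assert (mx' := Rmin_spec (Re z - xmin Q) (xmax Q - Re z)); assert (my' := Rmin_spec (Im z - ymin Q) (ymax Q - Im z)).
apply dist_Re_Im in Hw; fold x in mx'; fold y in my'; unfold in_interior; lra.
Qed.

(** * Goursat's theorem *)

Lemma norm_Cmod (x : C) : @norm R_AbsRing C_R_NormedModule x = Cmod x.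
Proof. symmetry; apply Cmod_norm. Qed.

Lemma scal_C_R (t : R) (x : C) : @scal R_AbsRing C_R_NormedModule t x = (RtoC t * x)%C.
Proof.
destruct x as [a b].
change (@scal R_AbsRing C_R_NormedModule t (a, b)) with (t * a, t * b).
unfold RtoC, Cmult; simpl; f_equal; ring.
Qed.

Lemma is_derive_path (F : C -> C) (z u l : C) (t : R) :
  cdiff F (z + RtoC t * u)%C l ->
  @is_derive R_AbsRing C_R_NormedModule (fun s : R => F (z + RtoC s * u)%C) t (u * l)%C.
Proof.
intros H; split; [apply is_linear_scal_l|].
intros x Hx eps.
apply (is_filter_lim_locally_unique (V := R_NormedModule)) in Hx; subst x.
assert (Hu := Cmod_ge_0 u).
destruct (H (eps / (Cmod u + 1))) as [d [Hd Hg]].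
{ apply Rdiv_lt_0_compat; [apply cond_pos|lra]. }
assert (Hd' : 0 < d / (Cmod u + 1)) by (apply Rdiv_lt_0_compat; lra).
exists (mkposreal _ Hd').
change (forall s : R, Rabs (s - t) < d / (Cmod u + 1) ->
  @norm R_AbsRing C_R_NormedModule (minus (minus (F (z + RtoC s * u)%C) (F (z + RtoC t * u)%C))
     (@scal R_AbsRing C_R_NormedModule (s - t) (u * l)%C)) <= eps * Rabs (s - t)).
intros s Hs.
rewrite scal_C_R, norm_Cmod.
change (Cmod (F (z + RtoC s * u) - F (z + RtoC t * u) - RtoC (s - t) * (u * l))%C <= eps * Rabs (s - t)).
assert (Hh : Cmod (RtoC (s - t) * u)%C < d).
{ rewrite Cmod_mult, Cmod_R.
  apply Rle_lt_trans with (Rabs (s - t) * (Cmod u + 1)).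
  - apply Rmult_le_compat_l; [apply Rabs_pos|lra].
  - replace d with (d / (Cmod u + 1) * (Cmod u + 1)) by (field; lra).
    apply Rmult_lt_compat_r; lra. }
specialize (Hg _ Hh).
replace (z + RtoC t * u + RtoC (s - t) * u)%C with (z + RtoC s * u)%C in Hg
  by (rewrite RtoC_minus; ring).
replace (RtoC (s - t) * (u * l))%C with (l * (RtoC (s - t) * u))%C by ring.
eapply Rle_trans; [exact Hg|].
rewrite Cmod_mult, Cmod_R.
replace (eps / (Cmod u + 1) * (Rabs (s - t) * Cmod u)) with
  (eps * Rabs (s - t) * (Cmod u / (Cmod u + 1))) by (field; lra).
rewrite <- (Rmult_1_r (eps * Rabs (s - t))) at 2.
apply Rmult_le_compat_l.
- apply Rmult_le_pos; [apply Rlt_le, cond_pos|apply Rabs_pos].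
- apply Rle_div_l; lra.
Qed.

Lemma continuous_path (g : C -> C) (z u : C) (t : R) :
  ccont g (z + RtoC t * u)%C ->
  @continuous R_UniformSpace C_R_NormedModule (fun s : R => g (z + RtoC s * u)%C) t.
Proof.
intros H.
apply (proj2 (filterlim_locally (F := locally t) (fun s : R => g (z + RtoC s * u)%C : C_R_NormedModule) _)).
intros eps.
destruct (H eps (cond_pos eps)) as [d [Hd Hg]].
assert (Hu := Cmod_ge_0 u).
assert (Hd' : 0 < d / (Cmod u + 1)) by (apply Rdiv_lt_0_compat; lra).
exists (mkposreal _ Hd').
change (forall s : R, Rabs (s - t) < d / (Cmod u + 1) ->
  @ball C_R_NormedModule (g (z + RtoC t * u)%C) eps (g (z + RtoC s * u)%C)).
intros s Hs.
apply (norm_compat1 (V := C_R_NormedModule)).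
rewrite norm_Cmod; apply Hg.
replace (z + RtoC s * u - (z + RtoC t * u))%C with (RtoC (s - t) * u)%C by (rewrite RtoC_minus; ring).
rewrite Cmod_mult, Cmod_R.
apply Rle_lt_trans with (Rabs (s - t) * (Cmod u + 1)).
- apply Rmult_le_compat_l; [apply Rabs_pos|lra].
- replace d with (d / (Cmod u + 1) * (Cmod u + 1)) by (field; lra).
  apply Rmult_lt_compat_r; lra.
Qed.

(** The integral is over the real parameter; the factor [u] of [dz = u ds] is supplied where it is
    used. *)
Definition seg_int (g : C -> C) (z u : C) (a b : R) : C :=
  @RInt C_R_CompleteNormedModule (fun s : R => g (z + RtoC s * u)%C) a b.

Definition ccont_seg (g : C -> C) (z u : C) (a b : R) : Prop :=
  forall s, a <= s <= b -> ccont g (z + RtoC s * u)%C.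

Lemma ex_seg_int g z u a b : a <= b -> ccont_seg g z u a b ->
  @ex_RInt C_R_CompleteNormedModule (fun s : R => g (z + RtoC s * u)%C) a b.
Proof.
intros Hab H; apply (ex_RInt_continuous (V := C_R_CompleteNormedModule)).
intros s Hs; rewrite Rmin_left, Rmax_right in Hs by lra.
apply continuous_path, H, Hs.
Qed.

Lemma seg_int_chasles g z u a b c : a <= b <= c -> ccont_seg g z u a c ->
  seg_int g z u a c = (seg_int g z u a b + seg_int g z u b c)%C.
Proof.
intros Hab H; unfold seg_int; symmetry.
apply (RInt_Chasles (V := C_R_CompleteNormedModule)); apply ex_seg_int; try lra;
 intros s Hs; apply H; lra.
Qed.

Lemma seg_int_minus f g z u a b : a <= b -> ccont_seg f z u a b -> ccont_seg g z u a b ->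
  seg_int (fun w => f w - g w)%C z u a b = (seg_int f z u a b - seg_int g z u a b)%C.
Proof.
intros Hab Hf Hg; unfold seg_int.
apply (RInt_minus (V := C_R_CompleteNormedModule)
 (fun s : R => f (z + RtoC s * u)%C) (fun s : R => g (z + RtoC s * u)%C)); now apply ex_seg_int.
Qed.

Lemma seg_int_bound g z u a b M : a <= b -> ccont_seg g z u a b ->
  (forall s, a <= s <= b -> Cmod (g (z + RtoC s * u)%C) <= M) ->
  Cmod (seg_int g z u a b) <= (b - a) * M.
Proof.
intros Hab Hc H; rewrite <- norm_Cmod.
apply (norm_RInt_le_const (V := C_R_NormedModule) (fun s : R => g (z + RtoC s * u)%C)); [exact Hab| |].
- intros s Hs; rewrite norm_Cmod; now apply H.
- apply (RInt_correct (V := C_R_CompleteNormedModule)); now apply ex_seg_int.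
Qed.

Lemma seg_int_derive (F g : C -> C) z u a b : a <= b ->
  (forall s, a <= s <= b -> cdiff F (z + RtoC s * u)%C (g (z + RtoC s * u)%C)) ->
  ccont_seg g z u a b ->
  (u * seg_int g z u a b = F (z + RtoC b * u) - F (z + RtoC a * u))%C.
Proof.
intros Hab HF Hc.
assert (A : @is_RInt C_R_NormedModule (fun s : R => (fun w => u * g w)%C (z + RtoC s * u)%C) a b
   (minus (F (z + RtoC b * u)%C) (F (z + RtoC a * u)%C))).
{ apply (is_RInt_derive (V := C_R_CompleteNormedModule) (fun s : R => F (z + RtoC s * u)%C)).
  - intros s Hs; rewrite Rmin_left, Rmax_right in Hs by lra; apply is_derive_path, HF, Hs.
  - intros s Hs; rewrite Rmin_left, Rmax_right in Hs by lra.
    apply (continuous_path (fun w => u * g w)%C).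
    intros eps He; assert (Hu := Cmod_ge_0 u).
    destruct (Hc s Hs (eps / (Cmod u + 1))) as [d [Hd Hg]]; [apply Rdiv_lt_0_compat; lra|].
    exists d; split; [exact Hd|]; intros w Hw; specialize (Hg w Hw).
    replace (u * g w - u * g (z + s * u))%C with (u * (g w - g (z + s * u)))%C by ring.
    rewrite Cmod_mult; apply Rle_lt_trans with ((Cmod u + 1) * Cmod (g w - g (z + s * u)%C)).
    + apply Rmult_le_compat_r; [apply Cmod_ge_0|lra].
    + replace eps with ((Cmod u + 1) * (eps / (Cmod u + 1))) by (field; lra).
      apply Rmult_lt_compat_l; lra. }
(* Multiplication by the complex number [u] is not a scalar multiplication of the real module, so it
   is integrated by components. *)
assert (B : @is_RInt C_R_NormedModule (fun s : R => (u * g (z + RtoC s * u))%C) a b (u * seg_int g z u a b)%C).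
{ assert (I : @is_RInt C_R_NormedModule (fun s : R => g (z + RtoC s * u)%C) a b (seg_int g z u a b))
    by (apply (RInt_correct (V := C_R_CompleteNormedModule)); now apply ex_seg_int).
  set (G := fun s : R => g (z + RtoC s * u)%C) in *.
  assert (I1 := is_RInt_fct_extend_fst G a b _ I).
  assert (I2 := is_RInt_fct_extend_snd G a b _ I).
  assert (Hp : forall f : R -> C, f = (fun s => (fst (f s), snd (f s)))).
  { intros f; apply FunctionalExtensionality.functional_extensionality; intros s; now destruct (f s). }
  rewrite (Hp (fun s => u * g (z + RtoC s * u))%C).
  rewrite (surjective_pairing (u * seg_int g z u a b)%C).
  apply (is_RInt_fct_extend_pair (U := R_NormedModule) (V := R_NormedModule)); simpl.
  - apply (is_RInt_minus (V := R_NormedModule)); apply (is_RInt_scal (V := R_NormedModule)); assumption.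
  - apply (is_RInt_plus (V := R_NormedModule)); apply (is_RInt_scal (V := R_NormedModule)); assumption. }
apply (is_RInt_unique (V := C_R_CompleteNormedModule)) in A.
apply (is_RInt_unique (V := C_R_CompleteNormedModule)) in B.
rewrite <- B; exact A.
Qed.

(** The contour integral along the boundary, anticlockwise: bottom minus top, plus [Ci] times right
    minus left. *)
Definition box_integral (g : C -> C) (Q : box) : C :=
  (seg_int g (0, ymin Q) 1 (xmin Q) (xmax Q) - seg_int g (0, ymax Q) 1 (xmin Q) (xmax Q)
   + Ci * (seg_int g (xmax Q, 0) Ci (ymin Q) (ymax Q) - seg_int g (xmin Q, 0) Ci (ymin Q) (ymax Q)))%C.

Lemma hor_pt (x y : R) : ((0, y) + RtoC x * 1)%C = (x, y).
Proof. unfold RtoC, Cplus, Cmult; simpl; f_equal; ring. Qed.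
Lemma ver_pt (x y : R) : ((x, 0) + RtoC y * Ci)%C = (x, y).
Proof. unfold RtoC, Ci, Cplus, Cmult; simpl; f_equal; ring. Qed.

Definition ccont_box (g : C -> C) (Q : box) := forall z, in_box Q z -> ccont g z.

Lemma ccont_box_hor g Q a b y : ccont_box g Q -> xmin Q <= a -> b <= xmax Q -> ymin Q <= y <= ymax Q ->
  ccont_seg g (0, y) 1 a b.
Proof. intros H h1 h2 h3 s Hs; rewrite hor_pt; apply H; unfold in_box; simpl; lra. Qed.

Lemma ccont_box_ver g Q a b x : ccont_box g Q -> ymin Q <= a -> b <= ymax Q -> xmin Q <= x <= xmax Q ->
  ccont_seg g (x, 0) Ci a b.
Proof. intros H h1 h2 h3 s Hs; rewrite ver_pt; apply H; unfold in_box; simpl; lra. Qed.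

Lemma box_integral_quarters g Q : box_wf Q -> ccont_box g Q ->
  box_integral g Q = (box_integral g (quarter_sw Q) + box_integral g (quarter_se Q) + box_integral g (quarter_nw Q) + box_integral g (quarter_ne Q))%C.
Proof.
intros HQ Hc; unfold box_integral, quarter_sw, quarter_se, quarter_nw, quarter_ne; simpl.
unfold box_wf in HQ.
assert (Hx : xmin Q <= xmid Q <= xmax Q) by (unfold xmid; lra).
assert (Hy : ymin Q <= ymid Q <= ymax Q) by (unfold ymid; lra).
rewrite (seg_int_chasles g (0, ymin Q) 1 (xmin Q) (xmid Q) (xmax Q)) by
  (try lra; eapply ccont_box_hor; try eassumption; lra).
rewrite (seg_int_chasles g (0, ymax Q) 1 (xmin Q) (xmid Q) (xmax Q)) by
  (try lra; eapply ccont_box_hor; try eassumption; lra).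
rewrite (seg_int_chasles g (xmin Q, 0) Ci (ymin Q) (ymid Q) (ymax Q)) by
  (try lra; eapply ccont_box_ver; try eassumption; lra).
rewrite (seg_int_chasles g (xmax Q, 0) Ci (ymin Q) (ymid Q) (ymax Q)) by
  (try lra; eapply ccont_box_ver; try eassumption; lra).
ring.
Qed.

Lemma box_integral_derive F g Q : box_wf Q -> (forall z, in_box Q z -> cdiff F z (g z)) -> ccont_box g Q -> box_integral g Q = 0%C.
Proof.
intros HQ HF Hc; unfold box_wf in HQ; unfold box_integral.
assert (E1 : forall y, ymin Q <= y <= ymax Q ->
  seg_int g (0, y) 1 (xmin Q) (xmax Q) = (F (xmax Q, y) - F (xmin Q, y))%C).
{ intros y Hy; rewrite <- (Cmult_1_l (seg_int g (0, y) 1 (xmin Q) (xmax Q))), (seg_int_derive F), !hor_pt.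
  - reflexivity.
  - lra.
  - intros s Hs; rewrite hor_pt; apply HF; unfold in_box; simpl; lra.
  - eapply ccont_box_hor; try eassumption; lra. }
assert (E2 : forall x, xmin Q <= x <= xmax Q ->
  (Ci * seg_int g (x, 0) Ci (ymin Q) (ymax Q))%C = (F (x, ymax Q) - F (x, ymin Q))%C).
{ intros x Hx; rewrite (seg_int_derive F), !ver_pt.
  - reflexivity.
  - lra.
  - intros s Hs; rewrite ver_pt; apply HF; unfold in_box; simpl; lra.
  - eapply ccont_box_ver; try eassumption; lra. }
rewrite !E1 by lra.
match goal with |- context [(Ci * (?a - ?b))%C] => replace (Ci * (a - b))%C with (Ci * a - Ci * b)%C by ring end.
rewrite !E2 by lra; ring.
Qed.

Lemma box_integral_minus f g Q : box_wf Q -> ccont_box f Q -> ccont_box g Q ->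
  box_integral (fun z => f z - g z)%C Q = (box_integral f Q - box_integral g Q)%C.
Proof.
intros HQ Hf Hg; unfold box_wf in HQ; unfold box_integral.
rewrite !seg_int_minus; try lra; try (eapply ccont_box_hor; try eassumption; lra);
  try (eapply ccont_box_ver; try eassumption; lra).
ring.
Qed.

Lemma box_integral_bound g Q M : box_wf Q -> ccont_box g Q -> (forall z, in_box Q z -> Cmod (g z) <= M) ->
  Cmod (box_integral g Q) <= 2 * box_size Q * M.
Proof.
intros HQ Hc H; unfold box_wf in HQ; unfold box_integral, box_size.
assert (B1 : forall y, ymin Q <= y <= ymax Q -> Cmod (seg_int g (0, y) 1 (xmin Q) (xmax Q)) <= (xmax Q - xmin Q) * M).
{ intros y Hy; apply seg_int_bound; [lra|eapply ccont_box_hor; try eassumption; lra|].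
  intros s Hs; rewrite hor_pt; apply H; unfold in_box; simpl; lra. }
assert (B2 : forall x, xmin Q <= x <= xmax Q -> Cmod (seg_int g (x, 0) Ci (ymin Q) (ymax Q)) <= (ymax Q - ymin Q) * M).
{ intros y Hy; apply seg_int_bound; [lra|eapply ccont_box_ver; try eassumption; lra|].
  intros s Hs; rewrite ver_pt; apply H; unfold in_box; simpl; lra. }
eapply Rle_trans; [apply Cmod_triangle|].
rewrite Cmod_mult, Cmod_Ci.
assert (T1 := Cmod_triangle_minus (seg_int g (0, ymin Q) 1 (xmin Q) (xmax Q)) (seg_int g (0, ymax Q) 1 (xmin Q) (xmax Q))).
assert (T2 := Cmod_triangle_minus (seg_int g (xmax Q, 0) Ci (ymin Q) (ymax Q)) (seg_int g (xmin Q, 0) Ci (ymin Q) (ymax Q))).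
assert (b1 := B1 (ymin Q) ltac:(lra)); assert (b2 := B1 (ymax Q) ltac:(lra)).
assert (b3 := B2 (xmin Q) ltac:(lra)); assert (b4 := B2 (xmax Q) ltac:(lra)).
lra.
Qed.

Lemma in_box_sub Q Q' z : sub_box Q' Q -> in_box Q' z -> in_box Q z.
Proof. unfold sub_box, in_box; lra. Qed.

(** Bisection keeps the ratio of the integral to the square of the size at least [k]. Near the limit
    point [g] is affine up to an error of [k / 4] times the distance; the affine part has a
    primitive, and the rest contributes at most half of [k] times the square of the size. *)
Lemma goursat g Q : box_wf Q -> (forall z, in_box Q z -> exists l, cdiff g z l) -> box_integral g Q = 0%C.
Proof.
intros HQ Hd.
assert (Hc : ccont_box g Q) by (intros z Hz; destruct (Hd z Hz) as [l Hl]; exact (cdiff_ccont _ _ _ Hl)).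
apply NNPP; intros Hn.
assert (Hp : 0 < Cmod (box_integral g Q)) by now apply Cmod_gt_0.
assert (Hs : 0 <= box_size Q) by (unfold box_wf, box_size in *; lra).
destruct (Rle_lt_or_eq_dec _ _ Hs) as [Hs'|Hs'].
(* A box of size 0 is a single point and its integral is 0; it is excluded before dividing by the
   size. *)
2: { destruct (Hd (xmin Q, ymin Q)) as [l Hl]; [unfold in_box, box_wf in *; simpl; lra|].
  assert (B := box_integral_bound g Q (Cmod (g (xmin Q, ymin Q))) HQ Hc).
  rewrite <- Hs' in B; assert (Cmod (box_integral g Q) <= 2 * 0 * Cmod (g (xmin Q, ymin Q))); [|lra].
  apply B; intros z Hz; right; do 2 f_equal; unfold in_box, box_wf, box_size in *; destruct z as [x y]; simpl in *.
  f_equal; lra. }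
set (k := Cmod (box_integral g Q) / box_size Q ^ 2).
assert (Hsq : 0 < box_size Q ^ 2) by (apply pow_lt; lra).
assert (Hk : 0 < k) by (apply Rdiv_lt_0_compat; lra).
destruct (bisect_point (fun Q' => 0 < box_size Q' /\ k * box_size Q' ^ 2 <= Cmod (box_integral g Q')) Q HQ) as [z [Hz HP]].
- split; [lra|]; unfold k; right; field; lra.
- intros Q' h1 h2 [h0 h3]; apply NNPP; intros Hn'.
  assert (Hf : forall Q'', is_quarter Q'' Q' -> Cmod (box_integral g Q'') < k * (box_size Q' ^ 2) / 4).
  { intros Q'' Hq; apply Rnot_le_lt; intros Hl; apply Hn'; exists Q''; split; [exact Hq|].
    destruct (quarter_props _ _ h1 Hq) as [_ [_ ->]]; lra. }
  assert (Hc' : ccont_box g Q') by (intros w Hw; apply Hc; now apply (in_box_sub _ Q')).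
  rewrite (box_integral_quarters g Q' h1 Hc') in h3.
  assert (F1 := Hf (quarter_sw Q') ltac:(unfold is_quarter; simpl; tauto)).
  assert (F2 := Hf (quarter_se Q') ltac:(unfold is_quarter; simpl; tauto)).
  assert (F3 := Hf (quarter_nw Q') ltac:(unfold is_quarter; simpl; tauto)).
  assert (F4 := Hf (quarter_ne Q') ltac:(unfold is_quarter; simpl; tauto)).
  assert (T1 := Cmod_triangle (box_integral g (quarter_sw Q') + box_integral g (quarter_se Q') + box_integral g (quarter_nw Q')) (box_integral g (quarter_ne Q'))).
  assert (T2 := Cmod_triangle (box_integral g (quarter_sw Q') + box_integral g (quarter_se Q')) (box_integral g (quarter_nw Q'))).
  assert (T3 := Cmod_triangle (box_integral g (quarter_sw Q')) (box_integral g (quarter_se Q'))).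
  lra.
- destruct (Hd z Hz) as [l Hl].
  destruct (Hl (k / 4) ltac:(lra)) as [d [Hd0 Hg]].
  destruct (HP d Hd0) as [Q' [h1 [h2 [h3 [h4 [h0 h5]]]]]].
  set (A := fun w : C => (g z + l * (w - z))%C).
  assert (HA : forall w, cdiff A w l).
  { intros w; unfold A; eapply cdiff_eq; [apply cdiff_plus; [apply cdiff_const|apply cdiff_scal]|].
    - apply cdiff_minus; [apply cdiff_id|apply cdiff_const].
    - ring. }
  assert (HcA : ccont_box A Q') by (intros w _; exact (cdiff_ccont _ _ _ (HA w))).
  assert (Hc' : ccont_box g Q') by (intros w Hw; apply Hc; now apply (in_box_sub _ Q')).
  assert (JA : box_integral A Q' = 0%C).
  { apply (box_integral_derive (fun w => g z * w + l * ((w - z) * (w - z) * / 2))%C); [exact h1| |exact HcA].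
    intros w _; unfold A; eapply cdiff_eq.
    - apply cdiff_plus; [apply cdiff_scal, cdiff_id|apply cdiff_scal].
      apply cdiff_mult; [|apply cdiff_const].
      apply cdiff_mult; apply cdiff_minus; try apply cdiff_id; apply cdiff_const.
    - cbv beta; field. }
  assert (HJ := box_integral_minus g A Q' h1 Hc' HcA).
  rewrite JA in HJ; replace (box_integral g Q' - 0)%C with (box_integral g Q') in HJ by ring.
  rewrite <- HJ in h5.
  assert (HB : Cmod (box_integral (fun w => g w - A w)%C Q') <= 2 * box_size Q' * (k / 4 * box_size Q')).
  { apply box_integral_bound; [exact h1| |].
    - intros w Hw; destruct (Hd w (in_box_sub _ _ _ h2 Hw)) as [l' Hl'].
      exact (cdiff_ccont _ _ _ (cdiff_minus _ _ _ _ _ Hl' (HA w))).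
    - intros w Hw; assert (D := in_box_dist _ _ _ h3 Hw).
      specialize (Hg (w - z)%C ltac:(lra)).
      replace (z + (w - z))%C with w in Hg by ring.
      unfold A; replace (g w - (g z + l * (w - z)))%C with (g w - g z - l * (w - z))%C by ring.
      eapply Rle_trans; [exact Hg|apply Rmult_le_compat_l; lra]. }
  assert (0 < k * box_size Q' ^ 2) by (apply Rmult_lt_0_compat; [lra|apply pow_lt; lra]).
  lra.
Qed.

(** * Primitives on boxes *)

Lemma seg_int_const c z u a b : seg_int (fun _ => c) z u a b = (RtoC (b - a) * c)%C.
Proof.
unfold seg_int; rewrite (RInt_const (V := C_R_CompleteNormedModule)); apply scal_C_R.
Qed.

Lemma ccont_const c z : ccont (fun _ => c) z.
Proof. exact (cdiff_ccont _ _ _ (cdiff_const c z)). Qed.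

Lemma ccont_plus f g z : ccont f z -> ccont g z -> ccont (fun w => f w + g w)%C z.
Proof.
intros Hf Hg e He.
destruct (Hf (e / 2)) as [d [hd Hd]]; [lra|]; destruct (Hg (e / 2)) as [d' [hd' Hd']]; [lra|].
exists (Rmin d d'); split; [now apply Rmin_glb_lt|]; intros w Hw.
assert (h1 := Rmin_spec d d').
specialize (Hd w ltac:(lra)); specialize (Hd' w ltac:(lra)).
replace (f w + g w - (f z + g z))%C with ((f w - f z) + (g w - g z))%C by ring.
assert (T := Cmod_triangle (f w - f z) (g w - g z)); lra.
Qed.

Lemma ccont_opp g z : ccont g z -> ccont (fun w => - g w)%C z.
Proof.
intros H e He; destruct (H e He) as [d [hd Hd]]; exists d; split; [exact hd|]; intros w Hw.
replace (- g w - - g z)%C with (- (g w - g z))%C by ring; rewrite Cmod_opp; now apply Hd.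
Qed.

Lemma ccont_minus f g z : ccont f z -> ccont g z -> ccont (fun w => f w - g w)%C z.
Proof. intros Hf Hg; apply (ccont_plus f (fun w => - g w)%C); [exact Hf|now apply ccont_opp]. Qed.

Lemma seg_int_near g z u a b c e : a <= b -> ccont_seg g z u a b ->
  (forall s, a <= s <= b -> Cmod (g (z + RtoC s * u)%C - c) <= e) ->
  Cmod (seg_int g z u a b - RtoC (b - a) * c) <= (b - a) * e.
Proof.
intros Hab Hc H.
rewrite <- (seg_int_const c z u a b), <- seg_int_minus; try assumption.
- apply seg_int_bound; [exact Hab| |exact H].
  intros s Hs; apply ccont_minus; [now apply Hc|apply ccont_const].
- intros s Hs; apply ccont_const.
Qed.

(** Integral from the lower left corner, horizontally and then vertically; [box_primitive_fun_alt]
    gives the other route. *)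
Definition box_primitive_fun (g : C -> C) (Q : box) (z : C) : C :=
  (seg_int g (0, ymin Q) 1 (xmin Q) (Re z) + Ci * seg_int g (Re z, 0) Ci (ymin Q) (Im z))%C.

Lemma box_primitive_fun_alt g Q z : box_wf Q -> (forall w, in_box Q w -> exists l, cdiff g w l) -> in_box Q z ->
  box_primitive_fun g Q z = (Ci * seg_int g (xmin Q, 0) Ci (ymin Q) (Im z) + seg_int g (0, Im z) 1 (xmin Q) (Re z))%C.
Proof.
intros HQ Hd Hz; unfold box_primitive_fun.
assert (G := goursat g (Box (xmin Q) (Re z) (ymin Q) (Im z))).
unfold box_integral in G; simpl in G.
match type of G with _ -> _ -> (?a - ?b + Ci * (?c - ?d))%C = _ => set (A := a) in *; set (B := b) in *; set (D := c) in *; set (E := d) in * end.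
assert (H : (A - B + Ci * (D - E))%C = 0%C).
{ apply G; [unfold box_wf, in_box in *; simpl; lra|].
  intros w Hw; apply Hd; unfold in_box in *; simpl in *; lra. }
replace (A + Ci * D)%C with ((A - B + Ci * (D - E)) + (Ci * E + B))%C by ring.
rewrite H; ring.
Qed.

(** Each of the two routes from the corner makes one partial derivative evident. An increment
    [s + i t] is split into a horizontal step, read off the vertical-first route, and a vertical
    step, read off the horizontal-first route; both are compared with the constant [g z]. *)
Lemma box_primitive g Q : (forall w, in_box Q w -> exists l, cdiff g w l) ->
  exists G, forall z, in_interior Q z -> cdiff G z (g z).
Proof.
intros Hd.
exists (box_primitive_fun g Q); intros z Hz.
assert (HQ : box_wf Q) by (unfold in_interior, box_wf in *; lra).
assert (Hc : ccont_box g Q) by (intros w Hw; destruct (Hd w Hw) as [l Hl]; exact (cdiff_ccont _ _ _ Hl)).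
intros eps He.
destruct (Hc z ltac:(unfold in_interior, in_box in *; lra) (eps / 2) ltac:(lra)) as [d [Hd0 Hg]].
destruct (in_interior_open Q z Hz) as (r & Hr & Hball).
exists (Rmin (d / 2) r); split; [apply Rmin_glb_lt; lra|].
intros h Hh.
assert (m := Rmin_spec (d / 2) r).
assert (Hzh := Hball (z + h)%C ltac:(replace (z + h - z)%C with h by ring; lra)).
assert (Hx := re_le_Cmod h); assert (Hy := im_le_Cmod h).
unfold in_interior in Hz, Hzh.
destruct z as [x y]; destruct h as [s t]; simpl in *.
assert (Near : forall u v, Rabs (u - x) <= Rabs s -> Rabs (v - y) <= Rabs t ->
   Cmod (g (u, v) - g (x, y)) <= eps / 2).
{ intros u v Hu Hv; apply Rlt_le, Hg.
  eapply Rle_lt_trans; [apply Cmod_le_Re_Im|]; simpl.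
  apply Rle_lt_trans with (Rabs s + Rabs t); [apply Rplus_le_compat; assumption|lra]. }
assert (Hor : forall a b, a <= b -> xmin Q <= a -> b <= xmax Q ->
   (forall u, a <= u <= b -> Rabs (u - x) <= Rabs s) ->
   Cmod (box_primitive_fun g Q (b, y) - box_primitive_fun g Q (a, y) - RtoC (b - a) * g (x, y)) <= (b - a) * (eps / 2)).
{ intros a b Hab Ha Hb Hu.
  rewrite !box_primitive_fun_alt; try assumption; try (unfold in_box; simpl; lra); simpl.
  rewrite (seg_int_chasles g (0, y) 1 (xmin Q) a b); [|lra|].
  - match goal with |- Cmod ?X <= _ =>
      replace X with (seg_int g (0, y) 1 a b - RtoC (b - a) * g (x, y))%C by ring end.
    apply seg_int_near; [exact Hab|eapply ccont_box_hor; try eassumption; lra|].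
    intros u Huu; rewrite hor_pt; apply Near; [now apply Hu|].
    rewrite Rminus_diag, Rabs_R0; apply Rabs_pos.
  - eapply ccont_box_hor; try eassumption; lra. }
assert (Ver : forall a b x', a <= b -> ymin Q <= a -> b <= ymax Q -> xmin Q <= x' <= xmax Q ->
   Rabs (x' - x) <= Rabs s ->
   (forall u, a <= u <= b -> Rabs (u - y) <= Rabs t) ->
   Cmod (box_primitive_fun g Q (x', b) - box_primitive_fun g Q (x', a) - RtoC (b - a) * (Ci * g (x, y))) <= (b - a) * (eps / 2)).
{ intros a b x' Hab Ha Hb Hx1 Hx2 Hu.
  unfold box_primitive_fun; simpl.
  rewrite (seg_int_chasles g (x', 0) Ci (ymin Q) a b); [|lra|].
  - match goal with |- Cmod ?X <= _ =>
      replace X with (Ci * (seg_int g (x', 0) Ci a b - RtoC (b - a) * g (x, y)))%C by ring end.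
    rewrite Cmod_mult, Cmod_Ci, Rmult_1_l.
    apply seg_int_near; [exact Hab|eapply ccont_box_ver; try eassumption; lra|].
    intros u Huu; rewrite ver_pt; apply Near; [exact Hx2|now apply Hu].
  - eapply ccont_box_ver; try eassumption; lra. }
assert (A1 : Cmod (box_primitive_fun g Q ((x + s)%R, y) - box_primitive_fun g Q (x, y) - RtoC s * g (x, y)) <= Rabs s * (eps / 2)).
{ destruct (Rle_dec 0 s) as [Hs|Hs].
  - assert (H := Hor x (x + s) ltac:(lra) ltac:(lra) ltac:(lra)).
    replace (x + s - x) with s in H by ring.
    rewrite (Rabs_pos_eq s) by exact Hs; apply H.
    intros u Hu; rewrite !Rabs_pos_eq; lra.
  - assert (H := Hor (x + s) x ltac:(lra) ltac:(lra) ltac:(lra)).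
    replace (x - (x + s)) with (- s) in H by ring.
    rewrite Rabs_left by lra.
    rewrite <- Cmod_opp.
    match goal with |- Cmod ?X <= _ =>
      replace X with (box_primitive_fun g Q (x, y) - box_primitive_fun g Q ((x + s)%R, y) - RtoC (- s) * g (x, y))%C
       by (rewrite RtoC_opp; ring) end.
    apply H; intros u Hu; rewrite !Rabs_left1; lra. }
assert (Hxs : Rabs (x + s - x) <= Rabs s) by (replace (x + s - x) with s by ring; lra).
assert (A2 : Cmod (box_primitive_fun g Q ((x + s)%R, (y + t)%R) - box_primitive_fun g Q ((x + s)%R, y) - RtoC t * (Ci * g (x, y))) <= Rabs t * (eps / 2)).
{ destruct (Rle_dec 0 t) as [Hs|Hs].
  - assert (H := Ver y (y + t) (x + s) ltac:(lra) ltac:(lra) ltac:(lra) ltac:(lra) Hxs).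
    replace (y + t - y) with t in H by ring.
    rewrite (Rabs_pos_eq t) by exact Hs; apply H.
    intros u Hu; rewrite !Rabs_pos_eq; lra.
  - assert (H := Ver (y + t) y (x + s) ltac:(lra) ltac:(lra) ltac:(lra) ltac:(lra) Hxs).
    replace (y - (y + t)) with (- t) in H by ring.
    rewrite (Rabs_left t) by lra.
    rewrite <- Cmod_opp.
    match goal with |- Cmod ?X <= _ =>
      replace X with (box_primitive_fun g Q ((x + s)%R, y) - box_primitive_fun g Q ((x + s)%R, (y + t)%R) - RtoC (- t) * (Ci * g (x, y)))%C
       by (rewrite RtoC_opp; ring) end.
    apply H; intros u Hu; rewrite !Rabs_left1; lra. }
change ((x, y) + (s, t))%C with ((x + s)%R, (y + t)%R).
replace (box_primitive_fun g Q ((x + s)%R, (y + t)%R) - box_primitive_fun g Q (x, y) - g (x, y) * (s, t))%C with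
  ((box_primitive_fun g Q ((x + s)%R, y) - box_primitive_fun g Q (x, y) - RtoC s * g (x, y)) +
   (box_primitive_fun g Q ((x + s)%R, (y + t)%R) - box_primitive_fun g Q ((x + s)%R, y) - RtoC t * (Ci * g (x, y))))%C.
2: { replace (s, t) with (RtoC s + Ci * RtoC t)%C by (unfold RtoC, Ci, Cplus, Cmult; simpl; f_equal; ring). ring. }
eapply Rle_trans; [apply Cmod_triangle|].
nra.
Qed.

(** * The mean value inequality *)

Lemma is_derive_Re_path (F : C -> C) (z u l : C) (t : R) :
  cdiff F (z + RtoC t * u)%C l ->
  is_derive (fun s : R => Re (F (z + RtoC s * u)%C)) t (Re (u * l)%C).
Proof.
intros H; apply is_derive_path in H.
destruct H as [_ H]; split; [apply is_linear_scal_l|].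
intros x Hx eps; specialize (H x Hx eps).
apply filter_imp with (2 := H); intros s Hs.
eapply Rle_trans; [|exact Hs].
rewrite norm_Cmod, scal_C_R.
match goal with |- _ <= Cmod ?X => eapply Rle_trans; [|apply (re_le_Cmod X)] end.
right; unfold norm; simpl; unfold abs; simpl; f_equal.
unfold minus, plus, opp, scal; simpl; unfold mult; simpl.
destruct (F (z + s * u)%C); destruct (F (z + x * u)%C); destruct u, l; simpl; unfold minus, plus, opp; simpl; ring.
Qed.

Lemma Cconj_mult_self z : (Cconj z * z)%C = RtoC (Cmod z ^ 2).
Proof. rewrite Cmult_comm, <- Cmod2_conj, RtoC_pow; reflexivity. Qed.

(** The real mean value theorem for [Re (Cconj v * F)] with [v = F (a + h) - F a]: this function
    increases by [|v|^2] along the segment, and its derivative is at most [|h| |v| M]. *)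
Lemma mvt_bound (F F1 : C -> C) (a h : C) (M : R) :
  (forall t, 0 <= t <= 1 -> cdiff F (a + RtoC t * h)%C (F1 (a + RtoC t * h)%C)) ->
  (forall t, 0 <= t <= 1 -> Cmod (F1 (a + RtoC t * h)%C) <= M) ->
  Cmod (F (a + h)%C - F a) <= M * Cmod h.
Proof.
intros HF HM.
set (v := (F (a + h)%C - F a)%C).
set (u := fun t : R => Re ((fun w => Cconj v * F w)%C (a + RtoC t * h)%C)).
destruct (MVT_gen u 0 1 (fun t => Re (h * (Cconj v * F1 (a + RtoC t * h)))%C)) as [c [Hc Huc]].
- intros t Ht; rewrite Rmin_left, Rmax_right in Ht by lra.
  apply (is_derive_Re_path (fun w => Cconj v * F w)%C), cdiff_scal, HF; lra.
- intros t Ht; rewrite Rmin_left, Rmax_right in Ht by lra.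
  apply continuity_pt_filterlim, (ex_derive_continuous u).
  eexists; apply (is_derive_Re_path (fun w => Cconj v * F w)%C), cdiff_scal, HF; lra.
- rewrite Rmin_left, Rmax_right in Hc by lra.
  assert (E : u 1 - u 0 = Cmod v ^ 2).
  { unfold u; replace (a + 1 * h)%C with (a + h)%C by ring; replace (a + 0 * h)%C with a by ring.
    assert (X := Cconj_mult_self v).
    assert (Y : (Cconj v * F (a + h) - Cconj v * F a)%C = RtoC (Cmod v ^ 2)) by (rewrite <- X; unfold v; ring).
    apply (f_equal Re) in Y; simpl in Y |- *.
    rewrite <- Y; destruct (F (a + h)%C), (F a), (Cconj v); simpl; ring. }
  rewrite E in Huc.
  destruct (Req_dec (Cmod v) 0) as [e|e].
  { rewrite e; apply Rmult_le_pos; [|apply Cmod_ge_0].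
    eapply Rle_trans; [apply Cmod_ge_0|apply (HM 0); lra]. }
  assert (Hv := Cmod_ge_0 v).
  assert (L : Re (h * (Cconj v * F1 (a + c * h)))%C <= Cmod h * (Cmod v * M)).
  { eapply Rle_trans; [apply Rle_abs|].
    eapply Rle_trans; [apply re_le_Cmod|].
    rewrite !Cmod_mult, Cmod_conj.
    apply Rmult_le_compat_l; [apply Cmod_ge_0|].
    apply Rmult_le_compat_l; [exact Hv|apply HM, Hc]. }
  apply Rmult_le_reg_l with (Cmod v); nra.
Qed.

(** * Maximum principle *)

(** A provisional notion: that derivatives are differentiable is itself deduced from the maximum
    principle, which therefore has to assume a second derivative at the point. *)
Definition twice_cdiff (F : C -> C) (z : C) : Prop := exists F1 d c, 0 < d /\
  (forall w, Cmod (w - z) < d -> cdiff F w (F1 w)) /\ cdiff F1 z c.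

(** The mean value inequality for [F] minus its quadratic polynomial, whose derivative is at most
    [eps |h|] on the segment. *)
Lemma taylor2 (F F1 : C -> C) (z c : C) (d : R) : 0 < d ->
  (forall w, Cmod (w - z) < d -> cdiff F w (F1 w)) -> cdiff F1 z c ->
  forall eps, 0 < eps -> exists delta, 0 < delta /\ forall h, Cmod h < delta ->
    Cmod (F (z + h) - F z - F1 z * h - c / 2 * (h * h))%C <= eps * (Cmod h * Cmod h).
Proof.
intros Hd HF HF1 eps He.
destruct (HF1 eps He) as [e [He0 Hg]].
exists (Rmin d e); split; [now apply Rmin_glb_lt|]; intros h Hh.
assert (h1 := Rmin_spec d e).
set (P := fun w => (F w - F1 z * (w - z) - c / 2 * ((w - z) * (w - z)))%C).
assert (small : forall t, 0 <= t <= 1 -> Cmod (RtoC t * h) <= Cmod h).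
{ intros t Ht; rewrite Cmod_mult, Cmod_R, Rabs_pos_eq by lra.
  assert (H0 := Cmod_ge_0 h); nra. }
assert (B := mvt_bound P (fun w => F1 w - F1 z - c * (w - z))%C z h (eps * Cmod h)).
replace (F (z + h) - F z - F1 z * h - c / 2 * (h * h))%C with (P (z + h) - P z)%C by (unfold P; ring).
eapply Rle_trans; [apply B|right; ring].
- intros t Ht; unfold P.
  eapply cdiff_eq.
  + apply cdiff_minus; [apply cdiff_minus|].
    * apply HF; replace (z + t * h - z)%C with (t * h)%C by ring; specialize (small t Ht); lra.
    * apply cdiff_scal, cdiff_minus; [apply cdiff_id|apply cdiff_const].
    * apply cdiff_scal, cdiff_mult; (apply cdiff_minus; [apply cdiff_id|apply cdiff_const]).
  + cbv beta; field.
- intros t Ht; specialize (small t Ht).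
  replace (z + t * h - z)%C with (t * h)%C by ring.
  eapply Rle_trans; [apply Hg; lra|].
  apply Rmult_le_compat_l; lra.
Qed.

Lemma Cmod_sqr (z : C) : Cmod z ^ 2 = Re z ^ 2 + Im z ^ 2.
Proof. apply Cmod2_alt. Qed.

(* At an interior maximum of [|F| + e |z|^2], average over [z1 + h], [z1 - h], [z1 + i h], [z1 - i h]:
   the Taylor terms of [F] of order one and two cancel, while [|z|^2] grows by [h^2]. *)
Lemma max_principle_twice_cdiff (K B : C -> Prop) (F : C -> C) (M : R) :
  cclosed K -> cbounded K ->
  (forall z, K z -> ccont F z) ->
  (forall z, K z -> B z \/ ((exists d, 0 < d /\ forall w, Cmod (w - z) < d -> K w) /\ twice_cdiff F z)) ->
  (forall z, K z -> B z -> Cmod (F z) <= M) ->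
  forall z, K z -> Cmod (F z) <= M.
Proof.
intros HK [Bd HBd] Hc Hin HM z0 Hz0.
apply Rnot_lt_le; intros Hlt.
(* So small that [e |z|^2] cannot make up for the gap [|F z0| - M] anywhere on [K]: the maximum
   found below is not attained on [B]. *)
set (e := (Cmod (F z0) - M) / (2 * (Bd ^ 2 + 1))).
assert (He : 0 < e) by (apply Rdiv_lt_0_compat; nra).
assert (He' : e * Bd ^ 2 < Cmod (F z0) - M).
{ apply Rlt_le_trans with (e * (2 * (Bd ^ 2 + 1))); [apply Rmult_lt_compat_l; nra|].
  unfold e; right; field; nra. }
assert (Hsq : forall w, K w -> Cmod w ^ 2 <= Bd ^ 2).
{ intros w Hw; apply pow_incr; split; [apply Cmod_ge_0|now apply HBd]. }
destruct (extreme_value K (fun z => Cmod (F z) + e * Cmod z ^ 2)) as [z1 [Kz1 Hz1]]; try assumption.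
- now exists Bd.
- now exists z0.
- intros z Hz eps Heps.
  destruct (Hc z Hz (eps / 2)) as [d [Hd Hg]]; [lra|].
  set (B2 := e * (2 * Bd + 1)).
  assert (0 <= Bd) by (eapply Rle_trans; [apply Cmod_ge_0|exact (HBd _ Hz)]).
  assert (HB2 : 0 < B2) by (apply Rmult_lt_0_compat; lra).
  exists (Rmin d (eps / (2 * B2))); split; [apply Rmin_glb_lt; [lra|apply Rdiv_lt_0_compat; lra]|].
  intros w Kw Hw.
  assert (h1 := Rmin_spec d (eps / (2 * B2))).
  specialize (Hg w ltac:(lra)).
  assert (a1 := Cmod_triangle_sub (F w) (F z)); assert (a2 := Cmod_triangle_sub (F z) (F w)).
  rewrite (Cmod_sub_sym (F z)) in a2.
  assert (b1 := Cmod_triangle_sub w z); assert (b2 := Cmod_triangle_sub z w).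
  rewrite (Cmod_sub_sym z w) in b2.
  assert (c1 := HBd _ Kw); assert (c2 := HBd _ Hz); assert (c3 := Cmod_ge_0 w); assert (c4 := Cmod_ge_0 z).
  assert (Hd' : Cmod (w - z) * B2 < eps / 2).
  { replace (eps / 2) with (eps / (2 * B2) * B2) by (field; lra).
    apply Rmult_lt_compat_r; lra. }
  assert (c5 := Cmod_ge_0 (w - z)).
  assert (S1 : Rabs (e * (Cmod w ^ 2 - Cmod z ^ 2)) <= Cmod (w - z) * B2).
  { rewrite Rabs_mult, (Rabs_pos_eq e) by lra.
    unfold B2; replace (Cmod (w - z) * (e * (2 * Bd + 1))) with (e * (Cmod (w - z) * (2 * Bd + 1))) by ring.
    apply Rmult_le_compat_l; [lra|].
    replace (Cmod w ^ 2 - Cmod z ^ 2) with ((Cmod w - Cmod z) * (Cmod w + Cmod z)) by ring.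
    rewrite Rabs_mult; apply Rmult_le_compat; try apply Rabs_pos.
    - apply Rabs_le; lra.
    - rewrite Rabs_pos_eq; lra. }
  apply Rabs_le_between in S1.
  apply Rabs_lt_between; lra.
- assert (H0 := Hz1 z0 Hz0); simpl in H0.
  assert (P0 := Cmod_ge_0 z0).
  assert (e0 : 0 <= e * Cmod z0 ^ 2) by (apply Rmult_le_pos; [lra|apply pow2_ge_0]).
  assert (e1 : e * Cmod z1 ^ 2 <= e * Bd ^ 2) by (apply Rmult_le_compat_l; [lra|now apply Hsq]).
  destruct (Hin z1 Kz1) as [b|[[d [Hd Hball]] [F1 [d1 [c [Hd1 [HF HF1]]]]]]].
  { specialize (HM z1 Kz1 b); simpl in *; lra. }
  (* With [e / 2] the four Taylor errors add up to at most [2 e h^2], less than the gain [4 e h^2]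
     of the quadratic terms. *)
  destruct (taylor2 F F1 z1 c d1 Hd1 HF HF1 (e / 2) ltac:(lra)) as [d2 [Hd2 HT]].
  set (h := Rmin d d2 / 2).
  assert (m1 := Rmin_spec d d2).
  assert (Hm : 0 < Rmin d d2) by now apply Rmin_glb_lt.
  assert (Hh : 0 < h < d /\ h < d2) by (unfold h; lra).
  assert (Est : forall u, Cmod u = 1 ->
     Cmod (F (z1 + RtoC h * u) - F z1 - F1 z1 * (RtoC h * u) - c / 2 * (RtoC h * u * (RtoC h * u)))%C
       <= e / 2 * (h * h) /\ Cmod (F (z1 + RtoC h * u)%C) + e * Cmod (z1 + RtoC h * u) ^ 2 <= Cmod (F z1) + e * Cmod z1 ^ 2).
  { intros u Hu.
    assert (Cmod (RtoC h * u) = h) by (rewrite Cmod_mult, Hu, Cmod_R, Rabs_pos_eq; lra).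
    split.
    - eapply Rle_trans; [apply HT; lra|]. rewrite H; lra.
    - apply (Hz1 (z1 + RtoC h * u)%C), Hball.
      replace (z1 + h * u - z1)%C with (h * u)%C by ring; lra. }
  destruct (Est 1%C Cmod_1) as [u1 v1]; destruct (Est (- (1))%C Cmod_m1) as [u2 v2].
  destruct (Est Ci Cmod_Ci) as [u3 v3].
  destruct (Est (- Ci)%C ltac:(rewrite Cmod_opp; apply Cmod_Ci)) as [u4 v4].
  assert (Sq : Cmod (z1 + RtoC h * 1) ^ 2 + Cmod (z1 + RtoC h * - (1)) ^ 2 +
     Cmod (z1 + RtoC h * Ci) ^ 2 + Cmod (z1 + RtoC h * - Ci) ^ 2 = 4 * Cmod z1 ^ 2 + 4 * (h * h)).
  { rewrite !Cmod_sqr; destruct z1; simpl; ring. }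
  match type of u1 with Cmod ?X <= _ => set (X1 := X) in * end.
  match type of u2 with Cmod ?X <= _ => set (X2 := X) in * end.
  match type of u3 with Cmod ?X <= _ => set (X3 := X) in * end.
  match type of u4 with Cmod ?X <= _ => set (X4 := X) in * end.
  assert (Id : (4 * F z1 = F (z1 + RtoC h * 1) + F (z1 + RtoC h * - (1)) + F (z1 + RtoC h * Ci)
     + F (z1 + RtoC h * - Ci) - (X1 + X2 + X3 + X4))%C).
  { unfold X1, X2, X3, X4.
    assert (CC : (Ci * Ci = - (1))%C) by (unfold Ci, Cmult, Copp, RtoC; simpl; f_equal; ring).
    set (a := F (z1 + h * 1)%C); set (b := F (z1 + h * - (1))%C); set (a' := F (z1 + h * Ci)%C); set (b' := F (z1 + h * - Ci)%C).
    replace (h * Ci * (h * Ci))%C with (h * h * (Ci * Ci))%C by ring.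
    replace (h * - Ci * (h * - Ci))%C with (h * h * (Ci * Ci))%C by ring.
    rewrite CC; ring. }
  apply (f_equal Cmod) in Id; rewrite Cmod_mult, (Cmod_R 4), (Rabs_pos_eq 4) in Id by lra.
  match type of Id with _ = Cmod (?a + ?b + ?c' + ?d' - (_ + _ + _ + _))%C =>
    assert (T1 := Cmod_triangle_minus (a + b + c' + d') (X1 + X2 + X3 + X4));
    assert (T2 := Cmod_triangle (a + b + c') d'); assert (T3 := Cmod_triangle (a + b) c'); assert (T4 := Cmod_triangle a b) end.
  assert (T5 := Cmod_triangle (X1 + X2 + X3) X4); assert (T6 := Cmod_triangle (X1 + X2) X3); assert (T7 := Cmod_triangle X1 X2).
  assert (0 < h * h) by (apply Rmult_lt_0_compat; lra).
  nra.
Qed.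

Lemma twice_cdiff_mult F G z : twice_cdiff F z -> twice_cdiff G z -> twice_cdiff (fun w => F w * G w)%C z.
Proof.
intros (F1 & d & c & Hd & HF & HF1) (G1 & d' & c' & Hd' & HG & HG1).
exists (fun w => F1 w * G w + F w * G1 w)%C, (Rmin d d'),
  ((c * G z + F1 z * G1 z) + (F1 z * G1 z + F z * c'))%C.
assert (h1 := Rmin_spec d d').
assert (Z : Cmod (z - z) < Rmin d d').
{ replace (z - z)%C with (RtoC 0) by ring; rewrite Cmod_0; now apply Rmin_glb_lt. }
split; [now apply Rmin_glb_lt|split].
- intros w Hw; apply cdiff_mult; [apply HF; lra|apply HG; lra].
- apply cdiff_plus; apply cdiff_mult; try assumption; [apply HG|apply HF]; lra.
Qed.

Lemma twice_cdiff_ext_loc F G z d : 0 < d -> (forall w, Cmod (w - z) < d -> F w = G w) -> twice_cdiff F z -> twice_cdiff G z.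
Proof.
intros Hd He (F1 & d' & c & Hd' & HF & HF1).
exists F1, (Rmin d d' / 2), c.
assert (h1 := Rmin_spec d d').
assert (Hm : 0 < Rmin d d') by now apply Rmin_glb_lt.
split; [lra|split; [|exact HF1]].
intros w Hw; apply (cdiff_ext_loc F _ _ _ (Rmin d d' / 2)); [lra| |apply HF; lra].
intros v Hv; apply He.
assert (T := Cmod_dist_triangle v w z); lra.
Qed.

Lemma twice_cdiff_intro F F1 z d c : 0 < d -> (forall w, Cmod (w - z) < d -> cdiff F w (F1 w)) -> cdiff F1 z c -> twice_cdiff F z.
Proof. intros; now exists F1, d, c. Qed.

Lemma twice_cdiff_const c z : twice_cdiff (fun _ => c) z.
Proof. apply (twice_cdiff_intro _ (fun _ => RtoC 0) z 1 0); [lra|intros; apply cdiff_const|apply cdiff_const]. Qed.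

Lemma twice_cdiff_pow F z N : twice_cdiff F z -> twice_cdiff (fun w => F w ^ N)%C z.
Proof.
intros H; induction N as [|N IH]; [exact (twice_cdiff_const 1 z)|].
exact (twice_cdiff_mult F (fun w => F w ^ N)%C z H IH).
Qed.

Lemma twice_cdiff_linear c z : twice_cdiff (fun w => w - c)%C z.
Proof.
apply (twice_cdiff_intro _ (fun _ => 1%C) z 1 0); [lra| |apply cdiff_const].
intros w _; eapply cdiff_eq; [apply cdiff_minus; [apply cdiff_id|apply cdiff_const]|ring].
Qed.

Lemma twice_cdiff_inv_linear c z : z <> c -> twice_cdiff (fun w => / (w - c))%C z.
Proof.
intros Hz.
assert (Hzc : (z - c)%C <> 0%C) by (intros e; apply Hz; replace z with ((z - c) + c)%C by ring; rewrite e; ring).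
assert (Hm : 0 < Cmod (z - c)) by now apply Cmod_gt_0.
assert (Hl : forall w, cdiff (fun v => v - c)%C w 1%C).
{ intros w; eapply cdiff_eq; [apply cdiff_minus; [apply cdiff_id|apply cdiff_const]|ring]. }
apply (twice_cdiff_intro _ (fun w => - (1) / ((w - c) * (w - c)))%C z (Cmod (z - c))
  ((0 * ((z - c) * (z - c)) - - (1) * (1 * (z - c) + (z - c) * 1)) / (((z - c) * (z - c)) * ((z - c) * (z - c))))%C); [exact Hm| |].
- intros w Hw; apply (cdiff_inv (fun v => v - c)%C); [|apply Hl].
  intros e; replace w with c in Hw by (replace w with ((w - c) + c)%C by ring; rewrite e; ring).
  rewrite Cmod_sub_sym in Hw; lra.
- apply (cdiff_div (fun _ => - (1))%C (fun w => (w - c) * (w - c))%C).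
  + now apply Cmult_neq_0.
  + apply cdiff_const.
  + exact (cdiff_mult _ _ _ _ _ (Hl z) (Hl z)).
Qed.

Definition square (z : C) (r : R) : box := Box (Re z - r) (Re z + r) (Im z - r) (Im z + r).

Lemma in_box_closed Q : cclosed (in_box Q).
Proof.
intros z H; apply NNPP; intros Hn.
assert (Hx : exists e, 0 < e /\ forall w, in_box Q w -> e <= Cmod (w - z)).
{ assert (S : Re z < xmin Q \/ xmax Q < Re z \/ Im z < ymin Q \/ ymax Q < Im z).
  { apply NNPP; intros K; apply Hn; unfold in_box; lra. }
  destruct S as [S|[S|[S|S]]].
  - exists (xmin Q - Re z); split; [lra|]; intros w Hw.
    assert (A := re_le_Cmod (w - z)); assert (B := Rle_abs (Re (w - z))); unfold in_box in Hw; destruct w, z; simpl in *; lra.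
  - exists (Re z - xmax Q); split; [lra|]; intros w Hw; rewrite Cmod_sub_sym.
    assert (A := re_le_Cmod (z - w)); assert (B := Rle_abs (Re (z - w))); unfold in_box in Hw; destruct w, z; simpl in *; lra.
  - exists (ymin Q - Im z); split; [lra|]; intros w Hw.
    assert (A := im_le_Cmod (w - z)); assert (B := Rle_abs (Im (w - z))); unfold in_box in Hw; destruct w, z; simpl in *; lra.
  - exists (Im z - ymax Q); split; [lra|]; intros w Hw; rewrite Cmod_sub_sym.
    assert (A := im_le_Cmod (z - w)); assert (B := Rle_abs (Im (z - w))); unfold in_box in Hw; destruct w, z; simpl in *; lra. }
destruct Hx as [e [He Hx]]; destruct (H e He) as [w [Hw Hd]]; specialize (Hx w Hw); lra.
Qed.

Lemma in_box_bounded Q : cbounded (in_box Q).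
Proof.
exists (Rabs (xmin Q) + Rabs (xmax Q) + (Rabs (ymin Q) + Rabs (ymax Q))); intros z [Hx Hy].
eapply Rle_trans; [apply Cmod_le_Re_Im|].
assert (A := Rle_abs (xmin Q)); assert (B := Rle_abs (xmax Q)); assert (D := Rle_abs (ymin Q)); assert (E := Rle_abs (ymax Q)).
assert (A' := Rle_abs (- xmin Q)); assert (B' := Rle_abs (- xmax Q)); assert (D' := Rle_abs (- ymin Q)); assert (E' := Rle_abs (- ymax Q)).
rewrite Rabs_Ropp in A', B', D', E'.
assert (P := Rabs_pos (xmin Q)); assert (P1 := Rabs_pos (xmax Q)); assert (P2 := Rabs_pos (ymin Q)); assert (P3 := Rabs_pos (ymax Q)).
apply Rplus_le_compat; apply Rabs_le; lra.
Qed.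

(** Taking [N]-th roots and letting [N] tend to infinity removes the constants [a] and [b]. *)
Lemma pow_root_bound (x M a b : R) : 0 <= M -> 0 < a ->
  (forall N, x ^ N * a <= M ^ N * b) -> 0 <= x -> x <= M.
Proof.
intros HM Ha H Hx; apply Rnot_lt_le; intros Hl.
destruct (Req_dec M 0) as [->|HM0].
{ specialize (H 1%nat); simpl in H; nra. }
assert (Hq : 1 < x / M) by (apply Rlt_div_r; lra).
destruct (Pow_x_infinity (x / M) ltac:(rewrite Rabs_pos_eq; lra) (Rabs (b / a) + 1)) as [N HN].
specialize (HN N (le_n N)); specialize (H N).
rewrite Rabs_pos_eq in HN by (apply pow_le; lra).
assert (MN : 0 < M ^ N) by (apply pow_lt; lra).
assert (E : (x / M) ^ N = x ^ N / M ^ N) by (unfold Rdiv; rewrite Rpow_mult_distr, pow_inv; reflexivity).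
rewrite E in HN.
assert (L : x ^ N / M ^ N <= b / a).
{ apply Rle_div_l; [exact MN|]. replace (b / a * M ^ N) with (M ^ N * b / a) by (field; lra).
  apply Rle_div_r; lra. }
assert (T := Rle_abs (b / a)); lra.
Qed.

Lemma ccont_mult F G w : ccont F w -> ccont G w -> ccont (fun v => F v * G v)%C w.
Proof.
intros HF HG e He.
destruct (HF 1 Rlt_0_1) as [d [Hd0 Hd]].
set (A := Cmod (F w) + 1); assert (HA : 0 < A) by (unfold A; assert (T := Cmod_ge_0 (F w)); lra).
set (B := Cmod (G w) + 1); assert (HB : 0 < B) by (unfold B; assert (T := Cmod_ge_0 (G w)); lra).
destruct (HF (e / (2 * B))) as [d' [Hd0' Hd']]; [apply Rdiv_lt_0_compat; lra|].
destruct (HG (e / (2 * A))) as [d'' [Hd0'' Hd'']]; [apply Rdiv_lt_0_compat; lra|].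
exists (Rmin (Rmin d d') d''); split.
{ repeat apply Rmin_glb_lt; assumption. }
intros v Hv.
assert (a1 := Rmin_spec (Rmin d d') d'').
assert (a3 := Rmin_spec d d').
specialize (Hd v ltac:(lra)); specialize (Hd' v ltac:(lra)); specialize (Hd'' v ltac:(lra)).
replace (F v * G v - F w * G w)%C with (F v * (G v - G w) + (F v - F w) * G w)%C by ring.
eapply Rle_lt_trans; [apply Cmod_triangle|]; rewrite !Cmod_mult.
assert (T := Cmod_triangle_sub (F v) (F w)).
assert (p1 := Cmod_ge_0 (G v - G w)); assert (p2 := Cmod_ge_0 (F v)); assert (p3 := Cmod_ge_0 (F v - F w)).
assert (p4 := Cmod_ge_0 (G w)).
assert (e1 : Cmod (F v) * Cmod (G v - G w) <= A * Cmod (G v - G w)) by (apply Rmult_le_compat_r; unfold A; lra).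
assert (e2 : A * Cmod (G v - G w) < e / 2).
{ replace (e / 2) with (A * (e / (2 * A))) by (field; lra). apply Rmult_lt_compat_l; lra. }
assert (e3 : Cmod (F v - F w) * Cmod (G w) <= e / (2 * B) * B) by (apply Rmult_le_compat; try (unfold B; lra); lra).
replace (e / (2 * B) * B) with (e / 2) in e3 by (field; lra).
lra.
Qed.

Lemma ccont_pow F w N : ccont F w -> ccont (fun v => F v ^ N)%C w.
Proof.
intros H; induction N as [|N IH]; [exact (ccont_const 1 w)|].
exact (ccont_mult F (fun v => F v ^ N)%C w H IH).
Qed.

Lemma twice_cdiff_ccont F z : twice_cdiff F z -> ccont F z.
Proof.
intros (F1 & d & c & Hd & HF & _); apply (cdiff_ccont F z (F1 z)), HF.
replace (z - z)%C with (RtoC 0) by ring; rewrite Cmod_0; exact Hd.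
Qed.

(* [F^N (z - z0)] vanishes at [z0], so no differentiability is needed there; let [N] tend to infinity. *)
Lemma max_principle_exceptional (Q : box) (z0 : C) (F : C -> C) (M : R) :
  in_interior Q z0 -> 0 <= M ->
  (forall z, in_box Q z -> ccont F z) ->
  (forall z, in_interior Q z -> z <> z0 -> twice_cdiff F z) ->
  (forall z, in_box Q z -> ~ in_interior Q z -> Cmod (F z) <= M) ->
  Cmod (F z0) <= M.
Proof.
intros Hz0 HM Hc H2 HB.
destruct (in_box_bounded Q) as [Bd HBd].
assert (HBd' : forall z, in_box Q z -> Cmod (z - z0) <= 2 * Bd).
{ intros z Hz; assert (T := Cmod_triangle_minus z z0); assert (T1 := HBd _ Hz); assert (T2 := HBd _ (in_interior_in_box _ _ Hz0)); lra. }
assert (Hoff : forall z, in_box Q z -> z <> z0 -> Cmod (F z) <= M).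
{ intros z Hz Hzz.
  assert (Hpos : 0 < Cmod (z - z0)).
  { apply Cmod_gt_0; intros e; apply Hzz; replace z with ((z - z0) + z0)%C by ring; rewrite e; ring. }
  apply (pow_root_bound _ M (Cmod (z - z0)) (2 * Bd) HM Hpos); [|apply Cmod_ge_0].
  intros N; rewrite <- Cmod_pow, <- Cmod_mult.
  apply (max_principle_twice_cdiff (in_box Q) (fun w => w = z0 \/ ~ in_interior Q w) (fun w => F w ^ N * (w - z0))%C);
    [apply in_box_closed|now exists Bd| | | |exact Hz].
  - intros w Hw; apply ccont_mult; [now apply ccont_pow, Hc|].
    apply twice_cdiff_ccont, twice_cdiff_linear.
  - intros w Hw; destruct (classic (w = z0)) as [e|e]; [now left; left|].
    destruct (classic (in_interior Q w)) as [i|i]; [right|now left; right].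
    split.
    + destruct (in_interior_open Q w i) as [d [Hd0 Hd]]; exists d; split; [exact Hd0|]; intros v Hv; apply in_interior_in_box, Hd, Hv.
    + apply twice_cdiff_mult; [apply twice_cdiff_pow; now apply H2|apply twice_cdiff_linear].
  - intros w Hw [e|e].
    + subst w; replace (z0 - z0)%C with (RtoC 0) by ring.
      rewrite Cmult_0_r, Cmod_0; apply Rmult_le_pos; [now apply pow_le|].
      eapply Rle_trans; [apply Cmod_ge_0|exact (HBd' _ Hw)].
    + rewrite Cmod_mult, Cmod_pow; apply Rmult_le_compat; try apply Cmod_ge_0; [apply pow_le, Cmod_ge_0| |now apply HBd'].
      apply pow_incr; split; [apply Cmod_ge_0|now apply HB]. }
(* The bound at [z0] itself follows from nearby points by continuity. *)
apply Rnot_lt_le; intros Hl.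
destruct (Hc z0 (in_interior_in_box _ _ Hz0) (Cmod (F z0) - M)) as [d [Hd0 Hd]]; [lra|].
destruct (in_interior_open Q z0 Hz0) as [d' [Hd0' Hd']].
set (r := Rmin d d' / 2).
assert (m1 := Rmin_spec d d').
assert (Hm : 0 < Rmin d d') by now apply Rmin_glb_lt.
set (w := (z0 + RtoC r)%C).
assert (Hw : Cmod (w - z0) = r).
{ unfold w; replace (z0 + r - z0)%C with (RtoC r) by ring; rewrite Cmod_R; apply Rabs_pos_eq; unfold r; lra. }
assert (A : Cmod (F w) <= M).
{ apply Hoff; [apply in_interior_in_box, Hd'; rewrite Hw; unfold r; lra|].
  intros e; rewrite e in Hw; replace (z0 - z0)%C with (RtoC 0) in Hw by ring; rewrite Cmod_0 in Hw; unfold r in Hw; lra. }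
specialize (Hd w ltac:(rewrite Hw; unfold r; lra)).
assert (T := Cmod_triangle_sub (F z0) (F w)); rewrite Cmod_sub_sym in T; lra.
Qed.

(** * Derivative bounds from divided differences *)

Lemma square_boundary z0 r z : in_box (square z0 r) z -> ~ in_interior (square z0 r) z -> r <= Cmod (z - z0).
Proof.
intros H Hn; apply Rnot_lt_le; intros Hl; apply Hn.
assert (X := dist_Re_Im z0 z r ltac:(lra)).
unfold in_interior, square; destruct z, z0; simpl in *; lra.
Qed.

Lemma square_center z0 r : 0 < r -> in_interior (square z0 r) z0.
Proof. intros H; unfold in_interior, square; simpl; lra. Qed.

Lemma Cneq_sub (z w : C) : z <> w -> (z - w)%C <> 0%C.
Proof. intros H e; apply H; replace z with ((z - w) + w)%C by ring; rewrite e; ring. Qed.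

(** Takes the place of Cauchy's integral formula: [F z / (z - z0)^j], completed by [L], is
    continuous at [z0] and twice differentiable elsewhere, so the maximum principle with one
    exceptional point applies to it. *)
Lemma divided_difference_bound (F : C -> C) (z0 L : C) (r M : R) (j : nat) :
  0 < r -> 0 <= M ->
  (forall z, in_box (square z0 r) z -> twice_cdiff F z) ->
  (forall eps, 0 < eps -> exists d, 0 < d /\ forall h, Cmod h < d ->
     Cmod (F (z0 + h) - L * h ^ j)%C <= eps * Cmod h ^ j) ->
  (forall z, in_box (square z0 r) z -> ~ in_interior (square z0 r) z -> Cmod (F z) <= M * Cmod (z - z0) ^ j) ->
  Cmod L <= M.
Proof.
intros Hr HM H2 HL HB.
set (k := fun z => if excluded_middle_informative (z = z0) then L else (F z * (/ (z - z0)) ^ j)%C).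
assert (Ek : forall z, z <> z0 -> k z = (F z * (/ (z - z0)) ^ j)%C).
{ intros z Hz; unfold k; destruct (excluded_middle_informative (z = z0)); [contradiction|reflexivity]. }
assert (Ek0 : k z0 = L).
{ unfold k; destruct (excluded_middle_informative (z0 = z0)); [reflexivity|contradiction]. }
assert (Hinv : forall z, z <> z0 -> ((/ (z - z0)) ^ j * (z - z0) ^ j = 1)%C).
{ intros z Hz; rewrite <- Cpow_mult_l, Cinv_l by now apply Cneq_sub.
  clear; induction j as [|j IH]; simpl; [reflexivity|rewrite IH; ring]. }
assert (K2 : forall z, in_box (square z0 r) z -> z <> z0 -> twice_cdiff k z).
{ intros z Hz Hn.
  apply (twice_cdiff_ext_loc (fun w => F w * (/ (w - z0)) ^ j)%C k z (Cmod (z - z0))).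
  - apply Cmod_gt_0, Cneq_sub, Hn.
  - intros w Hw; symmetry; apply Ek; intros e; subst w; rewrite Cmod_sub_sym in Hw; lra.
  - apply twice_cdiff_mult; [now apply H2|apply twice_cdiff_pow, twice_cdiff_inv_linear, Hn]. }
rewrite <- Ek0.
apply (max_principle_exceptional (square z0 r) z0 k M); [now apply square_center|exact HM| | |].
- intros z Hz; destruct (classic (z = z0)) as [->|Hn]; [|now apply twice_cdiff_ccont, K2].
  intros e He; destruct (HL (e / 2)) as [d [Hd0 Hd]]; [lra|].
  exists d; split; [exact Hd0|]; intros w Hw.
  destruct (classic (w = z0)) as [->|Hn].
  { replace (k z0 - k z0)%C with (RtoC 0) by ring; rewrite Cmod_0; exact He. }
  rewrite Ek0, (Ek w Hn).
  specialize (Hd (w - z0)%C Hw); replace (z0 + (w - z0))%C with w in Hd by ring.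
  replace (F w * (/ (w - z0)) ^ j - L)%C with ((F w - L * (w - z0) ^ j) * (/ (w - z0)) ^ j)%C
    by (rewrite <- (Cmult_1_r L) at 2; rewrite <- (Hinv w Hn); ring).
  rewrite Cmod_mult.
  apply Rle_lt_trans with (e / 2 * Cmod (w - z0) ^ j * Cmod ((/ (w - z0)) ^ j)).
  + apply Rmult_le_compat_r; [apply Cmod_ge_0|exact Hd].
  + assert (E := f_equal Cmod (Hinv w Hn)); rewrite Cmod_mult, Cmod_1, (Cmod_pow (w - z0)) in E.
    replace (e / 2 * Cmod (w - z0) ^ j * Cmod ((/ (w - z0)) ^ j)) with
      (e / 2 * (Cmod ((/ (w - z0)) ^ j) * Cmod (w - z0) ^ j)) by ring.
    rewrite E; lra.
- intros z Hz Hn; apply K2; [now apply in_interior_in_box|exact Hn].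
- intros z Hz Hn.
  assert (Hzz : z <> z0) by (intros e; subst z; apply Hn; now apply square_center).
  rewrite (Ek z Hzz), Cmod_mult.
  apply Rle_trans with (M * Cmod (z - z0) ^ j * Cmod ((/ (z - z0)) ^ j)).
  + apply Rmult_le_compat_r; [apply Cmod_ge_0|now apply HB].
  + assert (E := f_equal Cmod (Hinv z Hzz)); rewrite Cmod_mult, Cmod_1, (Cmod_pow (z - z0)) in E.
    replace (M * Cmod (z - z0) ^ j * Cmod ((/ (z - z0)) ^ j)) with
      (M * (Cmod ((/ (z - z0)) ^ j) * Cmod (z - z0) ^ j)) by ring.
    rewrite E; lra.
Qed.

Lemma twice_cdiff_plus F G z : twice_cdiff F z -> twice_cdiff G z -> twice_cdiff (fun w => F w + G w)%C z.
Proof.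
intros (F1 & d & c & Hd & HF & HF1) (G1 & d' & c' & Hd' & HG & HG1).
exists (fun w => F1 w + G1 w)%C, (Rmin d d'), (c + c')%C.
assert (h1 := Rmin_spec d d').
split; [now apply Rmin_glb_lt|split].
- intros w Hw; apply cdiff_plus; [apply HF; lra|apply HG; lra].
- now apply cdiff_plus.
Qed.

(** Divided differences of [F - F z0] with [j = 1], and of the first-order Taylor remainder with
    [j = 2], the latter with value [c / 2] at [z0]. The hypotheses concern a square twice as large,
    so that every point of the smaller one has a disc of radius [r] around it. *)
Lemma second_derivative_bound (F F1 : C -> C) (z0 c : C) (r m : R) :
  0 < r -> (forall z, in_box (square z0 (2 * r)) z -> cdiff F z (F1 z)) ->
  (forall z, in_box (square z0 (2 * r)) z -> exists l, cdiff F1 z l) ->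
  cdiff F1 z0 c ->
  (forall z, in_box (square z0 (2 * r)) z -> Cmod (F z) <= m) ->
  Cmod (F1 z0) <= 2 * m / r /\ Cmod c <= 8 * m / r ^ 2.
Proof.
intros Hr HF HF1 Hc Hm.
assert (In : forall z w, in_box (square z0 r) z -> Cmod (w - z) < r -> in_box (square z0 (2 * r)) w).
{ intros z w Hz Hw; assert (X := dist_Re_Im z w r ltac:(lra)).
  unfold in_box, square in *; destruct z, z0, w; simpl in *; lra. }
assert (In0 : forall z, in_box (square z0 r) z -> in_box (square z0 (2 * r)) z).
{ intros z Hz; apply (In z z Hz); replace (z - z)%C with (RtoC 0) by ring; rewrite Cmod_0; exact Hr. }
assert (Z0 : in_box (square z0 r) z0) by (apply in_interior_in_box; now apply square_center).
assert (m0 : 0 <= m) by (eapply Rle_trans; [apply Cmod_ge_0|apply (Hm z0), In0, Z0]).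
assert (FD2 : forall z, in_box (square z0 r) z -> twice_cdiff F z).
{ intros z Hz; destruct (HF1 z (In0 z Hz)) as [l Hl].
  apply (twice_cdiff_intro F F1 z r l Hr); [|exact Hl]; intros w Hw; apply HF; now apply (In z). }
assert (B1 : Cmod (F1 z0) <= 2 * m / r).
{ apply (divided_difference_bound (fun z => F z + - F z0)%C z0 (F1 z0) r (2 * m / r) 1 Hr).
  - apply Rdiv_le_0_compat; lra.
  - intros z Hz; apply twice_cdiff_plus; [now apply FD2|apply twice_cdiff_const].
  - intros e He; destruct (HF z0 (In0 _ Z0) e He) as [d [Hd0 Hd]]; exists d; split; [exact Hd0|]; intros h Hh.
    specialize (Hd h Hh).
    replace (F (z0 + h) + - F z0 - F1 z0 * h ^ 1)%C with (F (z0 + h) - F z0 - F1 z0 * h)%C by (simpl; ring).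
    rewrite pow_1; exact Hd.
  - intros z Hz Hn; rewrite pow_1.
    assert (D := square_boundary z0 r z Hz Hn).
    assert (T := Cmod_triangle_minus (F z) (F z0)).
    assert (A := Hm z (In0 _ Hz)); assert (B := Hm z0 (In0 _ Z0)).
    apply Rle_trans with (2 * m); [change (Cmod (F z - F z0) <= 2 * m); lra|].
    replace (2 * m) with (2 * m / r * r) at 1 by (field; lra).
    apply Rmult_le_compat_l; [apply Rdiv_le_0_compat; lra|exact D]. }
split; [exact B1|].
assert (Hr2 : 0 < r ^ 2) by (apply pow_lt; lra).
assert (B2 : Cmod (c / 2) <= 4 * m / r ^ 2).
{ apply (divided_difference_bound (fun z => F z + (- F z0 + - F1 z0 * (z - z0)))%C z0 (c / 2)%C r (4 * m / r ^ 2) 2 Hr).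
  - apply Rdiv_le_0_compat; lra.
  - intros z Hz; apply twice_cdiff_plus; [now apply FD2|]; apply twice_cdiff_plus; [apply twice_cdiff_const|].
    apply twice_cdiff_mult; [apply twice_cdiff_const|apply twice_cdiff_linear].
  - intros e He.
    destruct (taylor2 F F1 z0 c r Hr (fun w Hw => HF w (In z0 w Z0 Hw)) Hc e He) as [d [Hd0 Hd]].
    exists d; split; [exact Hd0|]; intros h Hh; specialize (Hd h Hh).
    replace (F (z0 + h) + (- F z0 + - F1 z0 * (z0 + h - z0)) - c / 2 * h ^ 2)%C with
     (F (z0 + h) - F z0 - F1 z0 * h - c / 2 * (h * h))%C by (simpl; ring).
    replace (Cmod h ^ 2) with (Cmod h * Cmod h) by ring; exact Hd.
  - intros z Hz Hn.
    assert (D := square_boundary z0 r z Hz Hn).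
    assert (A := Hm z (In0 _ Hz)); assert (B := Hm z0 (In0 _ Z0)).
    assert (T1 := Cmod_triangle (F z) (- F z0 + - F1 z0 * (z - z0))).
    assert (T2 := Cmod_triangle (- F z0) (- F1 z0 * (z - z0))).
    rewrite Cmod_mult, !Cmod_opp in T2.
    assert (P : Cmod (F1 z0) * Cmod (z - z0) <= 2 * m / r * Cmod (z - z0)) by (apply Rmult_le_compat_r; [lra|exact B1]).
    set (s := Cmod (z - z0)) in *.
    apply Rle_trans with (2 * m + 2 * m / r * s); [lra|].
    assert (Q1 : 2 * m <= 2 * m / r * s).
    { replace (2 * m) with (2 * m / r * r) at 1 by (field; lra).
      apply Rmult_le_compat_l; [apply Rdiv_le_0_compat; lra|exact D]. }
    replace (4 * m / r ^ 2 * s ^ 2) with (4 * m / r * s * (s / r)) by (field; lra).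
    assert (1 <= s / r) by (apply Rle_div_r; lra).
    assert (0 <= 4 * m / r * s) by (apply Rmult_le_pos; [apply Rdiv_le_0_compat; lra|lra]).
    nra. }
rewrite Cmod_div, (Cmod_R 2), (Rabs_pos_eq 2) in B2 by (try lra; intros e; injection e; lra).
apply Rle_trans with (2 * (4 * m / r ^ 2)); [lra|right; field; lra].
Qed.

(** * Analytic functions *)

Lemma cauchy_limit_at_0 (q : C -> C) :
  (forall e, 0 < e -> exists d, 0 < d /\ forall h k : C, h <> 0%C -> k <> 0%C ->
     Cmod h < d -> Cmod k < d -> Cmod (q h - q k) <= e) ->
  exists c, forall e, 0 < e -> exists d, 0 < d /\ forall h : C, h <> 0%C -> Cmod h < d -> Cmod (q h - c) <= e.
Proof.
intros H.
set (x := fun n : nat => RtoC (/ (INR n + 1))).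
assert (x0 : forall n, x n <> 0%C).
{ intros n e; injection e; apply Rinv_neq_0_compat; assert (T := pos_INR n); lra. }
assert (xs : forall d, 0 < d -> exists N, forall n, (N <= n)%nat -> Cmod (x n) < d).
{ intros d Hd; destruct (archimed_cor1 d Hd) as [N [HN HN0]].
  exists N; intros n Hn; unfold x; rewrite Cmod_R.
  assert (Hle := le_INR _ _ Hn); assert (Hp := lt_0_INR _ HN0).
  rewrite Rabs_pos_eq by (apply Rlt_le, Rinv_0_lt_compat; lra).
  apply Rle_lt_trans with (2 := HN); apply Rinv_le_contravar; lra. }
assert (Cr : Cauchy_crit (fun n => Re (q (x n)))).
{ intros e He; destruct (H (e / 2)) as [d [Hd0 Hd]]; [lra|]; destruct (xs d Hd0) as [N HN].
  exists N; intros n m Hn Hm; unfold Rdist.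
  specialize (Hd _ _ (x0 n) (x0 m) (HN n Hn) (HN m Hm)).
  assert (T := re_le_Cmod (q (x n) - q (x m))).
  replace (Re (q (x n)) - Re (q (x m))) with (Re (q (x n) - q (x m))) by (destruct (q (x n)), (q (x m)); reflexivity).
  lra. }
assert (Ci' : Cauchy_crit (fun n => Im (q (x n)))).
{ intros e He; destruct (H (e / 2)) as [d [Hd0 Hd]]; [lra|]; destruct (xs d Hd0) as [N HN].
  exists N; intros n m Hn Hm; unfold Rdist.
  specialize (Hd _ _ (x0 n) (x0 m) (HN n Hn) (HN m Hm)).
  assert (T := im_le_Cmod (q (x n) - q (x m))).
  replace (Im (q (x n)) - Im (q (x m))) with (Im (q (x n) - q (x m))) by (destruct (q (x n)), (q (x m)); reflexivity).
  lra. }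
destruct (Rcomplete.R_complete _ Cr) as [a Ha]; destruct (Rcomplete.R_complete _ Ci') as [b Hb].
exists (a, b); intros e He.
destruct (H (e / 2)) as [d [Hd0 Hd]]; [lra|].
exists d; split; [exact Hd0|]; intros h Hh Hhd.
destruct (xs d Hd0) as [N HN].
destruct (Ha (e / 4)) as [N1 HN1]; [lra|]; destruct (Hb (e / 4)) as [N2 HN2]; [lra|].
set (n := (N + N1 + N2)%nat).
specialize (HN n ltac:(unfold n; lia)); specialize (HN1 n ltac:(unfold n; lia)); specialize (HN2 n ltac:(unfold n; lia)).
unfold Rdist in *.
specialize (Hd h (x n) Hh (x0 n) Hhd HN).
assert (T := Cmod_triangle (q h - q (x n)) (q (x n) - (a, b))).
replace (q h - q (x n) + (q (x n) - (a, b)))%C with (q h - (a, b))%C in T by ring.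
assert (T1 := Cmod_le_Re_Im (q (x n) - (a, b))).
replace (Re (q (x n) - (a, b))) with (Re (q (x n)) - a) in T1 by (destruct (q (x n)); reflexivity).
replace (Im (q (x n) - (a, b))) with (Im (q (x n)) - b) in T1 by (destruct (q (x n)); reflexivity).
lra.
Qed.

Lemma in_square_dist z0 r w : in_box (square z0 r) w -> Cmod (w - z0) <= 2 * r.
Proof.
intros H; eapply Rle_trans; [apply Cmod_le_Re_Im|].
assert (A : Rabs (Re (w - z0)) <= r) by (unfold in_box, square in H; destruct w, z0; simpl in *; apply Rabs_le; lra).
assert (B : Rabs (Im (w - z0)) <= r) by (unfold in_box, square in H; destruct w, z0; simpl in *; apply Rabs_le; lra).
lra.
Qed.

Lemma square_move z0 r s z w : in_box (square z0 r) z -> Cmod (w - z) < s -> in_interior (square z0 (r + s)) w.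
Proof.
intros Hz Hw; assert (X := dist_Re_Im z w s ltac:(lra)).
unfold in_box, in_interior, square in *; destruct z, z0, w; simpl in *; lra.
Qed.

Lemma Cmod_segment (z h : C) (t : R) : 0 <= t <= 1 -> Cmod (z + RtoC t * h - z)%C <= Cmod h.
Proof.
intros Ht; replace (z + t * h - z)%C with (t * h)%C by ring.
rewrite Cmod_mult, Cmod_R, Rabs_pos_eq by lra.
assert (H0 := Cmod_ge_0 h); nra.
Qed.

(* The difference quotients [E h] of a primitive of [g] converge uniformly to [g], so by the maximum
   principle for divided differences their second derivatives at [z0], which are the difference
   quotients of [g'], form a Cauchy family. *)
Lemma derivative_differentiable (g g1 : C -> C) (z0 : C) (d : R) : 0 < d ->
  (forall w, Cmod (w - z0) < d -> cdiff g w (g1 w)) -> exists c, cdiff g1 z0 c.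
Proof.
intros Hd Hg.
(* The square of half side [6 r] lies within distance [12 r < d] of [z0] and leaves room for
   translating the square of half side [2 r] by [h]. *)
set (r := d / 20).
assert (Hr : 0 < r) by (unfold r; lra).
assert (Hg' : forall w, in_box (square z0 (6 * r)) w -> cdiff g w (g1 w)).
{ intros w Hw; apply Hg; assert (T := in_square_dist _ _ _ Hw); unfold r in T; lra. }
destruct (box_primitive g (square z0 (6 * r))) as [G HG].
{ intros w Hw; exists (g1 w); now apply Hg'. }
assert (UC := uniform_continuity_box (square z0 (2 * r)) g).
set (E := fun h z => ((G (z + h) - G z) / h)%C).
set (E1 := fun h z => ((g (z + h) - g z) / h)%C).
assert (In : forall z h, in_box (square z0 (2 * r)) z -> Cmod h < r -> in_interior (square z0 (6 * r)) (z + h)%C).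
{ intros z h Hz Hh; assert (K : in_interior (square z0 (2 * r + 4 * r)) (z + h)%C).
  - apply (square_move z0 (2 * r) (4 * r) z); [exact Hz|].
    replace (z + h - z)%C with h by ring; lra.
  - now replace (2 * r + 4 * r) with (6 * r) in K by ring. }
assert (In0 : forall z, in_box (square z0 (2 * r)) z -> in_interior (square z0 (6 * r)) z).
{ intros z Hz; replace z with (z + 0)%C by ring; apply In; [exact Hz|rewrite Cmod_0; exact Hr]. }
assert (HE : forall h z : C, h <> 0%C -> Cmod h < r -> in_box (square z0 (2 * r)) z -> cdiff (E h) z (E1 h z)).
{ intros h z Hh Hhr Hz; unfold E, E1.
  eapply cdiff_eq; [apply cdiff_mult; [|apply cdiff_const]|].
  - apply cdiff_minus; [apply cdiff_shift, HG, In; assumption|apply HG, In0, Hz].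
  - cbv beta; field; exact Hh. }
assert (HE1 : forall h z : C, h <> 0%C -> Cmod h < r -> in_box (square z0 (2 * r)) z ->
   cdiff (E1 h) z ((g1 (z + h) - g1 z) / h)%C).
{ intros h z Hh Hhr Hz; unfold E1.
  eapply cdiff_eq; [apply cdiff_mult; [|apply cdiff_const]|].
  - apply cdiff_minus; [apply cdiff_shift, Hg', in_interior_in_box, In; assumption|apply Hg', in_interior_in_box, In0, Hz].
  - cbv beta; field; exact Hh. }
destruct (cauchy_limit_at_0 (fun h => ((g1 (z0 + h) - g1 z0) / h)%C)) as [c Hc].
- intros e He.
  assert (Hr2 : 0 < r ^ 2) by (apply pow_lt; lra).
  (* [second_derivative_bound] turns the bound [2 e'] for a difference of two quotients into
     [16 e' / r^2 = e]. *)
  set (e' := e * r ^ 2 / 16).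
  assert (He' : 0 < e') by (unfold e'; apply Rdiv_lt_0_compat; [apply Rmult_lt_0_compat|]; lra).
  destruct (UC ltac:(unfold box_wf; simpl; lra)
    (fun z Hz => cdiff_ccont _ _ _ (Hg' z (in_interior_in_box _ _ (In0 z Hz)))) e' He') as [d' [Hd' HUC]].
  exists (Rmin d' r); split; [now apply Rmin_glb_lt|].
  assert (m1 := Rmin_spec d' r).
  assert (Unif : forall h z : C, h <> 0%C -> Cmod h < Rmin d' r -> in_box (square z0 (2 * r)) z -> Cmod (E h z - g z) <= e').
  { intros h z Hh Hhr Hz.
    assert (B := mvt_bound (fun w => G w - g z * w)%C (fun w => g w - g z)%C z h e').
    assert (Hh0 : 0 < Cmod h) by now apply Cmod_gt_0.
    replace (E h z - g z)%C with ((G (z + h) - g z * (z + h) - (G z - g z * z)) / h)%C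
      by (unfold E; field; exact Hh).
    rewrite Cmod_div by exact Hh; apply Rle_div_l; [exact Hh0|].
    apply B.
    - intros t Ht; assert (S := Cmod_segment z h t Ht).
      eapply cdiff_eq; [apply cdiff_minus; [apply HG|apply cdiff_scal, cdiff_id]|ring].
      apply In; [exact Hz|].
      replace (z + t * h - z)%C with (t * h)%C in S by ring; lra.
    - intros t Ht; assert (S := Cmod_segment z h t Ht).
      apply Rlt_le, HUC; [exact Hz|lra]. }
  intros h k Hh Hk Hhd Hkd.
  destruct (second_derivative_bound (fun z => E h z - E k z)%C (fun z => E1 h z - E1 k z)%C z0
    ((g1 (z0 + h) - g1 z0) / h - (g1 (z0 + k) - g1 z0) / k)%C r (2 * e') Hr) as [_ B].
  + intros z Hz; apply cdiff_minus; apply HE; try assumption; lra.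
  + intros z Hz; eexists; apply cdiff_minus; apply HE1; try assumption; lra.
  + apply cdiff_minus; apply HE1; try lra; try assumption; apply in_interior_in_box, square_center; lra.
  + intros z Hz; assert (U1 := Unif h z Hh Hhd Hz); assert (U2 := Unif k z Hk Hkd Hz).
    replace (E h z - E k z)%C with ((E h z - g z) - (E k z - g z))%C by ring.
    eapply Rle_trans; [apply Cmod_triangle_minus|lra].
  + eapply Rle_trans; [exact B|]; unfold e'; right; field; lra.
- exists c; intros e He; destruct (Hc e He) as [d' [Hd' Hq]].
  exists d'; split; [exact Hd'|]; intros h Hh.
  destruct (classic (h = 0%C)) as [->|Hn].
  { replace (z0 + 0)%C with z0 by ring; replace (g1 z0 - g1 z0 - c * 0)%C with (RtoC 0) by ring.
    rewrite Cmod_0; lra. }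
  specialize (Hq h Hn Hh).
  replace (g1 (z0 + h) - g1 z0 - c * h)%C with (((g1 (z0 + h) - g1 z0) / h - c) * h)%C by (field; exact Hn).
  rewrite Cmod_mult; apply Rmult_le_compat_r; [apply Cmod_ge_0|exact Hq].
Qed.

(** Differentiability on a full disc is what passes on to [C_derive]; the derivative is left
    existential and recovered through [C_derive]. *)
Definition analytic_at (g : C -> C) (z : C) : Prop :=
  exists d, 0 < d /\ forall w, Cmod (w - z) < d -> exists l, cdiff g w l.

Lemma cdiff_C_derive g z l : cdiff g z l -> C_derive g z = l.
Proof. intros H; apply is_C_derive_unique, cdiff_is_derive, H. Qed.

Lemma analytic_cdiff g z : analytic_at g z -> cdiff g z (C_derive g z).
Proof.
intros (d & Hd & H); destruct (H z) as [l Hl]; [rewrite Cmod_self; exact Hd|].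
now rewrite (cdiff_C_derive _ _ _ Hl).
Qed.

Lemma analytic_near g z : analytic_at g z ->
  exists d, 0 < d /\ forall w, Cmod (w - z) < d -> analytic_at g w.
Proof.
intros (d & Hd & H); exists (d / 2); split; [lra|]; intros w Hw.
exists (d / 2); split; [lra|]; intros v Hv; apply H.
assert (T := Cmod_dist_triangle v w z); lra.
Qed.

Lemma analytic_derive g z : analytic_at g z -> analytic_at (C_derive g) z.
Proof.
intros H; destruct (analytic_near _ _ H) as (d & Hd & Hn).
exists d; split; [exact Hd|]; intros w Hw.
destruct (analytic_near _ _ (Hn w Hw)) as (d' & Hd' & Hn').
apply (derivative_differentiable g (C_derive g) w d' Hd').
intros v Hv; apply analytic_cdiff, Hn', Hv.
Qed.

Lemma analytic_twice_cdiff g z : analytic_at g z -> twice_cdiff g z.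
Proof.
intros H; destruct (analytic_near _ _ H) as (d & Hd & Hn).
apply (twice_cdiff_intro g (C_derive g) z d (C_derive (C_derive g) z) Hd).
- intros w Hw; apply analytic_cdiff, Hn, Hw.
- apply analytic_cdiff, analytic_derive, H.
Qed.

Lemma analytic_ccont g z : analytic_at g z -> ccont g z.
Proof. intros H; exact (cdiff_ccont _ _ _ (analytic_cdiff _ _ H)). Qed.

Lemma analytic_of_derive (g g1 : C -> C) z : (forall w, cdiff g w (g1 w)) -> analytic_at g z.
Proof. intros H; exists 1; split; [lra|]; intros w _; now exists (g1 w). Qed.

Lemma analytic_const c z : analytic_at (fun _ => c) z.
Proof. apply (analytic_of_derive _ (fun _ => RtoC 0)); intros; apply cdiff_const. Qed.

Lemma analytic_id z : analytic_at (fun w => w) z.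
Proof. apply (analytic_of_derive _ (fun _ => RtoC 1)); intros; apply cdiff_id. Qed.

Lemma analytic_ext_loc f g z d : 0 < d -> (forall w, Cmod (w - z) < d -> f w = g w) ->
  analytic_at f z -> analytic_at g z.
Proof.
intros Hd He (d' & Hd' & H); exists (Rmin d d' / 2).
assert (m1 := Rmin_spec d d').
assert (Hm : 0 < Rmin d d') by now apply Rmin_glb_lt.
split; [lra|]; intros w Hw; destruct (H w) as [l Hl]; [lra|]; exists l.
apply (cdiff_ext_loc f g w l (Rmin d d' / 2)); [lra| |exact Hl].
intros v Hv; apply He.
assert (T := Cmod_dist_triangle v w z); lra.
Qed.

Lemma analytic_plus f g z : analytic_at f z -> analytic_at g z -> analytic_at (fun w => f w + g w)%C z.
Proof.
intros (d & Hd & H) (d' & Hd' & H'); exists (Rmin d d'); split; [now apply Rmin_glb_lt|]; intros w Hw.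
assert (m1 := Rmin_spec d d').
destruct (H w ltac:(lra)) as [l Hl]; destruct (H' w ltac:(lra)) as [l' Hl'].
eexists; apply cdiff_plus; eassumption.
Qed.

Lemma analytic_mult f g z : analytic_at f z -> analytic_at g z -> analytic_at (fun w => f w * g w)%C z.
Proof.
intros (d & Hd & H) (d' & Hd' & H'); exists (Rmin d d'); split; [now apply Rmin_glb_lt|]; intros w Hw.
assert (m1 := Rmin_spec d d').
destruct (H w ltac:(lra)) as [l Hl]; destruct (H' w ltac:(lra)) as [l' Hl'].
eexists; apply cdiff_mult; eassumption.
Qed.

Lemma analytic_opp g z : analytic_at g z -> analytic_at (fun w => - g w)%C z.
Proof.
intros (d & Hd & H); exists d; split; [exact Hd|]; intros w Hw; destruct (H w Hw) as [l Hl].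
eexists; apply cdiff_opp; eassumption.
Qed.

Lemma analytic_minus f g z : analytic_at f z -> analytic_at g z -> analytic_at (fun w => f w - g w)%C z.
Proof. intros Hf Hg; exact (analytic_plus f (fun w => - g w)%C z Hf (analytic_opp g z Hg)). Qed.

Lemma ccont_nonzero (g : C -> C) (z : C) : ccont g z -> g z <> 0%C ->
  exists d, 0 < d /\ forall w, Cmod (w - z) < d -> g w <> 0%C.
Proof.
intros Hc Hz; assert (Hm : 0 < Cmod (g z)) by now apply Cmod_gt_0.
destruct (Hc _ Hm) as [d [Hd H]]; exists d; split; [exact Hd|]; intros w Hw e.
specialize (H w Hw); rewrite e in H.
replace (0 - g z)%C with (- g z)%C in H by ring; rewrite Cmod_opp in H; lra.
Qed.

Lemma analytic_inv (g : C -> C) (z : C) : g z <> 0%C -> analytic_at g z -> analytic_at (fun w => / g w)%C z.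
Proof.
intros Hz H; destruct (ccont_nonzero g z (analytic_ccont _ _ H) Hz) as (d' & Hd' & Hn).
destruct H as (d & Hd & H).
exists (Rmin d d'); split; [now apply Rmin_glb_lt|]; intros w Hw.
assert (m1 := Rmin_spec d d').
destruct (H w ltac:(lra)) as [l Hl].
eexists; apply cdiff_inv; [apply Hn; lra|exact Hl].
Qed.

Lemma analytic_div (f g : C -> C) (z : C) : g z <> 0%C -> analytic_at f z -> analytic_at g z -> analytic_at (fun w => f w / g w)%C z.
Proof. intros Hz Hf Hg; apply (analytic_mult f (fun w => / g w)%C); [exact Hf|now apply analytic_inv]. Qed.

Lemma analytic_comp f g z : analytic_at f (g z) -> analytic_at g z -> analytic_at (fun w => f (g w)) z.
Proof.
intros (d & Hd & H) Hg; destruct (analytic_ccont _ _ Hg d Hd) as (d'' & Hd'' & Hc).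
destruct Hg as (d' & Hd' & H').
exists (Rmin d'' d'); split; [now apply Rmin_glb_lt|]; intros w Hw.
assert (m1 := Rmin_spec d'' d').
destruct (H (g w) (Hc w ltac:(lra))) as [l Hl]; destruct (H' w ltac:(lra)) as [l' Hl'].
eexists; apply cdiff_comp; eassumption.
Qed.

Lemma max_principle (K B : C -> Prop) (F : C -> C) (M : R) :
  cclosed K -> cbounded K ->
  (forall z, K z -> ccont F z) ->
  (forall z, K z -> B z \/ ((exists d, 0 < d /\ forall w, Cmod (w - z) < d -> K w) /\ analytic_at F z)) ->
  (forall z, K z -> B z -> Cmod (F z) <= M) ->
  forall z, K z -> Cmod (F z) <= M.
Proof.
intros HK HB Hc Hin; apply max_principle_twice_cdiff; try assumption.
intros z Hz; destruct (Hin z Hz) as [b|[o a]]; [now left|right]; split; [exact o|now apply analytic_twice_cdiff].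
Qed.

Lemma max_principle_disc (p : C) (r M : R) (F : C -> C) :
  (forall z, Cmod (z - p) <= r -> analytic_at F z) ->
  (forall z, Cmod (z - p) = r -> Cmod (F z) <= M) ->
  forall z, Cmod (z - p) <= r -> Cmod (F z) <= M.
Proof.
intros Ha HB.
apply (max_principle (fun z => Cmod (z - p) <= r) (fun z => Cmod (z - p) = r)).
- intros z Hz; apply Rnot_lt_le; intros Hl.
  destruct (Hz (Cmod (z - p) - r) ltac:(lra)) as [w [h1 h2]].
  assert (T := Cmod_triangle_minus (w - p) (w - z)).
  replace (w - p - (w - z))%C with (z - p)%C in T by ring; lra.
- exists (r + Cmod p); intros z Hz; assert (T := Cmod_triangle (z - p) p).
  replace (z - p + p)%C with z in T by ring; lra.
- intros z Hz; apply analytic_ccont, Ha, Hz.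
- intros z Hz; destruct (Req_dec (Cmod (z - p)) r) as [e|e]; [now left|right; split; [|now apply Ha]].
  exists (r - Cmod (z - p)); split; [lra|]; intros w Hw.
  assert (T := Cmod_dist_triangle w z p); lra.
- intros z _; apply HB.
Qed.

Lemma max_principle_box (Q : box) (M : R) (F : C -> C) :
  (forall z, in_box Q z -> analytic_at F z) ->
  (forall z, in_box Q z -> ~ in_interior Q z -> Cmod (F z) <= M) ->
  forall z, in_box Q z -> Cmod (F z) <= M.
Proof.
intros Ha HB.
apply (max_principle (in_box Q) (fun z => ~ in_interior Q z)); [apply in_box_closed|apply in_box_bounded| | |exact HB].
- intros z Hz; apply analytic_ccont, Ha, Hz.
- intros z Hz; destruct (classic (in_interior Q z)) as [i|i]; [right; split; [|now apply Ha]|now left].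
  destruct (in_interior_open Q z i) as [d [Hd0 Hd]]; exists d; split; [exact Hd0|]; intros v Hv; apply in_interior_in_box, Hd, Hv.
Qed.

(** The factor 8 arises from fitting a square of half side [s / 2] into the disc and using
    [second_derivative_bound] with [r = s / 4]. *)
Lemma cauchy_estimate (g : C -> C) (z0 : C) (s m : R) : 0 < s ->
  (forall w, Cmod (w - z0) <= s -> analytic_at g w) ->
  (forall w, Cmod (w - z0) <= s -> Cmod (g w) <= m) ->
  Cmod (C_derive g z0) <= 8 * m / s.
Proof.
intros Hs Ha Hm.
assert (In : forall w, in_box (square z0 (2 * (s / 4))) w -> Cmod (w - z0) <= s).
{ intros w Hw; assert (T := in_square_dist _ _ _ Hw); lra. }
destruct (second_derivative_bound g (C_derive g) z0 (C_derive (C_derive g) z0) (s / 4) m) as [B _]; [lra| | | | |].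
- intros z Hz; apply analytic_cdiff, Ha, In, Hz.
- intros z Hz; eexists; apply analytic_cdiff, analytic_derive, Ha, In, Hz.
- apply analytic_cdiff, analytic_derive, Ha; rewrite Cmod_self; lra.
- intros z Hz; apply Hm, In, Hz.
- eapply Rle_trans; [exact B|right; field; lra].
Qed.

(** The quotient by [z - z1] is completed by the derivative of [g] at [z1]; Taylor's formula of
    order two makes it differentiable there. [k] is one global function, so that the division can be
    repeated. *)
Lemma factor_zero (g : C -> C) (z1 : C) : g z1 = 0%C -> exists k,
  (forall z, g z = ((z - z1) * k z)%C) /\ (forall z, analytic_at g z -> analytic_at k z).
Proof.
intros H0.
set (k := fun z => if excluded_middle_informative (z = z1) then C_derive g z1 else (g z / (z - z1))%C).
assert (Ek : forall z, z <> z1 -> k z = (g z / (z - z1))%C).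
{ intros z Hz; unfold k; destruct (excluded_middle_informative (z = z1)); [contradiction|reflexivity]. }
assert (Ek0 : k z1 = C_derive g z1).
{ unfold k; destruct (excluded_middle_informative (z1 = z1)); [reflexivity|contradiction]. }
exists k; split.
- intros z; destruct (classic (z = z1)) as [->|Hn].
  + rewrite H0; ring.
  + rewrite (Ek z Hn); field; now apply Cneq_sub.
- assert (Hoff : forall z, z <> z1 -> analytic_at g z -> analytic_at k z).
  { intros z Hz Ha; apply (analytic_ext_loc (fun w => g w / (w - z1))%C k z (Cmod (z - z1))).
    - apply Cmod_gt_0, Cneq_sub, Hz.
    - intros w Hw; symmetry; apply Ek; intros e; subst w; rewrite Cmod_sub_sym in Hw; lra.
    - apply analytic_div; [now apply Cneq_sub|exact Ha|].
      apply analytic_minus; [apply analytic_id|apply analytic_const]. }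
  intros z Ha; destruct (classic (z = z1)) as [->|Hn]; [|now apply Hoff].
  destruct (analytic_near _ _ Ha) as (d & Hd & Hnear).
  exists d; split; [exact Hd|]; intros w Hw.
  destruct (classic (w = z1)) as [->|Hn].
  2: { eexists; apply analytic_cdiff, Hoff; [exact Hn|now apply Hnear]. }
  set (c := C_derive (C_derive g) z1).
  exists (c / 2)%C; intros e He.
  destruct (taylor2 g (C_derive g) z1 c d Hd (fun v Hv => analytic_cdiff _ _ (Hnear v Hv))
    (analytic_cdiff _ _ (analytic_derive _ _ Ha)) e He) as [d' [Hd' HT]].
  exists d'; split; [exact Hd'|]; intros h Hh; specialize (HT h Hh).
  destruct (classic (h = 0%C)) as [->|Hn].
  { replace (z1 + 0)%C with z1 by ring; replace (k z1 - k z1 - c / 2 * 0)%C with (RtoC 0) by ring.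
    rewrite Cmod_0; lra. }
  rewrite Ek0, Ek.
  2: { intros e'; apply Hn; replace h with ((z1 + h) - z1)%C by ring; rewrite e'; ring. }
  assert (Hp : 0 < Cmod h) by now apply Cmod_gt_0.
  apply Rmult_le_reg_r with (Cmod h); [exact Hp|].
  rewrite <- Cmod_mult, Rmult_assoc.
  eapply Rle_trans; [right|exact HT]; f_equal.
  replace (z1 + h - z1)%C with h by ring; rewrite H0; field; exact Hn.
Qed.

(** * The complex exponential *)

Lemma Cmod_cexp z : Cmod (cexp z) = exp (Re z).
Proof.
unfold cexp, Cmod; simpl.
replace (exp (Re z) * cos (Im z) * (exp (Re z) * cos (Im z) * 1) + exp (Re z) * sin (Im z) * (exp (Re z) * sin (Im z) * 1))
  with ((exp (Re z))² * ((sin (Im z))² + (cos (Im z))²)) by (unfold Rsqr; ring).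
rewrite sin2_cos2, Rmult_1_r; apply sqrt_Rsqr, Rlt_le, exp_pos.
Qed.

Lemma cexp_plus z w : cexp (z + w) = (cexp z * cexp w)%C.
Proof.
destruct z as [a b], w as [c d]; unfold cexp, Cplus, Cmult; simpl.
rewrite exp_plus, cos_plus, sin_plus; f_equal; ring.
Qed.

Lemma cexp_0 : cexp 0 = 1%C.
Proof. unfold cexp; simpl; rewrite exp_0, cos_0, sin_0; unfold RtoC; f_equal; ring. Qed.

Lemma cexp_neq_0 z : cexp z <> 0%C.
Proof. apply Cmod_gt_0; rewrite Cmod_cexp; apply exp_pos. Qed.

Lemma cexp_opp z : cexp (- z) = (/ cexp z)%C.
Proof.
assert (H := cexp_plus z (- z)); replace (z + - z)%C with (RtoC 0) in H by ring; rewrite cexp_0 in H.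
replace (cexp (- z)) with (/ cexp z * (cexp z * cexp (- z)))%C by (field; apply cexp_neq_0).
rewrite <- H; ring.
Qed.

Lemma derivable_pt_lim_bound (f : R -> R) (l : R) : derivable_pt_lim f 0 l -> forall e, 0 < e ->
  exists d, 0 < d /\ forall x, Rabs x < d -> Rabs (f x - f 0 - l * x) <= e * Rabs x.
Proof.
intros H e He; destruct (H e He) as [d Hd]; exists d; split; [apply cond_pos|]; intros x Hx.
destruct (Req_dec x 0) as [->|Hn].
{ replace (f 0 - f 0 - l * 0) with 0 by ring; rewrite Rabs_R0; lra. }
specialize (Hd x Hn Hx); rewrite Rplus_0_l in Hd.
replace (f x - f 0 - l * x) with (((f x - f 0) / x - l) * x) by (field; exact Hn).
rewrite Rabs_mult; apply Rmult_le_compat_r; [apply Rabs_pos|lra].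
Qed.

(** At 0 from the real derivatives of [exp], [cos] and [sin]; elsewhere by the functional
    equation. *)
Lemma cdiff_cexp z : cdiff cexp z (cexp z).
Proof.
assert (H0 : cdiff cexp 0 1).
{ intros e He.
  destruct (derivable_pt_lim_bound exp _ (derivable_pt_lim_exp 0) (e / 10) ltac:(lra)) as [d1 [Hd1 H1]].
  destruct (derivable_pt_lim_bound cos _ (derivable_pt_lim_cos 0) (e / 10) ltac:(lra)) as [d2 [Hd2 H2]].
  destruct (derivable_pt_lim_bound sin _ (derivable_pt_lim_sin 0) (e / 10) ltac:(lra)) as [d3 [Hd3 H3]].
  rewrite exp_0 in H1; rewrite cos_0, sin_0 in H2; rewrite sin_0, cos_0 in H3.
  destruct (derivable_pt_lim_bound exp _ (derivable_pt_lim_exp 0) 1 ltac:(lra)) as [d4 [Hd4 H4]].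
  rewrite exp_0 in H4.
  set (d := Rmin (Rmin (Rmin d1 d2) (Rmin d3 d4)) (Rmin 1 (e / 10))).
  exists d; split; [unfold d; repeat apply Rmin_glb_lt; lra|].
  intros h Hh.
  assert (D : d <= d1 /\ d <= d2 /\ d <= d3 /\ d <= d4 /\ d <= 1 /\ d <= e / 10).
  { unfold d; assert (a1 := Rmin_spec (Rmin (Rmin d1 d2) (Rmin d3 d4)) (Rmin 1 (e / 10))).
    assert (a3 := Rmin_spec (Rmin d1 d2) (Rmin d3 d4)).
    assert (a5 := Rmin_spec d1 d2); assert (a7 := Rmin_spec d3 d4).
    assert (a9 := Rmin_spec 1 (e / 10)); lra. }
  replace (0 + h)%C with h by ring; rewrite cexp_0.
  assert (X := re_le_Cmod h); assert (Y := im_le_Cmod h).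
  destruct h as [x y]; simpl in X, Y; unfold cexp; simpl.
  specialize (H1 x ltac:(lra)); specialize (H2 y ltac:(lra)); specialize (H3 y ltac:(lra)); specialize (H4 x ltac:(lra)).
  set (m := Cmod (x, y)) in *.
  assert (m0 : 0 <= m) by apply Cmod_ge_0.
  assert (Ex : Rabs (exp x - 1) <= 2 * m).
  { replace (exp x - 1) with ((exp x - 1 - 1 * x) + x) by ring.
    eapply Rle_trans; [apply Rabs_triang|]; lra. }
  assert (E3 : Rabs (exp x) <= 3).
  { replace (exp x) with ((exp x - 1) + 1) by ring; eapply Rle_trans; [apply Rabs_triang|].
    rewrite Rabs_R1; lra. }
  eapply Rle_trans; [apply Cmod_le_Re_Im|]; simpl.
  replace (exp x * cos y + - (1) + - (1 * x - 0 * y)) with ((exp x - 1 - 1 * x) + exp x * (cos y - 1 - - 0 * y)) by ring.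
  replace (exp x * sin y + - 0 + - (1 * y + 0 * x)) with (exp x * (sin y - 0 - 1 * y) + (exp x - 1) * y) by ring.
  assert (B1 := Rabs_triang (exp x - 1 - 1 * x) (exp x * (cos y - 1 - - 0 * y))).
  assert (B2 := Rabs_triang (exp x * (sin y - 0 - 1 * y)) ((exp x - 1) * y)).
  rewrite Rabs_mult in B1; rewrite !Rabs_mult in B2.
  assert (p := Rabs_pos (exp x)); assert (p1 := Rabs_pos y).
  assert (C1 : Rabs (exp x) * Rabs (cos y - 1 - - 0 * y) <= 3 * (e / 10 * m)).
  { apply Rmult_le_compat; try apply Rabs_pos; [exact E3|].
    eapply Rle_trans; [exact H2|apply Rmult_le_compat_l; lra]. }
  assert (C2 : Rabs (exp x) * Rabs (sin y - 0 - 1 * y) <= 3 * (e / 10 * m)).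
  { apply Rmult_le_compat; try apply Rabs_pos; [exact E3|].
    eapply Rle_trans; [exact H3|apply Rmult_le_compat_l; lra]. }
  assert (C3 : Rabs (exp x - 1) * Rabs y <= 2 * m * (e / 10)).
  { apply Rmult_le_compat; try apply Rabs_pos; lra. }
  assert (C4 : e / 10 * Rabs x <= e / 10 * m) by (apply Rmult_le_compat_l; lra).
  assert (0 <= e * m) by (apply Rmult_le_pos; lra).
  lra. }
intros e He.
assert (Hp : 0 < Cmod (cexp z)) by (rewrite Cmod_cexp; apply exp_pos).
destruct (H0 (e / Cmod (cexp z)) ltac:(apply Rdiv_lt_0_compat; lra)) as [d [Hd H]].
exists d; split; [exact Hd|]; intros h Hh; specialize (H h Hh).
rewrite cexp_plus; replace (0 + h)%C with h in H by ring; rewrite cexp_0 in H.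
replace (cexp z * cexp h - cexp z - cexp z * h)%C with (cexp z * (cexp h - 1 - 1 * h))%C by ring.
rewrite Cmod_mult.
eapply Rle_trans; [apply Rmult_le_compat_l; [lra|exact H]|].
right; field; lra.
Qed.

Lemma analytic_cexp z : analytic_at cexp z.
Proof. apply (analytic_of_derive cexp cexp), cdiff_cexp. Qed.

Lemma entire_analytic (g : C -> C) : entire g -> forall z, analytic_at g z.
Proof.
intros H z; exists 1; split; [lra|]; intros w _; destruct (H w) as [l Hl]; exists l; now apply cdiff_is_derive.
Qed.

(** * Zeros and logarithmic derivatives *)

(** Repetitions in the list record multiplicities. *)
Fixpoint root_product (l : list C) (z : C) : C :=
  match l with nil => 1%C | a :: l' => ((z - a) * root_product l' z)%C end.

Lemma root_product_le l z B : (forall a, In a l -> Cmod (z - a) <= B) -> Cmod (root_product l z) <= B ^ length l.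
Proof.
induction l as [|a l IH]; simpl; intros H; [rewrite Cmod_1; lra|].
rewrite Cmod_mult; apply Rmult_le_compat; try apply Cmod_ge_0; [apply H; now left|apply IH; auto].
Qed.

Lemma root_product_ge l z d : 0 <= d -> (forall a, In a l -> d <= Cmod (z - a)) -> d ^ length l <= Cmod (root_product l z).
Proof.
intros Hd; induction l as [|a l IH]; simpl; intros H; [rewrite Cmod_1; lra|].
rewrite Cmod_mult; apply Rmult_le_compat; [exact Hd|now apply pow_le|apply H; now left|apply IH; auto].
Qed.

(** The logarithmic derivative [s] is the sum of the [1 / (z - a)], each at most [1 / d] in
    modulus. *)
Lemma root_product_derive l z d : 0 < d -> (forall a, In a l -> d <= Cmod (z - a)) ->
  exists s, cdiff (root_product l) z (s * root_product l z)%C /\ Cmod s <= INR (length l) / d.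
Proof.
intros Hd; induction l as [|a l IH]; intros H.
- exists 0%C; split; [eapply cdiff_eq; [exact (cdiff_const 1 z)|ring]|].
  rewrite Cmod_0; simpl; unfold Rdiv; lra.
- destruct IH as [s [Hs Hb]]; [intros; apply H; now right|].
  assert (Ha := H a (or_introl eq_refl)).
  assert (Hz : (z - a)%C <> 0%C) by (apply Cmod_gt_0; lra).
  exists (/ (z - a) + s)%C; split.
  + eapply cdiff_eq.
    * apply (cdiff_mult (fun w => w - a)%C (root_product l)); [apply cdiff_minus; [apply cdiff_id|apply cdiff_const]|exact Hs].
    * simpl; field; exact Hz.
  + eapply Rle_trans; [apply Cmod_triangle|].
    rewrite Cmod_inv by exact Hz.
    replace (INR (length (a :: l)) / d) with (/ d + INR (length l) / d)
      by (simpl length; rewrite S_INR; field; lra).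
    apply Rplus_le_compat; [|exact Hb]; apply Rinv_le_contravar; assumption.
Qed.

Definition holomorphic (g : C -> C) := forall z, analytic_at g z.

(** On the circle of radius [4 R] every factor [z - a] has modulus at least [3 R]; the maximum
    principle carries the resulting bound for [g] inside. *)
Lemma factored_bound (f g : C -> C) (l : list C) (p : C) (R M : R) : 0 < R -> holomorphic g ->
  (forall z, f z = (root_product l z * g z)%C) ->
  (forall a, In a l -> Cmod (a - p) <= R) ->
  (forall z, Cmod (z - p) = 4 * R -> Cmod (f z) <= M) ->
  forall z, Cmod (z - p) <= 4 * R -> Cmod (g z) <= M / (3 * R) ^ length l.
Proof.
intros HR Hg Hf Hl HM.
assert (Hp : 0 < (3 * R) ^ length l) by (apply pow_lt; lra).
apply max_principle_disc; [intros z _; apply Hg|].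
intros z Hz; apply Rle_div_r; [exact Hp|].
apply Rle_trans with (2 := HM z Hz).
rewrite Hf, Cmod_mult, Rmult_comm.
apply Rmult_le_compat_r; [apply Cmod_ge_0|].
apply root_product_ge; [lra|]; intros a Ha.
assert (T := Cmod_triangle_minus (z - a) (p - a)).
replace (z - a - (p - a))%C with (z - p)%C in T by ring.
specialize (Hl a Ha); rewrite Cmod_sub_sym in Hl; lra.
Qed.

(** A form of Jensen's inequality: each zero gains a factor 3, being at distance at least [3 R] from
    the large circle and at most [R] from the centre. *)
Lemma zero_count (f g : C -> C) (l : list C) (p : C) (R M : R) : 0 < R -> holomorphic g ->
  (forall z, f z = (root_product l z * g z)%C) ->
  (forall a, In a l -> Cmod (a - p) <= R) ->
  (forall z, Cmod (z - p) = 4 * R -> Cmod (f z) <= M) ->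
  3 ^ length l * Cmod (f p) <= M.
Proof.
intros HR Hg Hf Hl HM.
assert (B := factored_bound f g l p R M HR Hg Hf Hl HM p ltac:(rewrite Cmod_self; lra)).
assert (Hp : 0 < R ^ length l) by (apply pow_lt; lra).
assert (H3 : 0 < 3 ^ length l) by (apply pow_lt; lra).
assert (B2 : Cmod (root_product l p) <= R ^ length l).
{ apply root_product_le; intros a Ha; rewrite Cmod_sub_sym; now apply Hl. }
rewrite Hf, Cmod_mult.
apply Rle_trans with (3 ^ length l * (R ^ length l * (M / (3 * R) ^ length l))).
- apply Rmult_le_compat_l; [lra|]; apply Rmult_le_compat; try apply Cmod_ge_0; assumption.
- rewrite Rpow_mult_distr; right; field; lra.
Qed.

(** Zeros in the disc are divided out one at a time; were this never to end, there would be
    factorisations of every length, contrary to [zero_count]. *)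
Lemma factor_zeros (f : C -> C) (p : C) (R M : R) : 0 < R -> holomorphic f -> f p <> 0%C ->
  (forall z, Cmod (z - p) = 4 * R -> Cmod (f z) <= M) ->
  exists l g, holomorphic g /\ (forall z, f z = (root_product l z * g z)%C) /\
    (forall a, In a l -> Cmod (a - p) <= R) /\
    (forall z, Cmod (z - p) <= R -> g z <> 0%C).
Proof.
intros HR Hf Hp HM; apply NNPP; intros Hn.
assert (Hall : forall n, exists l g, length l = n /\ holomorphic g /\ (forall z, f z = (root_product l z * g z)%C) /\
    (forall a, In a l -> Cmod (a - p) <= R)).
{ induction n as [|n (l & g & Hlen & Hg & Hfg & Hl)].
  - exists nil, f; simpl; repeat split; try assumption; [intros; ring|tauto].
  - apply NNPP; intros Hn'; apply Hn; exists l, g; repeat split; try assumption.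
    intros z Hz e; apply Hn'.
    destruct (factor_zero g z e) as [k [Hk Hka]].
    exists (z :: l), k; simpl; repeat split.
    + now rewrite Hlen.
    + intros w; apply Hka, Hg.
    + intros w; rewrite Hfg, Hk; ring.
    + intros a [<-|Ha]; [exact Hz|now apply Hl]. }
assert (Hpos : 0 < Cmod (f p)) by now apply Cmod_gt_0.
destruct (Pow_x_infinity 3 ltac:(rewrite Rabs_pos_eq; lra) (M / Cmod (f p) + 1)) as [N HN].
specialize (HN N (le_n N)).
rewrite Rabs_pos_eq in HN by (apply pow_le; lra).
destruct (Hall N) as (l & g & Hlen & Hg & Hfg & Hl).
assert (B := zero_count f g l p R M HR Hg Hfg Hl HM).
rewrite Hlen in B.
apply Rle_div_r in B; [|exact Hpos]; lra.
Qed.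

Lemma disc_in_square p r z : Cmod (z - p) < r -> in_interior (square p r) z.
Proof.
intros Hw; assert (X := dist_Re_Im p z r ltac:(lra)).
unfold in_interior, square; destruct z, p; simpl in *; lra.
Qed.

Lemma zero_derive_const (F : C -> C) (p : C) (r : R) :
  (forall z, Cmod (z - p) < r -> cdiff F z 0) -> forall z, Cmod (z - p) < r -> F z = F p.
Proof.
intros H z Hz.
assert (B := mvt_bound F (fun _ => 0%C) p (z - p) 0).
replace (p + (z - p))%C with z in B by ring.
assert (E : Cmod (F z - F p) <= 0 * Cmod (z - p)).
{ apply B.
  - intros t Ht; apply H; assert (S := Cmod_segment p (z - p) t Ht); lra.
  - intros t _; rewrite Cmod_0; lra. }
rewrite Rmult_0_l in E.
assert (E' : Cmod (F z - F p) = 0) by (assert (P := Cmod_ge_0 (F z - F p)); lra).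
apply Cmod_eq_0 in E'; replace (F z) with ((F z - F p) + F p)%C by ring; rewrite E'; ring.
Qed.

(** [q] is a primitive of [g' / g], and [g e^(-q)] has derivative 0. The disc of radius [2 r]
    contains the square on which the primitive is taken. *)
Lemma holomorphic_log (g : C -> C) (p : C) (r : R) : 0 < r -> holomorphic g ->
  (forall z, Cmod (z - p) <= 2 * r -> g z <> 0%C) ->
  exists q : C -> C, q p = 0%C /\ forall z, Cmod (z - p) < r ->
    cdiff q z (C_derive g z / g z)%C /\ g z = (g p * cexp (q z))%C.
Proof.
intros Hr Hg Hn.
destruct (box_primitive (fun z => C_derive g z / g z)%C (square p r)) as [G HG].
{ intros w Hw; assert (D := in_square_dist _ _ _ Hw).
  eexists; apply analytic_cdiff, (analytic_div (C_derive g) g w); [now apply Hn|apply analytic_derive, Hg|apply Hg]. }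
set (q := fun z => (G z - G p)%C).
assert (Hq : forall z, Cmod (z - p) < r -> cdiff q z (C_derive g z / g z)%C).
{ intros z Hz; unfold q; eapply cdiff_eq; [apply cdiff_minus; [apply HG, disc_in_square, Hz|apply cdiff_const]|ring]. }
assert (q0 : q p = 0%C) by (unfold q; ring).
exists q; split; [exact q0|]; intros z Hz; split; [now apply Hq|].
assert (E : (g z * cexp (- q z) = g p * cexp (- q p))%C).
{ apply (zero_derive_const (fun w => g w * cexp (- q w))%C p r); [|exact Hz].
  intros w Hw; eapply cdiff_eq.
  - apply cdiff_mult; [apply analytic_cdiff, Hg|].
    apply (cdiff_comp cexp (fun v => - q v)%C); [apply cdiff_cexp|apply cdiff_opp, Hq, Hw].
  - cbv beta; field; apply Hn; lra. }
rewrite q0 in E; replace (- 0)%C with (RtoC 0) in E by ring; rewrite cexp_0, cexp_opp in E.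
replace (g z) with (g z * / cexp (q z) * cexp (q z))%C by (field; apply cexp_neq_0).
rewrite E; ring.
Qed.

Lemma le_mul_of_div_le (x y c : R) : 0 < y -> x / y <= c -> x <= c * y.
Proof.
intros Hy H; replace x with (x / y * y) by (field; lra).
apply Rmult_le_compat_r; lra.
Qed.

(** [psi = q / (2 L - q)] maps into the unit disc because [Re q <= L], and it vanishes at [p].
    Dividing by [z - p] as in Schwarz's lemma gives [|psi| <= 1 / 2] on the disc of half the radius,
    which solves to [|q| <= 2 L]. *)
Lemma borel_caratheodory (q : C -> C) (p : C) (r L : R) : 0 < r -> 0 < L ->
  (forall z, Cmod (z - p) <= r -> analytic_at q z) -> q p = 0%C ->
  (forall z, Cmod (z - p) <= r -> Re (q z) <= L) ->
  forall z, Cmod (z - p) <= r / 2 -> Cmod (q z) <= 2 * L.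
Proof.
intros Hr HL Ha q0 HRe.
assert (Hne : forall z, Cmod (z - p) <= r -> (RtoC (2 * L) - q z)%C <> 0%C).
{ intros z Hz e; specialize (HRe z Hz); apply (f_equal Re) in e; destruct (q z); simpl in *; lra. }
set (psi := fun z => (q z / (RtoC (2 * L) - q z))%C).
destruct (factor_zero psi p) as [k [Hk Hka]].
{ unfold psi; rewrite q0; unfold Cdiv; ring. }
assert (Hpsi : forall z, Cmod (z - p) <= r -> Cmod (psi z) <= 1).
{ intros z Hz; unfold psi; rewrite Cmod_div by now apply Hne.
  apply Rle_div_l; [apply Cmod_gt_0; now apply Hne|].
  rewrite Rmult_1_l; apply Rsqr_incr_0; try apply Cmod_ge_0.
  unfold Rsqr; specialize (HRe z Hz).
  assert (A := Cmod_sqr (q z)); assert (B := Cmod_sqr (RtoC (2 * L) - q z)).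
  destruct (q z) as [x y]; simpl in *; nra. }
assert (Hkb : forall z, Cmod (z - p) <= r -> Cmod (k z) <= 1 / r).
{ apply max_principle_disc.
  - intros z Hz; apply Hka; unfold psi; apply (analytic_div q (fun w => RtoC (2 * L) - q w)%C);
     [now apply Hne|now apply Ha|apply analytic_minus; [apply analytic_const|now apply Ha]].
  - intros z Hz; apply Rle_div_r; [exact Hr|].
    specialize (Hpsi z ltac:(lra)); rewrite Hk, Cmod_mult, Hz in Hpsi; lra. }
intros z Hz.
assert (P : Cmod (psi z) <= 1 / 2).
{ rewrite Hk, Cmod_mult; apply Rle_trans with (r / 2 * (1 / r)); [|right; field; lra].
  apply Rmult_le_compat; try apply Cmod_ge_0; [exact Hz|apply Hkb; lra]. }
unfold psi in P; rewrite Cmod_div in P by (apply Hne; lra).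
apply le_mul_of_div_le in P; [|apply Cmod_gt_0, Hne; lra].
assert (T := Cmod_triangle_minus (RtoC (2 * L)) (q z)).
rewrite Cmod_R, Rabs_pos_eq in T by lra; lra.
Qed.

Lemma exp_le_inv (x y : R) : exp x <= exp y -> x <= y.
Proof. intros H; apply Rnot_lt_le; intros h; apply exp_increasing in h; lra. Qed.

Lemma exp_le (x y : R) : x <= y -> exp x <= exp y.
Proof. intros [h| ->]; [left; now apply exp_increasing|right; reflexivity]. Qed.

(** From [exp 1 <= 3]; it turns [zero_count] into a bound for the number of zeros. *)
Lemma pow_le_exp_length (N : nat) (x M : R) : 0 < x -> 3 ^ N * x <= M -> INR N <= ln (M / x).
Proof.
intros Hx H.
apply exp_le_inv.
assert (HM : 0 < M) by (eapply Rlt_le_trans; [|exact H]; apply Rmult_lt_0_compat; [apply pow_lt; lra|exact Hx]).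
rewrite exp_ln by (apply Rdiv_lt_0_compat; lra).
apply Rle_trans with (3 ^ N); [|now apply Rle_div_r].
clear H HM.
clear; induction N as [|N IH]; [simpl; rewrite exp_0; lra|].
rewrite S_INR, exp_plus; simpl; rewrite (Rmult_comm 3).
apply Rmult_le_compat; try (apply Rlt_le, exp_pos); [exact IH|apply exp_le_3].
Qed.

(* [f] is a polynomial with at most [L] zeros times [g p * e^q], where [q] is bounded by
   Borel-Caratheodory; [f''/f] is recovered from a Cauchy estimate for [f'/f]. *)
Lemma log_derivative_estimate (f : C -> C) (p : C) (R M : R) :
  12 <= R -> holomorphic f -> f p <> 0%C -> Cmod (f p) < M ->
  (forall z, Cmod (z - p) = 4 * R -> Cmod (f z) <= M) ->
  let L := ln (M / Cmod (f p)) in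
  exists l : list C, INR (length l) <= L /\
    forall z d, 0 < d <= 1 -> Cmod (z - p) <= R / 24 -> (forall a, In a l -> d <= Cmod (z - a)) ->
      f z <> 0%C /\
      exp (- (L * (ln (/ d) + ln R + 2))) * Cmod (f p) <= Cmod (f z) /\
      Cmod (C_derive f z) <= 194 * L / d * Cmod (f z) /\
      Cmod (C_derive (C_derive f) z) <= ((194 * L / d) ^ 2 + 16 * (194 * L) / d ^ 2) * Cmod (f z).
Proof.
intros HR Hf Hp HMp HM L.
assert (Hpp : 0 < Cmod (f p)) by now apply Cmod_gt_0.
assert (HL : 0 < L).
{ unfold L; rewrite <- ln_1; apply ln_increasing; [lra|apply Rlt_div_r; lra]. }
(* The radii shrink as follows: growth on [4 R], zeros removed on [R], logarithm on [R / 2],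
   Borel-Caratheodory from [R / 3] to [R / 6], Cauchy estimate on [R / 12]. A last loss of
   [d / 2 <= R / 24] leads to [R / 24]. *)
destruct (factor_zeros f p R M ltac:(lra) Hf Hp HM) as (l & g & Hg & Hfg & Hl & Hgn).
assert (HN : INR (length l) <= L).
{ apply pow_le_exp_length; [exact Hpp|]; now apply (zero_count f g l p R M ltac:(lra)). }
set (N := length l) in *.
assert (HRN : 0 < R ^ N) by (apply pow_lt; lra).
assert (H3N : 1 <= 3 ^ N) by (apply pow_R1_Rle; lra).
assert (gp : Cmod (f p) <= R ^ N * Cmod (g p)).
{ rewrite Hfg, Cmod_mult; apply Rmult_le_compat_r; [apply Cmod_ge_0|].
  apply root_product_le; intros a Ha; rewrite Cmod_sub_sym; now apply Hl. }
assert (gp0 : 0 < Cmod (g p)) by (apply Cmod_gt_0, Hgn; rewrite Cmod_self; lra).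
(* [factored_bound] gives [M / (3 R)^N], while [gp] bounds [|g p|] below by [|f p| / R^N]; the
   quotient is at most [M / |f p| = exp L]. *)
assert (gb : forall z, Cmod (z - p) <= R -> Cmod (g z) <= Cmod (g p) * exp L).
{ intros z Hz; eapply Rle_trans; [apply (factored_bound f g l p R M); try assumption; lra|].
  unfold L; rewrite exp_ln by (apply Rdiv_lt_0_compat; lra).
  fold N; rewrite Rpow_mult_distr.
  apply Rle_trans with (M / R ^ N).
  - apply Rmult_le_compat_l; [lra|]; apply Rinv_le_contravar; [exact HRN|]; nra.
  - apply Rle_div_l; [exact HRN|].
    replace (Cmod (g p) * (M / Cmod (f p)) * R ^ N) with (M * ((R ^ N * Cmod (g p)) / Cmod (f p))) by (field; lra).
    rewrite <- (Rmult_1_r M) at 1; apply Rmult_le_compat_l; [lra|].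
    apply Rle_div_r; lra. }
destruct (holomorphic_log g p (R / 2) ltac:(lra) Hg) as (q & q0 & Hq).
{ intros z Hz; apply Hgn; lra. }
assert (qa : forall z, Cmod (z - p) < R / 2 -> analytic_at q z).
{ intros z Hz; exists (R / 2 - Cmod (z - p)); split; [lra|]; intros w Hw; eexists; apply Hq.
  assert (T := Cmod_dist_triangle w z p); lra. }
assert (qb : forall z, Cmod (z - p) <= R / 6 -> Cmod (q z) <= 2 * L).
{ intros z Hz; apply (borel_caratheodory q p (R / 3) L); try lra; try assumption.
  - intros w Hw; apply qa; lra.
  - intros w Hw; destruct (Hq w ltac:(lra)) as [_ E].
    assert (B := gb w ltac:(lra)); rewrite E, Cmod_mult, Cmod_cexp in B.
    apply Rmult_le_reg_l in B; [|exact gp0]; now apply exp_le_inv. }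
assert (qd : forall z, Cmod (z - p) <= R / 12 -> Cmod (C_derive q z) <= 192 * L / R).
{ intros z Hz; replace (192 * L / R) with (8 * (2 * L) / (R / 12)) by (field; lra).
  assert (S : forall w, Cmod (w - z) <= R / 12 -> Cmod (w - p) <= R / 6).
  { intros w Hw; assert (T := Cmod_dist_triangle w z p); lra. }
  apply cauchy_estimate; [lra| |].
  - intros w Hw; apply qa; specialize (S w Hw); lra.
  - intros w Hw; apply qb, S, Hw. }
exists l; split; [exact HN|].
(* Used below also with [d / 2] in place of [d], on the disc of radius [d / 2] around [z]; there the
   last bound reads [194 * L / d]. *)
assert (First : forall z d, 0 < d <= 1 -> Cmod (z - p) <= R / 12 -> (forall a, In a l -> d <= Cmod (z - a)) ->
  f z <> 0%C /\ d ^ N * (Cmod (g p) * exp (- (2 * L))) <= Cmod (f z) /\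
  Cmod (C_derive f z / f z) <= 194 * L / (2 * d)).
{ intros z d Hd Hz Hda.
  assert (lp := root_product_ge l z d ltac:(lra) Hda); fold N in lp.
  assert (dN : 0 < d ^ N) by (apply pow_lt; lra).
  assert (gz : Cmod (g p) * exp (- (2 * L)) <= Cmod (g z)).
  { destruct (Hq z ltac:(lra)) as [_ E]; rewrite E, Cmod_mult, Cmod_cexp.
    apply Rmult_le_compat_l; [lra|].
    assert (B := qb z ltac:(lra)); assert (X := re_le_Cmod (q z)).
    assert (X' : Rabs (Re (q z)) <= 2 * L) by lra; apply Rabs_le_between in X'.
    apply exp_le; lra. }
  assert (ez := exp_pos (- (2 * L))).
  assert (gz0 : 0 < Cmod (g p) * exp (- (2 * L))) by (apply Rmult_lt_0_compat; lra).
  assert (fz : d ^ N * (Cmod (g p) * exp (- (2 * L))) <= Cmod (f z)).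
  { rewrite Hfg, Cmod_mult; apply Rmult_le_compat; lra. }
  assert (fz0 : f z <> 0%C).
  { apply Cmod_gt_0; eapply Rlt_le_trans; [|exact fz]; now apply Rmult_lt_0_compat. }
  split; [exact fz0|split; [exact fz|]].
  destruct (root_product_derive l z d ltac:(lra) Hda) as [s [Hs Hsb]]; fold N in Hsb.
  destruct (Hq z ltac:(lra)) as [Hqz _].
  assert (gzn : g z <> 0%C) by (apply Hgn; lra).
  assert (lzn : root_product l z <> 0%C) by (apply Cmod_gt_0; lra).
  assert (Ef : C_derive f z = ((s + C_derive q z) * f z)%C).
  { apply cdiff_C_derive.
    apply (cdiff_ext_loc (fun w => root_product l w * g w)%C f z _ 1); [lra|intros; now rewrite Hfg|].
    eapply cdiff_eq; [apply cdiff_mult; [exact Hs|apply analytic_cdiff, Hg]|].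
    rewrite (cdiff_C_derive _ _ _ Hqz), Hfg; field; exact gzn. }
  rewrite Ef; replace ((s + C_derive q z) * f z / f z)%C with (s + C_derive q z)%C by (field; exact fz0).
  eapply Rle_trans; [apply Cmod_triangle|].
  assert (B := qd z Hz).
  apply Rle_trans with (L / d + 192 * L / 12).
  - apply Rplus_le_compat.
    + eapply Rle_trans; [exact Hsb|]; apply Rmult_le_compat_r; [|exact HN].
      apply Rlt_le, Rinv_0_lt_compat; lra.
    + eapply Rle_trans; [exact B|]; apply Rmult_le_compat_l; [lra|]; apply Rinv_le_contravar; lra.
  - replace (194 * L / (2 * d)) with (97 * (L / d)) by (field; lra).
    assert (L <= L / d) by (apply Rle_div_r; nra). lra. }
intros z d Hd Hz Hda.
destruct (First z d Hd ltac:(lra) Hda) as (fz0 & fz & fd).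
assert (Hfz : 0 < Cmod (f z)) by now apply Cmod_gt_0.
set (A := 194 * L / d).
assert (HA : 0 < A) by (apply Rdiv_lt_0_compat; lra).
assert (Near : forall w, Cmod (w - z) <= d / 2 -> f w <> 0%C /\ Cmod (C_derive f w / f w) <= A).
{ intros w Hw.
  destruct (First w (d / 2)) as (h1 & _ & h2); [lra| | |].
  - assert (T := Cmod_dist_triangle w z p); lra.
  - intros a Ha; specialize (Hda a Ha).
    assert (T := Cmod_triangle_minus (w - a) (w - z)); replace (w - a - (w - z))%C with (z - a)%C in T by ring; lra.
  - split; [exact h1|]; eapply Rle_trans; [exact h2|]; unfold A; right; field; lra. }
set (k := fun w => (C_derive f w / f w)%C).
assert (ka : forall w, Cmod (w - z) <= d / 2 -> analytic_at k w).
{ intros w Hw; apply (analytic_div (C_derive f) f w); [now apply Near|apply analytic_derive, Hf|apply Hf]. }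
assert (kd := cauchy_estimate k z (d / 2) A ltac:(lra) ka (fun w Hw => proj2 (Near w Hw))).
assert (Zself : Cmod (z - z) <= d / 2) by (rewrite Cmod_self; lra).
assert (fA : Cmod (C_derive f z) <= A * Cmod (f z)).
{ assert (B := proj2 (Near z Zself)); rewrite Cmod_div in B by exact fz0.
  now apply le_mul_of_div_le in B. }
split; [exact fz0|split; [|split; [exact fA|]]].
- eapply Rle_trans; [|exact fz].
  assert (G1 : Cmod (f p) / R ^ N <= Cmod (g p)) by (apply Rle_div_l; lra).
  apply Rle_trans with (d ^ N * (Cmod (f p) / R ^ N * exp (- (2 * L)))).
  2: { apply Rmult_le_compat_l; [apply pow_le; lra|]; apply Rmult_le_compat_r; [apply Rlt_le, exp_pos|exact G1]. }
  replace (d ^ N) with (exp (- (INR N * ln (/ d)))).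
  2: { rewrite ln_Rinv by lra; replace (- (INR N * - ln d)) with (INR N * ln d) by ring.
       rewrite <- ln_pow by lra; apply exp_ln, pow_lt; lra. }
  replace (Cmod (f p) / R ^ N) with (exp (- (INR N * ln R)) * Cmod (f p)).
  2: { rewrite exp_Ropp, <- ln_pow, exp_ln by (try exact HRN; lra); field; lra. }
  replace (exp (- (INR N * ln (/ d))) * (exp (- (INR N * ln R)) * Cmod (f p) * exp (- (2 * L))))
    with (exp (- (INR N * ln (/ d)) + - (INR N * ln R) + - (2 * L)) * Cmod (f p)) by (rewrite !exp_plus; ring).
  apply Rmult_le_compat_r; [lra|].
  assert (l1 : 0 <= ln (/ d)).
  { rewrite <- ln_1; apply ln_le; [lra|]; rewrite <- Rinv_1; apply Rinv_le_contravar; lra. }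
  assert (l2 : 0 <= ln R) by (rewrite <- ln_1; apply ln_le; lra).
  apply exp_le; nra.
- assert (E : C_derive (C_derive f) z = ((C_derive k z + k z * k z) * f z)%C).
  { apply cdiff_C_derive.
    apply (cdiff_ext_loc (fun w => k w * f w)%C (C_derive f) z _ (d / 2)); [lra| |].
    - intros w Hw; unfold k; field; apply Near; lra.
    - eapply cdiff_eq; [apply cdiff_mult; [apply analytic_cdiff, ka, Zself|apply analytic_cdiff, Hf]|].
      replace (C_derive f z) with (k z * f z)%C by (unfold k; field; exact fz0); ring. }
  rewrite E, Cmod_mult; apply Rmult_le_compat_r; [lra|].
  eapply Rle_trans; [apply Cmod_triangle|]; rewrite Cmod_mult.
  assert (B := proj2 (Near z Zself)); fold (k z) in B.
  assert (k0 := Cmod_ge_0 (k z)).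
  replace (16 * (194 * L) / d ^ 2) with (8 * A / (d / 2)) by (unfold A; field; lra).
  fold A; nra.
Qed.

(** * Functions of finite order *)

Definition for_large (P : R -> Prop) : Prop := exists R0, forall r, R0 <= r -> P r.

Lemma for_large_and P Q : for_large P -> for_large Q -> for_large (fun r => P r /\ Q r).
Proof.
intros [a Ha] [b Hb]; exists (Rmax a b); intros r Hr.
assert (h1 := Rmax_spec a b).
split; [apply Ha|apply Hb]; lra.
Qed.

Lemma for_large_imp (P Q : R -> Prop) : (forall r, P r -> Q r) -> for_large P -> for_large Q.
Proof. intros H [a Ha]; exists a; intros r Hr; apply H, Ha, Hr. Qed.

Lemma for_large_ge c : for_large (fun r => c <= r).
Proof. now exists c. Qed.

Lemma Rpower_pos x y : 0 < Rpower x y.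
Proof. apply exp_pos. Qed.

Lemma for_large_Rpower_ge (e C : R) : 0 < e -> for_large (fun r => C <= Rpower r e).
Proof.
intros He; set (c := Rmax C 1).
assert (h1 := Rmax_spec C 1); fold c in h1.
exists (Rpower c (/ e)); intros r Hr.
apply Rle_trans with (1 := proj1 h1).
replace c with (Rpower (Rpower c (/ e)) e).
- apply Rle_Rpower_l; [lra|split; [apply Rpower_pos|exact Hr]].
- rewrite Rpower_mult, Rinv_l, Rpower_1 by lra; reflexivity.
Qed.

Lemma for_large_Rpower_dom (a b C : R) : a < b -> for_large (fun r => C * Rpower r a <= Rpower r b).
Proof.
intros Hab; apply (for_large_imp (fun r => C <= Rpower r (b - a))); [|apply for_large_Rpower_ge; lra].
intros r Hr; replace b with ((b - a) + a) at 1 by ring.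
rewrite Rpower_plus; apply Rmult_le_compat_r; [apply Rlt_le, Rpower_pos|exact Hr].
Qed.

Lemma ln_le_self x : 0 < x -> ln x <= x.
Proof.
intros Hx; destruct (Rle_dec (ln x) 0) as [h|h]; [lra|].
assert (H := exp_ineq1_le (ln x)); rewrite exp_ln in H by exact Hx; lra.
Qed.

Lemma for_large_ln_dom (e C : R) : 0 < e -> 0 <= C -> for_large (fun r => C * ln r <= Rpower r e).
Proof.
intros He HC.
apply (for_large_imp (fun r => (C * (2 / e)) * Rpower r (e / 2) <= Rpower r e)); [|apply for_large_Rpower_dom; lra].
intros r Hr; eapply Rle_trans; [|exact Hr].
rewrite Rmult_assoc; apply Rmult_le_compat_l; [exact HC|].
assert (H := ln_le_self (Rpower r (e / 2)) (Rpower_pos _ _)).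
unfold Rpower at 1 in H; rewrite ln_exp in H.
replace (ln r) with (2 / e * (e / 2 * ln r)) by (field; lra).
apply Rmult_le_compat_l; [|exact H].
apply Rlt_le, Rdiv_lt_0_compat; lra.
Qed.

Definition growth (s : R) (f : C -> C) : Prop :=
  for_large (fun r => forall z, Cmod z = r -> Cmod (f z) <= exp (Rpower r s)).

(** [log_derivative_estimate] around a fixed point [p] with radius [72 r]: its inner disc, of radius
    [3 r], contains [|z| <= 2 r] once [|p| <= r]. The room between [sigma] and [s] absorbs all
    constants and the factor [ln r]. *)
Lemma growth_estimate (f : C -> C) (sigma s : R) : holomorphic f -> (exists p, f p <> 0%C) ->
  0 < sigma < s -> growth sigma f ->
  for_large (fun r => exists l : list C, INR (length l) <= Rpower r s /\
    forall z d, 0 < d <= 1 -> Cmod z <= 2 * r -> (forall a, In a l -> d <= Cmod (z - a)) ->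
      f z <> 0%C /\
      exp (- (Rpower r s * (1 + ln (/ d)))) <= Cmod (f z) /\
      Cmod (C_derive f z) <= Rpower r s / d * Cmod (f z) /\
      Cmod (C_derive (C_derive f) z) <= (Rpower r s / d) ^ 2 * Cmod (f z)).
Proof.
intros Hf [p Hp] Hs [R0 HR0].
assert (Hpp : 0 < Cmod (f p)) by now apply Cmod_gt_0.
set (c0 := Rabs (ln (Cmod (f p)))).
set (s1 := (sigma + s) / 2); set (e := (s - sigma) / 4).
(* The outer circle has radius [288 r] around [p], so its points have modulus at most [289 r]. *)
set (K := Rpower 289 sigma).
assert (HK : 1 <= K).
{ unfold K; rewrite <- (Rpower_O 289) by lra; apply Rle_Rpower; lra. }
assert (E1 := for_large_Rpower_dom sigma s1 (2 * 194 * K) ltac:(unfold s1; lra)).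
assert (E2 := for_large_Rpower_ge s1 (2 * 194 * c0) ltac:(unfold s1; lra)).
assert (E3 := for_large_Rpower_ge s1 16 ltac:(unfold s1; lra)).
assert (E4 := for_large_Rpower_dom s1 s 2 ltac:(unfold s1; lra)).
assert (E5 := for_large_Rpower_ge e (2 * (ln 72 + 2)) ltac:(unfold e; lra)).
assert (E6 := for_large_ln_dom e 2 ltac:(unfold e; lra) ltac:(lra)).
assert (E7 := for_large_Rpower_dom (s1 + e) s 2 ltac:(unfold s1, e; lra)).
assert (E8 := for_large_Rpower_ge s (2 * c0) ltac:(lra)).
assert (E9 := for_large_Rpower_ge sigma (c0 + 1) ltac:(lra)).
assert (E10 := for_large_ge (Rmax (Rmax 1 (Cmod p)) R0)).
generalize (for_large_and _ _ E1 (for_large_and _ _ E2 (for_large_and _ _ E3 (for_large_and _ _ E4 (for_large_and _ _ E5 (for_large_and _ _ E6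
  (for_large_and _ _ E7 (for_large_and _ _ E8 (for_large_and _ _ E9 E10))))))))).
clear E1 E2 E3 E4 E5 E6 E7 E8 E9 E10.
apply for_large_imp; intros r (E1 & E2 & E3 & E4 & E5 & E6 & E7 & E8 & E9 & E10).
assert (m1 := Rmax_spec (Rmax 1 (Cmod p)) R0).
assert (m3 := Rmax_spec 1 (Cmod p)).
assert (rp : Rpower (289 * r) sigma = K * Rpower r sigma).
{ unfold K; rewrite Rpower_mult_distr by lra; reflexivity. }
set (M := exp (Rpower (289 * r) sigma)).
assert (c0' : - c0 <= ln (Cmod (f p)) <= c0) by (apply Rabs_le_between; unfold c0; lra).
assert (rs : 0 < Rpower r sigma) by apply Rpower_pos.
assert (HM : Cmod (f p) < M).
{ rewrite <- (exp_ln (Cmod (f p))) by exact Hpp; apply exp_increasing; rewrite rp; nra. }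
assert (Hlog : ln (M / Cmod (f p)) = K * Rpower r sigma - ln (Cmod (f p))).
{ rewrite ln_div by (try apply exp_pos; exact Hpp); unfold M; rewrite ln_exp, rp; reflexivity. }
assert (Gr : forall z, Cmod (z - p) = 4 * (72 * r) -> Cmod (f z) <= M).
{ intros z Hz.
  assert (T1 := Cmod_dist_bounds p z).
  assert (T2 := Cmod_triangle_minus z p).
  eapply Rle_trans; [apply (HR0 (Cmod z)); [lra|reflexivity]|].
  apply exp_le, Rle_Rpower_l; lra. }
destruct (log_derivative_estimate f p (72 * r) M ltac:(lra) Hf Hp HM Gr) as (l & Hl & H).
rewrite Hlog in Hl, H.
set (L := K * Rpower r sigma - ln (Cmod (f p))) in *.
assert (HL : 194 * L <= Rpower r s1) by (unfold L; lra).
assert (Hs1 : 0 < Rpower r s1) by apply Rpower_pos.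
assert (HL0 : 0 <= L) by (unfold L; nra).
exists l; split; [lra|].
intros z d Hd Hz Hda.
destruct (H z d Hd) as (h1 & h2 & h3 & h4); [|exact Hda|].
{ assert (T := Cmod_triangle_minus z p); lra. }
assert (Hi : 1 <= / d) by (rewrite <- Rinv_1; apply Rinv_le_contravar; lra).
assert (fz := Cmod_ge_0 (f z)).
split; [exact h1|split; [|split]].
- eapply Rle_trans; [|exact h2].
  rewrite <- (exp_ln (Cmod (f p))) at 1 by exact Hpp; rewrite <- exp_plus; apply exp_le.
  assert (l1 : 0 <= ln (/ d)) by (rewrite <- ln_1; apply ln_le; lra).
  rewrite ln_mult by lra.
  assert (l2 : L * ln (/ d) <= Rpower r s * ln (/ d)) by (apply Rmult_le_compat_r; lra).
  assert (l3 : ln 72 + ln r + 2 <= Rpower r e) by lra.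
  assert (l0 : 0 <= ln r) by (rewrite <- ln_1; apply ln_le; lra).
  assert (l72 : 0 <= ln 72) by (rewrite <- ln_1; apply ln_le; lra).
  assert (l4 : L * (ln 72 + ln r + 2) <= Rpower r s1 * Rpower r e) by (apply Rmult_le_compat; lra).
  rewrite <- Rpower_plus in l4; lra.
- eapply Rle_trans; [exact h3|]; apply Rmult_le_compat_r; [exact fz|].
  apply Rmult_le_compat_r; lra.
- eapply Rle_trans; [exact h4|]; apply Rmult_le_compat_r; [exact fz|].
  set (B := 194 * L) in *.
  assert (B0 : 0 <= B) by (unfold B; lra).
  replace ((B / d) ^ 2 + 16 * B / d ^ 2) with ((B ^ 2 + 16 * B) * (/ d) ^ 2) by (field; lra).
  replace ((Rpower r s / d) ^ 2) with ((Rpower r s) ^ 2 * (/ d) ^ 2) by (field; lra).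
  apply Rmult_le_compat_r; [apply pow2_ge_0|].
  nra.
Qed.

(** Each [x] is closer than [w / 2] to at most one of the centres, which is struck out; one centre
    is left over. *)
Lemma pigeonhole_centres (w : R) (t : nat -> R) (xs : list R) (idx : list nat) :
  (forall i j, i <> j -> w <= Rabs (t i - t j)) -> NoDup idx -> (length xs < length idx)%nat ->
  exists i, In i idx /\ forall x, In x xs -> w / 2 <= Rabs (t i - x).
Proof.
intros Ht; revert idx; induction xs as [|x xs IH]; intros idx Hnd Hlen.
- destruct idx as [|i idx]; simpl in Hlen; [lia|]; exists i; split; [now left|simpl; tauto].
- destruct (classic (exists i, In i idx /\ Rabs (t i - x) < w / 2)) as [(i0 & Hi0 & Hx)|Hn].
  + destruct (in_split _ _ Hi0) as (l1 & l2 & E); subst idx.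
    destruct (IH (l1 ++ l2)) as (i & Hi & H).
    * now apply NoDup_remove_1 in Hnd.
    * rewrite length_app in *; simpl in *; lia.
    * exists i; split; [apply in_app_iff in Hi; apply in_app_iff; simpl; tauto|].
      intros y [<-|Hy]; [|now apply H].
      assert (i <> i0) by (intros ->; apply NoDup_remove_2 in Hnd; contradiction).
      assert (A := Ht i i0 H0); assert (T := Rabs_triang (t i - x) (x - t i0)).
      replace (t i - x + (x - t i0)) with (t i - t i0) in T by ring.
      rewrite (Rabs_minus_sym x) in T; lra.
  + destruct (IH idx Hnd) as (i & Hi & H); [simpl in Hlen; lia|].
    exists i; split; [exact Hi|]; intros y [<-|Hy]; [|now apply H].
    apply Rnot_lt_le; intros h; apply Hn; now exists i.
Qed.

(** The candidates are the midpoints of [N + 1] equal parts of the interval, one more than there are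
    points to avoid. *)
Lemma avoid_points (xs : list R) (a b : R) : a < b ->
  exists t, a <= t <= b /\ forall x, In x xs -> (b - a) / (2 * (INR (length xs) + 1)) <= Rabs (t - x).
Proof.
intros Hab.
set (N := length xs); set (w := (b - a) / (INR N + 1)).
assert (HN := pos_INR N).
assert (Hw : 0 < w) by (apply Rdiv_lt_0_compat; lra).
destruct (pigeonhole_centres w (fun i => a + (INR i + 1 / 2) * w) xs (seq 0 (N + 1))) as (i & Hi & H).
- intros i j Hij.
  replace (a + (INR i + 1 / 2) * w - (a + (INR j + 1 / 2) * w)) with ((INR i - INR j) * w) by ring.
  rewrite Rabs_mult, (Rabs_pos_eq w) by lra.
  rewrite <- (Rmult_1_l w) at 1; apply Rmult_le_compat_r; [lra|].
  destruct (Nat.lt_total i j) as [h|[h|h]]; [|contradiction|].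
  + apply le_INR in h; rewrite S_INR in h; rewrite Rabs_left1; lra.
  + apply le_INR in h; rewrite S_INR in h; rewrite Rabs_pos_eq; lra.
- apply seq_NoDup.
- rewrite length_seq; fold N; lia.
- exists (a + (INR i + 1 / 2) * w); split.
  + apply in_seq in Hi; assert (iN : (i <= N)%nat) by lia; apply le_INR in iN.
    assert (i0 := pos_INR i).
    assert (E : w * (INR N + 1) = b - a) by (unfold w; field; lra).
    split; nra.
  + intros x Hx; specialize (H x Hx).
    replace ((b - a) / (2 * (INR N + 1))) with (w / 2) by (unfold w; field; lra).
    exact H.
Qed.

(* The zeros near [z0] are at most [2 r^S] in number, so by pigeonhole some radius stays at distance
   at least [r^(-S)] from all of their moduli. *)
Lemma good_circles (f h : C -> C) (sigma gamma gamma' delta : R) :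
  holomorphic f -> holomorphic h -> (exists p, f p <> 0%C) -> (exists p, h p <> 0%C) ->
  0 < sigma -> growth sigma f -> 0 < gamma < gamma' -> growth gamma h -> 0 < delta <= 1 ->
  exists K, 0 < K /\ for_large (fun r => forall z0, Cmod z0 = r ->
    exists t, delta * r / 2 <= t <= delta * r /\ forall z, Cmod (z - z0) = t ->
      f z <> 0%C /\ Cmod (C_derive f z) <= Rpower r K * Cmod (f z) /\
      Cmod (C_derive (C_derive f) z) <= Rpower r K * Cmod (f z) /\
      exp (- Rpower r gamma') <= Cmod (h z)).
Proof.
intros Hf Hh Hf0 Hh0 Hs Gf Hg Gh Hd.
set (s1 := sigma + 1); set (s2 := (gamma + gamma') / 2).
set (S := s1 + s2).
assert (E1 := growth_estimate f sigma s1 Hf Hf0 ltac:(unfold s1; lra) Gf).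
assert (E2 := growth_estimate h gamma s2 Hh Hh0 ltac:(unfold s2; lra) Gh).
(* The second derivative costs [(r^s1 / d)^2], where the distance to the zeros is [d = r^(-S)]. *)
exists (2 * (s1 + S)); split; [unfold S, s1, s2; lra|].
set (e := (gamma' - gamma) / 4).
assert (E3 := for_large_ln_dom e (2 * S) ltac:(unfold e; lra) ltac:(unfold S, s1, s2; lra)).
assert (E4 := for_large_Rpower_ge e 2 ltac:(unfold e; lra)).
assert (E5 := for_large_Rpower_dom (s2 + e) gamma' 1 ltac:(unfold s2, e; lra)).
(* With at most [2 r^S] points to avoid on an interval of length [delta r / 2], [12 <= delta r]
   makes the gap found by [avoid_points] at least [r^(-S)]. *)
assert (E6 := for_large_ge (Rmax 1 (12 / delta))).
generalize (for_large_and _ _ E1 (for_large_and _ _ E2 (for_large_and _ _ E3 (for_large_and _ _ E4 (for_large_and _ _ E5 E6))))).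
clear E1 E2 E3 E4 E5 E6.
apply for_large_imp; intros r ((l1 & N1 & H1) & (l2 & N2 & H2) & E3 & E4 & E5 & E6) z0 Hz0.
assert (m1 := Rmax_spec 1 (12 / delta)).
assert (Hr : 1 <= r) by lra.
assert (Hdr : 12 <= delta * r).
{ apply Rle_trans with (delta * (12 / delta)); [right; field; lra|apply Rmult_le_compat_l; lra]. }
destruct (avoid_points (map (fun a => Cmod (a - z0)) (l1 ++ l2)) (delta * r / 2) (delta * r) ltac:(lra)) as (t & Ht & Hav).
exists t; split; [exact Ht|]; intros z Hz.
set (d := Rpower r (- S)).
assert (S0 : 0 < S) by (unfold S, s1, s2; lra).
assert (pS1 : Rpower r s1 <= Rpower r S) by (apply Rle_Rpower; unfold S, s2; lra).
assert (pS2 : Rpower r s2 <= Rpower r S) by (apply Rle_Rpower; unfold S, s1; lra).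
assert (pS : 1 <= Rpower r S) by (rewrite <- (Rpower_O r) by lra; apply Rle_Rpower; lra).
assert (Hd0 : 0 < d <= 1).
{ split; [apply Rpower_pos|]; unfold d; rewrite Rpower_Ropp, <- Rinv_1; apply Rinv_le_contravar; lra. }
assert (Hsep : forall a, In a (l1 ++ l2) -> d <= Cmod (z - a)).
{ intros a Ha; assert (A := Hav _ (in_map (fun a => Cmod (a - z0)) _ _ Ha)).
  rewrite length_map, length_app, plus_INR in A.
  assert (T1 := Cmod_triangle_sub (z - z0) (a - z0)); assert (T2 := Cmod_triangle_sub (a - z0) (z - z0)).
  replace (z - z0 - (a - z0))%C with (z - a)%C in T1 by ring.
  replace (a - z0 - (z - z0))%C with (a - z)%C in T2 by ring.
  rewrite (Cmod_sub_sym a z) in T2; rewrite Hz in T1, T2.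
  assert (B : Rabs (t - Cmod (a - z0)) <= Cmod (z - a)) by (apply Rabs_le; lra).
  eapply Rle_trans; [|exact B]; eapply Rle_trans; [|exact A].
  assert (P1 := pos_INR (length l1)); assert (P2 := pos_INR (length l2)).
  unfold d; rewrite Rpower_Ropp.
  apply Rle_div_r; [lra|].
  apply Rle_trans with (/ Rpower r S * (6 * Rpower r S)).
  - apply Rmult_le_compat_l; [apply Rlt_le, Rinv_0_lt_compat; lra|lra].
  - replace (/ Rpower r S * (6 * Rpower r S)) with 6 by (field; lra); lra. }
assert (Hz2 : Cmod z <= 2 * r).
{ assert (T := Cmod_dist_bounds z0 z).
  assert (delta * r <= 1 * r) by (apply Rmult_le_compat_r; lra). lra. }
destruct (H1 z d Hd0 Hz2 (fun a Ha => Hsep a (in_or_app _ _ _ (or_introl Ha)))) as (f0 & _ & f1 & f2).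
destruct (H2 z d Hd0 Hz2 (fun a Ha => Hsep a (in_or_app _ _ _ (or_intror Ha)))) as (_ & hl & _ & _).
assert (fz := Cmod_ge_0 (f z)).
assert (Q : Rpower r s1 / d = Rpower r (s1 + S)).
{ unfold d; rewrite Rpower_Ropp, Rpower_plus; field; apply Rgt_not_eq, Rpower_pos. }
assert (Q2 : Rpower r (2 * (s1 + S)) = Rpower r (s1 + S) ^ 2).
{ replace (2 * (s1 + S)) with ((s1 + S) + (s1 + S)) by ring; rewrite (Rpower_plus (s1 + S) (s1 + S)); ring. }
rewrite Q in f1, f2.
split; [exact f0|split; [|split]].
- eapply Rle_trans; [exact f1|]; apply Rmult_le_compat_r; [exact fz|].
  apply Rle_Rpower; unfold s1 in *; lra.
- rewrite Q2; exact f2.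
- eapply Rle_trans; [|exact hl]; apply exp_le.
  replace (ln (/ d)) with (S * ln r).
  2: { unfold d; rewrite Rpower_Ropp, Rinv_inv; unfold Rpower; now rewrite ln_exp. }
  rewrite Rpower_plus in E5.
  assert (p2 : 0 < Rpower r s2) by apply Rpower_pos.
  apply Ropp_le_contravar; eapply Rle_trans; [|exact E5].
  rewrite Rmult_1_l; apply Rmult_le_compat_l; lra.
Qed.

(** * Maximum modulus, order and lower order *)

Lemma circle_closed r : cclosed (fun z => Cmod z = r).
Proof.
intros z H; apply NNPP; intros Hn.
assert (Hp : 0 < Rabs (Cmod z - r)) by (apply Rabs_pos_lt; lra).
destruct (H _ Hp) as [w [Hw Hd]].
assert (T1 := Cmod_triangle_sub w z); assert (T2 := Cmod_triangle_sub z w); rewrite (Cmod_sub_sym z w) in T2.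
assert (Rabs (Cmod z - r) <= Cmod (w - z)) by (apply Rabs_le; lra); lra.
Qed.

Lemma Cmod_ccont (g : C -> C) (z : C) : ccont g z -> forall eps, 0 < eps -> exists d, 0 < d /\
  forall w, Cmod (w - z) < d -> Rabs (Cmod (g w) - Cmod (g z)) < eps.
Proof.
intros H e He; destruct (H e He) as [d [Hd Hg]]; exists d; split; [exact Hd|]; intros w Hw.
specialize (Hg w Hw).
assert (T1 := Cmod_triangle_sub (g w) (g z)); assert (T2 := Cmod_triangle_sub (g z) (g w)).
rewrite (Cmod_sub_sym (g z)) in T2; apply Rabs_lt_between; lra.
Qed.

Lemma circle_max (g : C -> C) (r : R) : 0 <= r -> holomorphic g ->
  exists z0, Cmod z0 = r /\ forall z, Cmod z = r -> Cmod (g z) <= Cmod (g z0).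
Proof.
intros Hr Hg.
apply (extreme_value (fun z => Cmod z = r) (fun z => Cmod (g z))).
- apply circle_closed.
- exists r; intros z ->; lra.
- exists (RtoC r); rewrite Cmod_R; now apply Rabs_pos_eq.
- intros z _ e He; destruct (Cmod_ccont g z (analytic_ccont _ _ (Hg z)) e He) as [d [Hd H]].
  exists d; split; [exact Hd|]; intros w _; apply H.
Qed.

(** The supremum in [maxmod] is finite, so that nothing is lost by [real] in [ord_quot]. *)
Lemma maxmod_attained (g : C -> C) (r : R) : 0 <= r -> holomorphic g ->
  (exists z, Cmod z = r /\ real (maxmod g r) = Cmod (g z)) /\
  (forall z, Cmod z = r -> Cmod (g z) <= real (maxmod g r)).
Proof.
intros Hr Hg; destruct (circle_max g r Hr Hg) as [z0 [Hz0 Hm]].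
assert (E : maxmod g r = Finite (Cmod (g z0))).
{ unfold maxmod; apply Rbar_is_lub_unique.
  split.
  - intros v [z [Hz ->]]; simpl; now apply Hm.
  - intros b Hb; apply Hb; now exists z0. }
rewrite E; simpl; split; [now exists z0|exact Hm].
Qed.

Lemma Rbar_lub_correct (E : Rbar -> Prop) : Rbar_is_lub E (Rbar_lub E).
Proof. unfold Rbar_lub; apply (proj2_sig (Rbar_ex_lub E)). Qed.

Lemma Rbar_glb_correct (E : Rbar -> Prop) : Rbar_is_glb E (Rbar_glb E).
Proof. unfold Rbar_glb; apply (proj2_sig (Rbar_ex_glb E)). Qed.

(** Some tail supremum of the quotient is below [A], otherwise [A] would be a lower bound of all of
    them. [B] is that supremum; it is real because it is below [A] and above the values on a
    nonempty tail. *)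
Lemma order_lt_for_large (g : C -> C) (A : R) : Rbar_lt (order g) A ->
  exists B, B < A /\ for_large (fun r => ord_quot g r <= B).
Proof.
unfold order, limsup_infty; intros H.
match type of H with Rbar_lt (Rbar_glb ?E) _ => destruct (Rbar_glb_correct E) as [_ Hgl] end.
apply NNPP; intros Hn; revert H; apply Rbar_le_not_lt, Hgl.
intros y [R0 ->]; apply Rbar_not_lt_le; intros Hlt; apply Hn.
match type of Hlt with Rbar_lt (Rbar_lub ?E) _ => destruct (Rbar_lub_correct E) as [Hub _];
  set (y := Rbar_lub E) in * end.
assert (Hy : forall r, R0 <= r -> Rbar_le (ord_quot g r) y) by (intros r Hr; apply Hub; now exists r).
destruct y as [y| |]; simpl in Hlt; [|contradiction|].
- exists y; split; [exact Hlt|]; now exists R0.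
- destruct (Hy R0 (Rle_refl _)).
Qed.

Lemma lower_order_gt_for_large (g : C -> C) (A : R) : Rbar_lt A (lower_order g) ->
  for_large (fun r => A < ord_quot g r).
Proof.
unfold lower_order, liminf_infty; intros H.
match type of H with Rbar_lt _ (Rbar_lub ?E) => destruct (Rbar_lub_correct E) as [_ Hlu] end.
apply NNPP; intros Hn; revert H; apply Rbar_le_not_lt, Hlu.
intros y [R0 ->]; apply Rbar_not_lt_le; intros Hlt; apply Hn.
match type of Hlt with Rbar_lt _ (Rbar_glb ?E) => destruct (Rbar_glb_correct E) as [Hlb _];
  set (y := Rbar_glb E) in * end.
exists R0; intros r Hr.
assert (Hy : Rbar_le y (ord_quot g r)) by (apply Hlb; now exists r).
exact (Rbar_lt_le_trans A y (ord_quot g r) Hlt Hy).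
Qed.

Lemma logplus_ge0 x : 0 <= logplus x.
Proof. apply Rmax_l. Qed.

Lemma logplus_ge x : ln x <= logplus x.
Proof. apply Rmax_r. Qed.

Lemma ord_quot_nonneg g r : 1 < r -> 0 <= ord_quot g r.
Proof.
intros Hr; apply Rdiv_le_0_compat; [apply logplus_ge0|].
rewrite <- ln_1; apply ln_increasing; lra.
Qed.

Lemma order_lt_growth (g : C -> C) (A : R) : holomorphic g -> Rbar_lt (order g) A ->
  exists B, 0 <= B < A /\ growth B g.
Proof.
intros Hg H; destruct (order_lt_for_large g A H) as [B [HB Hev]].
assert (B0 : 0 <= B).
{ destruct Hev as [R0 HR0]; assert (h1 := Rmax_spec R0 2).
  eapply Rle_trans; [apply (ord_quot_nonneg g (Rmax R0 2)); lra|apply HR0, h1]. }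
exists B; split; [lra|].
generalize (for_large_and _ _ Hev (for_large_ge 2)); apply for_large_imp; intros r [Hq Hr] z Hz.
assert (Hln : 0 < ln r) by (rewrite <- ln_1; apply ln_increasing; lra).
destruct (maxmod_attained g r ltac:(lra) Hg) as [_ Hm].
eapply Rle_trans; [apply Hm, Hz|].
unfold ord_quot in Hq; apply le_mul_of_div_le in Hq; [|exact Hln].
set (M := real (maxmod g r)) in *.
assert (l0 := logplus_ge0 M); assert (l1 := logplus_ge M).
assert (l2 := logplus_ge (logplus M)).
assert (Hl : logplus M <= Rpower r B).
(* [ln] takes the value 0 at 0, so [logplus M = 0] is a separate case. *)
{ destruct (Rle_lt_or_eq_dec _ _ l0) as [h|h]; [|rewrite <- h; apply Rlt_le, Rpower_pos].
  rewrite <- (exp_ln (logplus M)) by exact h; apply exp_le; lra. }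
destruct (Rle_dec M 0) as [h|h]; [assert (E := exp_pos (Rpower r B)); lra|].
rewrite <- (exp_ln M) by lra; apply exp_le; lra.
Qed.

(** The default value of [ln]: a positive logarithm forces a positive argument. *)
Lemma ln_nonpos x : x <= 0 -> ln x = 0.
Proof. intros H; unfold ln; destruct (Rlt_dec 0 x); [exfalso; lra|reflexivity]. Qed.

Lemma lower_order_gt_large (g : C -> C) (A : R) : holomorphic g -> 0 < A -> Rbar_lt A (lower_order g) ->
  for_large (fun r => exists z, Cmod z = r /\ exp (Rpower r A) < Cmod (g z)).
Proof.
intros Hg HA H.
generalize (for_large_and _ _ (lower_order_gt_for_large g A H) (for_large_ge 2)); apply for_large_imp; intros r [Hq Hr].
assert (Hln : 0 < ln r) by (rewrite <- ln_1; apply ln_increasing; lra).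
destruct (maxmod_attained g r ltac:(lra) Hg) as [[z [Hz E]] _].
exists z; split; [exact Hz|].
unfold ord_quot in Hq; rewrite E in Hq; apply Rlt_div_r in Hq; [|exact Hln].
set (M := Cmod (g z)) in *.
assert (p : 0 < A * ln r) by (apply Rmult_lt_0_compat; lra).
assert (Hll : A * ln r < ln (logplus M)).
{ unfold logplus at 1 in Hq; unfold Rmax in Hq; destruct (Rle_dec 0 (ln (logplus M))); lra. }
assert (Hlp : 0 < logplus M).
{ destruct (Rle_lt_or_eq_dec _ _ (logplus_ge0 M)) as [h|h]; [exact h|].
  exfalso; rewrite (ln_nonpos (logplus M)) in Hll by lra; lra. }
assert (Hl : Rpower r A < logplus M).
{ rewrite <- (exp_ln (logplus M)) by exact Hlp; apply exp_increasing; exact Hll. }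
assert (Hln2 : Rpower r A < ln M).
{ unfold logplus, Rmax in Hl; destruct (Rle_dec 0 (ln M)); [exact Hl|].
  assert (P := Rpower_pos r A); lra. }
assert (HM : 0 < M).
{ apply Rnot_le_lt; intros h; rewrite (ln_nonpos M h) in Hln2.
  assert (P := Rpower_pos r A); lra. }
rewrite <- (exp_ln M) by exact HM; now apply exp_increasing.
Qed.

Lemma Rbar_lt_between (x y : Rbar) : Rbar_lt x y -> exists r : R, Rbar_lt x r /\ Rbar_lt r y.
Proof.
destruct x as [x| |], y as [y| |]; simpl; intros H; try contradiction.
- exists ((x + y) / 2); simpl; lra.
- exists (x + 1); simpl; lra.
- exists (y - 1); simpl; lra.
- exists 0; simpl; tauto.
Qed.

Lemma growth_le (f : C -> C) (s s' : R) : s <= s' -> growth s f -> growth s' f.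
Proof.
intros Hs H; generalize (for_large_and _ _ H (for_large_ge 1)); apply for_large_imp; intros r [Hr H1] z Hz.
eapply Rle_trans; [apply Hr, Hz|]; apply exp_le; now apply Rle_Rpower.
Qed.

(** * A Phragmen-Lindelof principle *)

Lemma Re_scal_cexp (c : R) (w : C) : Re (RtoC c * cexp w)%C = c * (exp (Re w) * cos (Im w)).
Proof. destruct w; simpl; ring. Qed.

Lemma cos_sector_lower (tau a x : R) : 0 <= tau -> tau * a < PI / 2 -> Rabs x <= a -> 
  cos (tau * a) <= cos (tau * x).
Proof.
intros Ht Ha Hx.
assert (P := PI_RGT_0); assert (X := Rabs_pos x).
assert (E : cos (tau * x) = cos (tau * Rabs x)).
{ unfold Rabs; destruct (Rcase_abs x); [|reflexivity].
  replace (tau * - x) with (- (tau * x)) by ring; now rewrite cos_neg. }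
rewrite E.
assert (tau * Rabs x <= tau * a) by (apply Rmult_le_compat_l; lra).
assert (0 <= tau * Rabs x) by (apply Rmult_le_pos; lra).
apply cos_decr_1; lra.
Qed.

(** The comparison function of the strip [|y - m| <= a] with [tau a < PI / 2]: the cosine is bounded
    below there, so for [D > 0] the modulus decays doubly exponentially. A small [D] serves in
    [phragmen_lindelof]; a fixed one compensates growth [exp (r^beta)] in [sector_growth]. *)
Lemma Cmod_comparison (D tau m x y : R) :
  Cmod (cexp (RtoC (- D) * cexp (RtoC tau * ((x, y) - (0%R, m))))%C) = exp (- D * (exp (tau * x) * cos (tau * (y - m)))).
Proof.
rewrite Cmod_cexp, Re_scal_cexp; simpl.
replace (tau * (x + - 0) - 0 * (y + - m)) with (tau * x) by ring.
replace (tau * (y + - m) + 0 * (x + - 0)) with (tau * (y - m)) by ring.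
reflexivity.
Qed.

Lemma analytic_comparison (D tau m : R) (z : C) :
  analytic_at (fun w => cexp (RtoC (- D) * cexp (RtoC tau * (w - (0%R, m))))%C) z.
Proof.
apply (analytic_comp cexp (fun w => RtoC (- D) * cexp (RtoC tau * (w - (0%R, m))))%C); [apply analytic_cexp|].
apply analytic_mult; [apply analytic_const|].
apply (analytic_comp cexp (fun w => RtoC tau * (w - (0%R, m)))%C); [apply analytic_cexp|].
apply analytic_mult; [apply analytic_const|apply analytic_minus; [apply analytic_id|apply analytic_const]].
Qed.

(* A half strip is a sector in the coordinate [w = log z]; the comparison function is
   [exp (- eps e^(tau w))] with [sigma < tau < PI / (2 a)]. *)
Lemma phragmen_lindelof (G : C -> C) (s0 m a sigma A B : R) :
  0 < a -> 0 < sigma -> sigma * a < PI / 2 -> 0 < B ->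
  holomorphic G ->
  (forall s t, s0 <= s -> Rabs (t - m) <= a -> Cmod (G (s, t)) <= exp (A * exp (sigma * s))) ->
  (forall t, Rabs (t - m) <= a -> Cmod (G (s0, t)) <= B) ->
  (forall s, s0 <= s -> Cmod (G (s, m - a)) <= B /\ Cmod (G (s, m + a)) <= B) ->
  forall s t, s0 <= s -> Rabs (t - m) <= a -> Cmod (G (s, t)) <= B.
Proof.
intros Ha Hs Hsa HB HG Hgr H0 H1 s t Hst Ht.
set (tau := (sigma + PI / (2 * a)) / 2).
assert (Q : sigma < PI / (2 * a)) by (apply Rlt_div_r; lra).
assert (Htau : sigma < tau < PI / (2 * a)) by (unfold tau; lra).
assert (Hta : tau * a < PI / 2).
{ replace (PI / 2) with (PI / (2 * a) * a) by (field; lra); apply Rmult_lt_compat_r; lra. }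
set (kappa := cos (tau * a)).
assert (P := PI_RGT_0).
assert (Hk : 0 < kappa) by (apply cos_gt_0; nra).
assert (Hcos : forall x, Rabs (x - m) <= a -> kappa <= cos (tau * (x - m))).
{ intros x Hx; apply cos_sector_lower; try assumption; lra. }
assert (Key : forall eps, 0 < eps -> Cmod (G (s, t)) <= B * exp (eps * exp (tau * s))).
{ intros eps He.
  set (cmp := fun w : C => cexp (RtoC (- eps) * cexp (RtoC tau * (w - (0, m))))%C).
  assert (Hcmp : forall x y, Cmod (cmp (x, y)) = exp (- eps * (exp (tau * x) * cos (tau * (y - m))))).
  { intros x y; apply Cmod_comparison. }
  assert (Hcmp1 : forall x y, Rabs (y - m) <= a -> Cmod (cmp (x, y)) <= 1).
  { intros x y Hy; rewrite Hcmp, <- exp_0; apply exp_le.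
    specialize (Hcos y Hy); assert (E := exp_pos (tau * x)).
    assert (0 <= eps * (exp (tau * x) * cos (tau * (y - m)))); [|lra].
    apply Rmult_le_pos; [lra|apply Rmult_le_pos; lra]. }
  destruct (for_large_Rpower_dom sigma tau ((Rabs A + Rabs (ln B)) / (eps * kappa)) ltac:(lra)) as [r3 Hr3].
  set (rr := Rmax r3 1).
  assert (a1 := Rmax_spec r3 1); fold rr in a1.
  (* The right edge of the box: beyond [s], and so far out that the comparison function beats the
     growth bound. *)
  set (S := Rmax (ln rr) (s + 1)).
  assert (S1 := Rmax_spec (ln rr) (s + 1)); fold S in S1.
  assert (HS : rr <= exp S).
  { rewrite <- (exp_ln rr) by lra; now apply exp_le. }
  assert (PS : forall x, Rpower (exp S) x = exp (x * S)) by (intros x; unfold Rpower; now rewrite ln_exp).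
  assert (HS3 := Hr3 (exp S) ltac:(lra)); rewrite !PS in HS3.
  assert (S0 : 0 <= S).
  { rewrite <- (ln_exp S), <- ln_1; apply ln_le; lra. }
  assert (eS : 1 <= exp (sigma * S)).
  { rewrite <- exp_0; apply exp_le, Rmult_le_pos; lra. }
  assert (ek : 0 < eps * kappa) by (apply Rmult_lt_0_compat; lra).
  assert (HSf : A * exp (sigma * S) - eps * kappa * exp (tau * S) <= ln B).
  { assert (X : (Rabs A + Rabs (ln B)) * exp (sigma * S) <= eps * kappa * exp (tau * S)).
    { apply Rmult_le_compat_l with (r := eps * kappa) in HS3; [|lra].
      replace (eps * kappa * ((Rabs A + Rabs (ln B)) / (eps * kappa) * exp (sigma * S))) with
        ((Rabs A + Rabs (ln B)) * exp (sigma * S)) in HS3 by (field; lra).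
      exact HS3. }
    assert (Y1 := Rle_abs A); assert (Y2 := Rle_abs (- ln B)); rewrite Rabs_Ropp in Y2.
    assert (Y3 := Rabs_pos (ln B)).
    nra. }
  set (F := fun w => (G w * cmp w)%C).
  assert (HF : forall z, in_box (Box s0 S (m - a) (m + a)) z -> Cmod (F z) <= B).
  { apply max_principle_box.
    - intros z _; apply analytic_mult; [apply HG|apply analytic_comparison].
    - intros [x y] Hz Hn; unfold in_box, in_interior in Hz, Hn; simpl in Hz, Hn.
      assert (Hy : Rabs (y - m) <= a) by (apply Rabs_le; lra).
      unfold F; rewrite Cmod_mult.
      assert (C1 := Hcmp1 x y Hy); assert (C0 := Cmod_ge_0 (cmp (x, y))); assert (G0 := Cmod_ge_0 (G (x, y))).
      destruct (Req_dec x s0) as [e1|e1]; [subst x; specialize (H0 y Hy); nra|].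
      destruct (Req_dec y (m - a)) as [e2|e2]; [subst y; destruct (H1 x ltac:(lra)) as [h _]; nra|].
      destruct (Req_dec y (m + a)) as [e3|e3]; [subst y; destruct (H1 x ltac:(lra)) as [_ h]; nra|].
      assert (x = S) by (apply NNPP; intros e4; apply Hn; lra); subst x.
      apply Rle_trans with (exp (A * exp (sigma * S)) * Cmod (cmp (S, y))).
      + apply Rmult_le_compat_r; [exact C0|apply Hgr; lra].
      + rewrite Hcmp, <- exp_plus, <- (exp_ln B) by exact HB; apply exp_le.
        specialize (Hcos y Hy); assert (E := exp_pos (tau * S)).
        assert (eps * kappa * exp (tau * S) <= eps * (exp (tau * S) * cos (tau * (y - m)))).
        { rewrite Rmult_assoc; apply Rmult_le_compat_l; [lra|].
          rewrite Rmult_comm; apply Rmult_le_compat_l; lra. }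
        lra. }
  assert (Hin : in_box (Box s0 S (m - a) (m + a)) (s, t)).
  { apply Rabs_le_between in Ht; unfold in_box; simpl; lra. }
  specialize (HF _ Hin); unfold F in HF; rewrite Cmod_mult, Hcmp in HF.
  assert (L : exp (- (eps * exp (tau * s))) <= exp (- eps * (exp (tau * s) * cos (tau * (t - m))))).
  { apply exp_le; assert (C1 := COS_bound (tau * (t - m))); assert (E := exp_pos (tau * s)).
    assert (eps * (exp (tau * s) * cos (tau * (t - m))) <= eps * exp (tau * s) * 1); [|lra].
    rewrite <- Rmult_assoc; apply Rmult_le_compat_l; [nra|lra]. }
  rewrite exp_Ropp in L.
  assert (E := exp_pos (eps * exp (tau * s))).
  assert (G0 := Cmod_ge_0 (G (s, t))).
  apply Rmult_le_compat_l with (r := Cmod (G (s, t))) in L; [|exact G0].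
  replace (Cmod (G (s, t))) with (Cmod (G (s, t)) * / exp (eps * exp (tau * s)) * exp (eps * exp (tau * s))) by (field; lra).
  apply Rmult_le_compat_r; lra. }
(* Let [eps] tend to 0: if [|G| = B q] with [q > 1], the choice of [eps] below turns the exponential
   factor into the square root of [q], which is less than [q]. *)
apply Rnot_lt_le; intros Hlt.
set (q := Cmod (G (s, t)) / B).
assert (Hq : 1 < q) by (apply Rlt_div_r; lra).
assert (Hlq : 0 < ln q) by (rewrite <- ln_1; apply ln_increasing; lra).
assert (E := exp_pos (tau * s)).
assert (K := Key (ln q / (2 * exp (tau * s))) ltac:(apply Rdiv_lt_0_compat; lra)).
replace (ln q / (2 * exp (tau * s)) * exp (tau * s)) with (ln q / 2) in K by (field; lra).
assert (X : exp (ln q / 2) < q) by (rewrite <- (exp_ln q) at 2 by lra; apply exp_increasing; lra).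
assert (Y : Cmod (G (s, t)) = B * q) by (unfold q; field; lra).
nra.
Qed.

(** * Sectors *)

Lemma pow_n_Cpow (z : C) (k : nat) : @pow_n C_Ring z k = (z ^ k)%C.
Proof. induction k as [|k IH]; [reflexivity|]; change (z * @pow_n C_Ring z k = z * z ^ k)%C; now rewrite IH. Qed.

Lemma cpoly_S (b : nat -> C) (m : nat) (z : C) : cpoly b (S m) z = (cpoly b m z + b (S m) * z ^ S m)%C.
Proof.
unfold cpoly; rewrite sum_Sn; change plus with Cplus; rewrite pow_n_Cpow; reflexivity.
Qed.

Lemma cpoly_bound (b : nat -> C) (m : nat) : exists K, 0 <= K /\
  forall z, 1 <= Cmod z -> Cmod (cpoly b m z) <= K * Cmod z ^ m.
Proof.
induction m as [|m [K [HK IH]]].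
- exists (Cmod (b 0%nat)); split; [apply Cmod_ge_0|]; intros z Hz.
  unfold cpoly; rewrite sum_O, pow_n_Cpow; simpl; rewrite Rmult_1_r, Cmult_1_r; lra.
- exists (K + Cmod (b (S m))); split; [assert (T := Cmod_ge_0 (b (S m))); lra|]; intros z Hz.
  rewrite cpoly_S; eapply Rle_trans; [apply Cmod_triangle|].
  rewrite Cmod_mult, Cmod_pow, Rmult_plus_distr_r; apply Rplus_le_compat_r.
  eapply Rle_trans; [apply IH, Hz|]; apply Rmult_le_compat_l; [exact HK|].
  apply Rle_pow; [exact Hz|lia].
Qed.

Lemma pow_diff_bound (z w : C) (B : R) (n : nat) : Cmod z <= B -> Cmod w <= B ->
  Cmod (z ^ S n - w ^ S n) <= INR (S n) * B ^ n * Cmod (z - w).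
Proof.
intros Hz Hw; assert (B0 : 0 <= B) by (eapply Rle_trans; [apply Cmod_ge_0|exact Hz]).
induction n as [|n IH].
- replace (z ^ 1 - w ^ 1)%C with (z - w)%C by (simpl; ring); simpl; lra.
- replace (z ^ S (S n) - w ^ S (S n))%C with (z * (z ^ S n - w ^ S n) + (z - w) * w ^ S n)%C by (simpl; ring).
  eapply Rle_trans; [apply Cmod_triangle|]; rewrite !Cmod_mult.
  rewrite (S_INR (S n)).
  replace ((INR (S n) + 1) * B ^ S n * Cmod (z - w)) with
    (B * (INR (S n) * B ^ n * Cmod (z - w)) + Cmod (z - w) * B ^ S n) by (simpl pow; ring).
  apply Rplus_le_compat.
  + apply Rmult_le_compat; try apply Cmod_ge_0; assumption.
  + apply Rmult_le_compat_l; [apply Cmod_ge_0|].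
    rewrite Cmod_pow; apply pow_incr; split; [apply Cmod_ge_0|exact Hw].
Qed.

Lemma Re_scal (e : R) (z : C) : Re (RtoC e * z)%C = e * Re z.
Proof. destruct z; simpl; ring. Qed.

(** On a disc of radius [delta |z0|] the leading term changes by a small multiple of [r^n], and the
    lower terms are [O(r^(n-1))]. The sign [e] serves both the region where the real part is
    positive and the one where it is negative. *)
Lemma cpoly_real_part (b : nat -> C) (n : nat) (eta : R) : (1 <= n)%nat -> 0 < eta ->
  exists delta, 0 < delta <= 1 / 2 /\ for_large (fun r => forall z0 e, Cmod z0 = r -> Rabs e = 1 ->
    2 * eta * r ^ n <= e * Re (b n * z0 ^ n)%C ->
    forall z, Cmod (z - z0) <= delta * r -> eta * r ^ n <= e * Re (cpoly b n z)).
Proof.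
intros Hn Heta; destruct n as [|m]; [lia|]; clear Hn.
destruct (cpoly_bound b m) as [K [HK HKb]].
set (D := Cmod (b (S m)) * (INR (S m) * 2 ^ m) + 1).
assert (p2 : 0 < 2 ^ m) by (apply pow_lt; lra).
assert (HD : 1 <= D).
{ unfold D; assert (0 <= Cmod (b (S m)) * (INR (S m) * 2 ^ m)); [|lra].
  apply Rmult_le_pos; [apply Cmod_ge_0|apply Rmult_le_pos; [apply pos_INR|lra]]. }
(* One half of [eta] pays for moving from [z0] to [z], the other for the lower terms. *)
set (delta := Rmin (1 / 2) (eta / (2 * D))).
assert (d1 := Rmin_spec (1 / 2) (eta / (2 * D))); fold delta in d1.
assert (d0 : 0 < delta) by (apply Rmin_glb_lt; [lra|apply Rdiv_lt_0_compat; lra]).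
exists delta; split; [lra|].
exists (Rmax 2 (K * 2 ^ m * 2 / eta)); intros r Hr z0 e Hz0 He Hre z Hz.
assert (r1 := Rmax_spec 2 (K * 2 ^ m * 2 / eta)).
assert (dr : delta * r <= r / 2) by (replace (r / 2) with (1 / 2 * r) by field; apply Rmult_le_compat_r; lra).
assert (zb : Cmod z <= 2 * r /\ 1 <= Cmod z).
{ assert (T1 := Cmod_dist_bounds z0 z).
  assert (T2 := Cmod_triangle_sub z0 (z0 - z)); replace (z0 - (z0 - z))%C with z in T2 by ring.
  rewrite (Cmod_sub_sym z0 z) in T2; lra. }
set (X := (cpoly b m z + b (S m) * (z ^ S m - z0 ^ S m))%C).
assert (E : e * Re (cpoly b (S m) z) = e * Re (b (S m) * z0 ^ S m)%C + e * Re X).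
{ rewrite cpoly_S; unfold X; rewrite <- Rmult_plus_distr_l; f_equal.
  replace (cpoly b m z + b (S m) * z ^ S m)%C with (b (S m) * z0 ^ S m + (cpoly b m z + b (S m) * (z ^ S m - z0 ^ S m)))%C by ring.
  reflexivity. }
assert (rm : 0 < r ^ m) by (apply pow_lt; lra).
assert (HX : Cmod X <= eta * r ^ S m).
{ unfold X; eapply Rle_trans; [apply Cmod_triangle|]; rewrite Cmod_mult.
  assert (A1 : Cmod (cpoly b m z) <= eta / 2 * r ^ S m).
  { eapply Rle_trans; [apply HKb, zb|].
    apply Rle_trans with (K * (2 ^ m * r ^ m)).
    - rewrite <- Rpow_mult_distr; apply Rmult_le_compat_l; [exact HK|]; apply pow_incr; lra.
    - simpl; replace (K * (2 ^ m * r ^ m)) with (eta / 2 * ((K * 2 ^ m * 2 / eta) * r ^ m)) by (field; lra).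
      apply Rmult_le_compat_l; [lra|]; apply Rmult_le_compat_r; lra. }
  assert (A2 : Cmod (b (S m)) * Cmod (z ^ S m - z0 ^ S m) <= eta / 2 * r ^ S m).
  { eapply Rle_trans; [apply Rmult_le_compat_l; [apply Cmod_ge_0|apply (pow_diff_bound z z0 (2 * r)); lra]|].
    rewrite Rpow_mult_distr.
    replace (Cmod (b (S m)) * (INR (S m) * (2 ^ m * r ^ m) * Cmod (z - z0))) with
      (Cmod (b (S m)) * (INR (S m) * 2 ^ m) * (r ^ m * Cmod (z - z0))) by ring.
    apply Rle_trans with (D * (r ^ m * (eta / (2 * D) * r))).
    - apply Rmult_le_compat.
      + apply Rmult_le_pos; [apply Cmod_ge_0|apply Rmult_le_pos; [apply pos_INR|lra]].
      + apply Rmult_le_pos; [lra|apply Cmod_ge_0].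
      + unfold D; lra.
      + apply Rmult_le_compat_l; [lra|]; eapply Rle_trans; [exact Hz|]; apply Rmult_le_compat_r; lra.
    - simpl; right; field; lra. }
  lra. }
assert (eX : - (eta * r ^ S m) <= e * Re X).
{ assert (Y : Rabs (e * Re X) <= eta * r ^ S m).
  { rewrite Rabs_mult, He, Rmult_1_l; eapply Rle_trans; [apply re_le_Cmod|exact HX]. }
  apply Rabs_le_between in Y; lra. }
rewrite E; lra.
Qed.

Lemma cos_shift_Z (x : R) (k : Z) : cos (x + 2 * IZR k * PI) = cos x.
Proof.
assert (H : forall (m : nat) y, cos (y + 2 * INR m * PI) = cos y) by (intros; apply cos_period).
destruct (Z_le_dec 0 k) as [h|h].
- rewrite <- (Z2Nat.id k h), <- INR_IZR_INZ; apply H.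
- rewrite <- (H (Z.to_nat (- k)) (x + 2 * IZR k * PI)), INR_IZR_INZ, Z2Nat.id, opp_IZR by lia.
  f_equal; ring.
Qed.

Lemma Rabs_cos_shift_Z (x : R) (k : Z) : Rabs (cos (x + IZR k * PI)) = Rabs (cos x).
Proof.
assert (H : forall (m : nat) y, Rabs (cos (y + INR m * PI)) = Rabs (cos y)).
{ induction m as [|m IH]; intros y; [simpl; do 2 f_equal; ring|].
  rewrite S_INR; replace (y + (INR m + 1) * PI) with ((y + INR m * PI) + PI) by ring.
  now rewrite neg_cos, Rabs_Ropp. }
destruct (Z_le_dec 0 k) as [h|h].
- rewrite <- (Z2Nat.id k h), <- INR_IZR_INZ; apply H.
- rewrite <- (H (Z.to_nat (- k)) (x + IZR k * PI)), INR_IZR_INZ, Z2Nat.id, opp_IZR by lia.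
  do 2 f_equal; ring.
Qed.

Lemma mod_period (x p : R) : 0 < p -> exists k : Z, 0 <= x - IZR k * p < p.
Proof.
intros Hp; exists (Int_part (x / p)).
destruct (base_Int_part (x / p)) as [h1 h2].
assert (E : x = x / p * p) by (field; lra).
set (k := IZR (Int_part (x / p))) in *; rewrite E at 1 2; split.
- assert (0 <= (x / p - k) * p) by (apply Rmult_le_pos; lra). lra.
- assert ((x / p - k) * p < 1 * p) by (apply Rmult_lt_compat_r; lra). lra.
Qed.

Lemma cos_half_pi_plus (e : R) : cos (PI / 2 + e) = - sin e.
Proof. rewrite cos_plus, cos_PI2, sin_PI2; ring. Qed.

(** Modulo [2 PI], [cos x < sin e] means that [x] is within [PI / 2 + e] of [PI]. So the remaining
    directions lie in sectors around those of cosine -1, and on the sides of these sectors the good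
    inequality holds again. *)
Lemma negative_sector (n phi theta e : R) : 0 < n -> 0 < e < PI / 2 ->
  sin e <= cos (n * theta + phi) \/
  exists m, Rabs (theta - m) <= (PI / 2 + e) / n /\
    cos (n * (m - (PI / 2 + e) / n) + phi) = sin e /\ cos (n * (m + (PI / 2 + e) / n) + phi) = sin e.
Proof.
intros Hn He; assert (P := PI_RGT_0).
destruct (mod_period (n * theta + phi) (2 * PI) ltac:(lra)) as [k Hk].
set (x := n * theta + phi - IZR k * (2 * PI)) in *.
assert (Ex : n * theta + phi = x + 2 * IZR k * PI) by (unfold x; ring).
rewrite Ex, cos_shift_Z.
destruct (Rle_dec (sin e) (cos x)) as [h|h]; [now left|right].
exists ((PI + 2 * IZR k * PI - phi) / n).
split; [|split].
- replace (theta - (PI + 2 * IZR k * PI - phi) / n) with ((x - PI) / n) by (unfold x; field; lra).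
  unfold Rdiv; rewrite Rabs_mult, (Rabs_pos_eq (/ n)) by (apply Rlt_le, Rinv_0_lt_compat; lra).
  apply Rmult_le_compat_r; [apply Rlt_le, Rinv_0_lt_compat; lra|].
  apply Rnot_lt_le; intros hl; apply h.
  set (y := Rabs (x - PI)) in *.
  assert (Hy : y <= PI) by (apply Rabs_le; lra).
  assert (Ey : cos x = - cos y).
  { replace x with ((x - PI) + PI) by ring; rewrite neg_cos; f_equal.
    unfold y, Rabs; destruct (Rcase_abs (x - PI)); [now rewrite cos_neg|reflexivity]. }
  rewrite Ey; assert (D := cos_decr_1 (PI / 2 + e) y); rewrite cos_half_pi_plus in D.
  assert (cos y <= - sin e) by (apply D; lra). lra.
- replace (n * ((PI + 2 * IZR k * PI - phi) / n - (PI / 2 + e) / n) + phi) with ((PI / 2 - e) + 2 * IZR k * PI) by (field; lra).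
  rewrite cos_shift_Z; replace (PI / 2 - e) with (PI / 2 + - e) by ring; rewrite cos_half_pi_plus, sin_neg; ring.
- replace (n * ((PI + 2 * IZR k * PI - phi) / n + (PI / 2 + e) / n) + phi) with ((PI / 2 + e) + PI + 2 * IZR k * PI) by (field; lra).
  rewrite cos_shift_Z, neg_cos, cos_half_pi_plus; ring.
Qed.

(** The same reduction modulo [PI]: the sectors are centred at the zeros of the cosine and become as
    thin as desired with [e]. *)
Lemma critical_sector (n phi theta e : R) : 0 < n -> 0 < e < PI / 2 ->
  sin e <= Rabs (cos (n * theta + phi)) \/
  exists m, Rabs (theta - m) <= e / n /\
    sin e <= Rabs (cos (n * (m - e / n) + phi)) /\ sin e <= Rabs (cos (n * (m + e / n) + phi)).
Proof.
intros Hn He; assert (P := PI_RGT_0).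
assert (se : 0 <= sin e) by (apply sin_ge_0; lra).
destruct (mod_period (n * theta + phi) PI P) as [k Hk].
set (x := n * theta + phi - IZR k * PI) in *.
assert (Ex : n * theta + phi = x + IZR k * PI) by (unfold x; ring).
rewrite Ex, Rabs_cos_shift_Z.
destruct (Rle_dec (sin e) (Rabs (cos x))) as [h|h]; [now left|right].
exists ((PI / 2 + IZR k * PI - phi) / n).
split; [|split].
- replace (theta - (PI / 2 + IZR k * PI - phi) / n) with ((x - PI / 2) / n) by (unfold x; field; lra).
  unfold Rdiv at 1; rewrite Rabs_mult, (Rabs_pos_eq (/ n)) by (apply Rlt_le, Rinv_0_lt_compat; lra).
  apply Rmult_le_compat_r; [apply Rlt_le, Rinv_0_lt_compat; lra|].
  apply Rnot_lt_le; intros hl; apply h.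
  replace x with (PI / 2 + (x - PI / 2)) by ring; rewrite cos_half_pi_plus, Rabs_Ropp.
  set (y := x - PI / 2) in *.
  assert (Hy : - (PI / 2) <= y <= PI / 2) by (unfold y; lra).
  unfold Rabs in hl; destruct (Rcase_abs y).
  + assert (D := sin_incr_1 e (- y)); rewrite sin_neg in D.
    eapply Rle_trans; [apply D; lra|]; rewrite <- Rabs_Ropp; apply Rle_abs.
  + eapply Rle_trans; [apply (sin_incr_1 e y); lra|]; apply Rle_abs.
- replace (n * ((PI / 2 + IZR k * PI - phi) / n - e / n) + phi) with ((PI / 2 + - e) + IZR k * PI) by (field; lra).
  rewrite Rabs_cos_shift_Z, cos_half_pi_plus, sin_neg, Ropp_involutive; apply Rle_abs.
- replace (n * ((PI / 2 + IZR k * PI - phi) / n + e / n) + phi) with ((PI / 2 + e) + IZR k * PI) by (field; lra).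
  rewrite Rabs_cos_shift_Z, cos_half_pi_plus, Rabs_Ropp; apply Rle_abs.
Qed.

(** The range of [theta] later bounds the angle between two points of a circle. *)
Lemma polar (z : C) : exists theta, - PI <= theta <= PI /\ z = (RtoC (Cmod z) * cexp (0, theta))%C.
Proof.
assert (P := PI_RGT_0).
destruct (classic (z = 0%C)) as [->|Hz].
{ exists 0; split; [lra|]; rewrite Cmod_0; ring. }
assert (Hm : 0 < Cmod z) by now apply Cmod_gt_0.
set (m := Cmod z) in *.
assert (S := Cmod_sqr z); fold m in S.
set (c := Re z / m); set (s := Im z / m).
assert (Hcs : c ^ 2 + s ^ 2 = 1) by (unfold c, s; replace 1 with ((Re z ^ 2 + Im z ^ 2) / m ^ 2) by (rewrite <- S; field; lra); field; lra).
assert (Hc : -1 <= c <= 1) by nra.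
assert (Hz' : z = (m * c, m * s)).
{ unfold c, s; rewrite (surjective_pairing z) at 1; f_equal; unfold Re, Im; field; lra. }
assert (B := acos_bound c).
assert (Sn : sin (acos c) = Rabs s).
{ rewrite sin_acos by lra; rewrite <- sqrt_Rsqr_abs; f_equal; unfold Rsqr; nra. }
assert (Cs : cos (acos c) = c) by (apply cos_acos; lra).
destruct (Rle_dec 0 s) as [h|h].
- exists (acos c); split; [lra|].
  rewrite Rabs_pos_eq in Sn by exact h.
  rewrite Hz' at 1; unfold cexp; simpl; rewrite exp_0, Sn, Cs; unfold Cmult; simpl; f_equal; ring.
- exists (- acos c); split; [lra|].
  rewrite Rabs_left in Sn by lra.
  rewrite Hz' at 1; unfold cexp; simpl; rewrite exp_0, sin_neg, cos_neg, Sn, Cs; unfold Cmult; simpl; f_equal; ring.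
Qed.

Lemma cexp_pow (w : C) (n : nat) : (cexp w ^ n)%C = cexp (RtoC (INR n) * w).
Proof.
induction n as [|n IH].
- simpl; replace (0 * w)%C with (RtoC 0) by ring; now rewrite cexp_0.
- rewrite S_INR, RtoC_plus; replace ((INR n + 1) * w)%C with (w + INR n * w)%C by ring.
  rewrite cexp_plus, <- IH; reflexivity.
Qed.

Lemma cexp_log (s theta : R) : cexp (s, theta) = (RtoC (exp s) * cexp (0, theta))%C.
Proof. unfold cexp; simpl; rewrite exp_0; unfold Cmult; simpl; f_equal; ring. Qed.

Lemma exists_log (z : C) : 0 < Cmod z -> exists theta, z = cexp (ln (Cmod z), theta).
Proof.
intros Hz; destruct (polar z) as [theta [_ E]]; exists theta.
rewrite cexp_log, exp_ln by exact Hz; exact E.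
Qed.

Lemma leading_term_polar (b : C) (n : nat) : exists phi, forall s theta,
  Re (b * cexp (s, theta) ^ n)%C = Cmod b * exp s ^ n * cos (INR n * theta + phi).
Proof.
destruct (polar b) as [phi [_ E]]; exists phi; intros s theta.
rewrite cexp_pow, E at 1.
replace (Cmod b * cexp (0, phi) * cexp (INR n * (s, theta)))%C with
  (RtoC (Cmod b) * cexp ((0, phi) + INR n * (s, theta)))%C by (rewrite cexp_plus; ring).
rewrite Re_scal; unfold cexp; simpl.
replace (0 + (INR n * s - 0 * theta)) with (INR n * s) by ring.
replace (phi + (INR n * theta + 0 * s)) with (INR n * theta + phi) by ring.
replace (exp (INR n * s)) with (exp s ^ n); [ring|].
clear; induction n as [|n IH]; [simpl; rewrite Rmult_0_l, exp_0; reflexivity|].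
rewrite S_INR; simpl; rewrite IH, <- exp_plus; f_equal; ring.
Qed.

(** * Estimates for solutions *)

Lemma Rpower_exp s x : Rpower (exp s) x = exp (x * s).
Proof. unfold Rpower; now rewrite ln_exp. Qed.

Lemma Rpower_as_exp r x : Rpower r x = exp (x * ln r).
Proof. reflexivity. Qed.

Lemma exp_add_le (x y : R) : 0 <= x -> 0 <= y -> exp x + exp y <= exp (x + y + 1).
Proof.
intros Hx Hy.
assert (a : exp x <= exp (x + y)) by (apply exp_le; lra).
assert (b : exp y <= exp (x + y)) by (apply exp_le; lra).
rewrite exp_plus; assert (c := exp_ineq1_le 1); assert (d := exp_pos (x + y)); nra.
Qed.

Lemma growth_near (f : C -> C) (s : R) : 0 < s -> growth s f ->
  for_large (fun r => forall z, r / 2 <= Cmod z <= 2 * r -> Cmod (f z) <= exp (Rpower 2 s * Rpower r s)).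
Proof.
intros Hs [R0 H]; exists (Rmax 1 (2 * R0)); intros r Hr z Hz.
assert (h1 := Rmax_spec 1 (2 * R0)).
eapply Rle_trans; [apply (H (Cmod z)); [lra|reflexivity]|].
rewrite Rpower_mult_distr by lra; apply exp_le, Rle_Rpower_l; lra.
Qed.

Lemma disc_annulus (z0 z : C) (r delta : R) : 0 <= r -> delta <= 1 / 2 -> Cmod z0 = r -> Cmod (z - z0) <= delta * r ->
  r / 2 <= Cmod z <= 2 * r.
Proof.
intros Hr Hd Hz0 Hz.
assert (delta * r <= 1 / 2 * r) by (apply Rmult_le_compat_r; lra).
assert (T1 := Cmod_dist_bounds z0 z).
assert (T2 := Cmod_triangle_sub z0 (z0 - z)); replace (z0 - (z0 - z))%C with z in T2 by ring.
rewrite (Cmod_sub_sym z0 z) in T2; lra.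
Qed.

Lemma Cmod_le_of_sum_zero (x y z : C) : (x + y + z)%C = 0%C -> Cmod z <= Cmod x + Cmod y.
Proof.
intros H; replace z with ((x + y + z) - (x + y))%C by ring; rewrite H.
replace (0 - (x + y))%C with (- (x + y))%C by ring; rewrite Cmod_opp; apply Cmod_triangle.
Qed.

(* The equation bounds [h0] on good circles, the maximum principle carries the bound to the centres. *)
Lemma coefficient_bound (f h1 h0 P1 : C -> C) (b : nat -> C) (n : nat) (k0 : C) (sigma beta beta1 eta : R) :
  (1 <= n)%nat -> holomorphic f -> holomorphic h1 -> holomorphic h0 ->
  (exists p, f p <> 0%C) -> (exists p, h1 p <> 0%C) ->
  0 < sigma -> growth sigma f -> 0 < beta < beta1 -> growth beta h1 -> 0 < eta ->
  (forall z, P1 z = (cpoly b n z + k0)%C) ->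
  (forall z, (C_derive (C_derive f) z + h1 z * cexp (P1 z) * C_derive f z + h0 z * cexp (cpoly b n z) * f z)%C = 0%C) ->
  for_large (fun r => forall z0, Cmod z0 = r -> 2 * eta * r ^ n <= Re (b n * z0 ^ n)%C ->
    Cmod (h0 z0) <= exp (Rpower r beta1)).
Proof.
intros Hn Hf Hh1 Hh0 Hf0 Hh10 Hs Gf Hb G1 Heta HP Hode.
destruct (cpoly_real_part b n eta Hn Heta) as (delta & Hdelta & EP).
destruct (good_circles f h1 sigma beta beta1 delta Hf Hh1 Hf0 Hh10 Hs Gf Hb G1 ltac:(lra)) as (K & HK & EG).
set (bb := (beta + beta1) / 2).
assert (E1 := growth_near h1 beta ltac:(lra) G1).
assert (E2 := for_large_ln_dom bb K ltac:(unfold bb; lra) ltac:(lra)).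
assert (E3 := for_large_Rpower_dom beta bb (Rpower 2 beta) ltac:(unfold bb; lra)).
assert (E4 := for_large_Rpower_ge bb (Rabs (Re k0) + 1) ltac:(unfold bb; lra)).
assert (E5 := for_large_Rpower_dom bb beta1 4 ltac:(unfold bb; lra)).
generalize (for_large_and _ _ EP (for_large_and _ _ EG (for_large_and _ _ E1 (for_large_and _ _ E2 (for_large_and _ _ E3 (for_large_and _ _ E4 (for_large_and _ _ E5 (for_large_ge 1)))))))).
clear EP EG E1 E2 E3 E4 E5.
apply for_large_imp; intros r (EP & EG & E1 & E2 & E3 & E4 & E5 & Hr) z0 Hz0 Hre.
destruct (EG z0 Hz0) as (t & Ht & Hcirc).
apply (max_principle_disc z0 t); [intros; apply Hh0| |rewrite Cmod_self; nra].
intros z Hz.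
destruct (Hcirc z Hz) as (fz & f1 & f2 & _).
assert (HRe : eta * r ^ n <= Re (cpoly b n z)).
{ rewrite <- (Rmult_1_l (Re (cpoly b n z))); apply (EP z0 1 Hz0 Rabs_R1); lra. }
assert (Hu : 0 <= Re (cpoly b n z)).
{ eapply Rle_trans; [|exact HRe]; apply Rmult_le_pos; [lra|apply pow_le; lra]. }
set (u := Re (cpoly b n z)) in *.
assert (Hz2 := disc_annulus z0 z r delta ltac:(lra) ltac:(lra) Hz0 ltac:(lra)).
assert (B1 := E1 z Hz2).
assert (Ff : 0 < Cmod (f z)) by now apply Cmod_gt_0.
(* The two exponentials have moduli [e^u] and [e^(u + Re k0)], so [e^u] finally cancels from the
   bound for [h0]. *)
assert (Hmain : Cmod (h0 z) * exp u * Cmod (f z) <= Cmod (C_derive (C_derive f) z) + Cmod (h1 z) * exp (u + Re k0) * Cmod (C_derive f z)).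
{ assert (E := Cmod_le_of_sum_zero _ _ _ (Hode z)); rewrite !Cmod_mult, !Cmod_cexp, HP in E; fold u in E.
  eapply Rle_trans; [exact E|]; right; do 3 f_equal; unfold u; destruct (cpoly b n z), k0; reflexivity. }
set (X := Rpower 2 beta * Rpower r beta) in *.
assert (X0 : 0 <= X) by (unfold X; apply Rmult_le_pos; apply Rlt_le, Rpower_pos).
assert (lr : 0 <= ln r) by (rewrite <- ln_1; apply ln_le; lra).
assert (Hm2 : Cmod (h0 z) * exp u * Cmod (f z) <= (exp (K * ln r) * (1 + exp (X + u + Re k0))) * Cmod (f z)).
{ eapply Rle_trans; [exact Hmain|].
  rewrite Rpower_as_exp in f1, f2.
  assert (Q : Cmod (h1 z) * exp (u + Re k0) * Cmod (C_derive f z) <= exp X * exp (u + Re k0) * (exp (K * ln r) * Cmod (f z))).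
  { apply Rmult_le_compat; [apply Rmult_le_pos; [apply Cmod_ge_0|apply Rlt_le, exp_pos]|apply Cmod_ge_0| |exact f1].
    apply Rmult_le_compat_r; [apply Rlt_le, exp_pos|exact B1]. }
  rewrite <- exp_plus in Q; replace (X + (u + Re k0)) with (X + u + Re k0) in Q by ring.
  lra. }
apply Rmult_le_reg_r in Hm2; [|exact Ff].
assert (Hk := Rle_abs (Re k0)); assert (Hk0 := Rabs_pos (Re k0)).
apply Rmult_le_reg_r with (exp u); [apply exp_pos|].
eapply Rle_trans; [exact Hm2|].
assert (Y1 : 1 + exp (X + u + Re k0) <= exp (X + u + Rabs (Re k0) + 1)).
{ rewrite <- exp_0 at 1; eapply Rle_trans; [apply Rplus_le_compat_l, (exp_le _ (X + u + Rabs (Re k0))); lra|].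
  replace (X + u + Rabs (Re k0) + 1) with (0 + (X + u + Rabs (Re k0)) + 1) by ring.
  apply exp_add_le; lra. }
eapply Rle_trans; [apply Rmult_le_compat_l; [apply Rlt_le, exp_pos|exact Y1]|].
rewrite <- !exp_plus; apply exp_le; lra.
Qed.

(** In the directions not covered by the hypothesis, [h] is taken in logarithmic coordinates and
    multiplied by a comparison function that undoes [exp (r^beta)] on the sides of the sector.
    [phragmen_lindelof] bounds the product by a constant, and dividing back costs only the factor
    [D] in the exponent. *)
Lemma sector_growth (h : C -> C) (bn : C) (n : nat) (beta gamma : R) :
  (1 <= n)%nat -> holomorphic h -> bn <> 0%C -> 0 < beta < gamma -> gamma < INR n -> growth gamma h ->
  (forall eta, 0 < eta -> for_large (fun r => forall z0, Cmod z0 = r -> 2 * eta * r ^ n <= Re (bn * z0 ^ n)%C ->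
     Cmod (h z0) <= exp (Rpower r beta))) ->
  exists B D, 0 < B /\ for_large (fun r => forall z, Cmod z = r -> Cmod (h z) <= B * exp (D * Rpower r beta)).
Proof.
intros Hn Hh Hbn Hbg Hgn Gh Hpos.
assert (P := PI_RGT_0).
set (N := INR n) in *.
assert (HN : 0 < N) by (unfold N; apply lt_0_INR; lia).
assert (HB0 : 0 < Cmod bn) by now apply Cmod_gt_0.
set (x := gamma / N).
assert (Hx : 0 < x < 1).
{ unfold x; split; [apply Rdiv_lt_0_compat; lra|apply Rlt_div_l; lra]. }
(* Then [gamma a = (PI / 4) x (3 - x)], below [PI / 2] because [x < 1]: the sectors, though wider
   than [PI / n], stay narrow enough for growth of order [gamma]. *)
set (e := PI / 4 * (1 - x)).
assert (He : 0 < e < PI / 2) by (unfold e; nra).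
set (a := (PI / 2 + e) / N).
assert (Ha : 0 < a) by (apply Rdiv_lt_0_compat; lra).
assert (Hga : gamma * a < PI / 2).
{ replace (gamma * a) with (x * (PI / 2 + e)) by (unfold a, x; field; lra).
  unfold e; replace (x * (PI / 2 + PI / 4 * (1 - x))) with (PI / 4 * (x * (3 - x))) by field.
  assert (x * (3 - x) < 2) by nra. nra. }
assert (Hba : beta * a < PI / 2).
{ apply Rle_lt_trans with (2 := Hga); apply Rmult_le_compat_r; lra. }
assert (se : 0 < sin e) by (apply sin_gt_0; lra).
destruct (leading_term_polar bn n) as [phi Hphi]; fold N in Hphi.
destruct (Hpos (Cmod bn * sin e / 2) ltac:(apply Rdiv_lt_0_compat; [nra|lra])) as [R1 H1].
destruct Gh as [R2 H2].
set (s0 := ln (Rmax 1 (Rmax R1 R2))).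
assert (m1 := Rmax_spec 1 (Rmax R1 R2)).
assert (m3 := Rmax_spec R1 R2).
assert (Hs0 : exp s0 = Rmax 1 (Rmax R1 R2)) by (apply exp_ln; lra).
destruct (circle_max h (exp s0) ltac:(apply Rlt_le, exp_pos) Hh) as [zm [Hzm Hmax]].
set (B := Rmax 1 (Cmod (h zm))).
assert (b1 := Rmax_spec 1 (Cmod (h zm))); fold B in b1.
set (kappa := cos (beta * a)).
assert (Hk : 0 < kappa) by (apply cos_gt_0; nra).
(* Makes the modulus of the comparison function at most [exp (- e^(beta x))] in the whole sector. *)
set (D := / kappa).
assert (HD : 0 < D) by (now apply Rinv_0_lt_compat).
assert (Ray : forall s t, s0 <= s -> sin e <= cos (N * t + phi) -> Cmod (h (cexp (s, t))) <= exp (exp (beta * s))).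
{ intros s t Hs Ht; rewrite <- Rpower_exp.
  assert (exp s0 <= exp s) by now apply exp_le.
  apply H1; [lra|rewrite Cmod_cexp; reflexivity|].
  rewrite Hphi.
  replace (2 * (Cmod bn * sin e / 2) * exp s ^ n) with (Cmod bn * exp s ^ n * sin e) by field.
  apply Rmult_le_compat_l; [|exact Ht].
  apply Rmult_le_pos; [lra|apply pow_le, Rlt_le, exp_pos]. }
exists B, D; split; [lra|].
exists (exp s0); intros r Hr z Hz.
assert (Hr0 : 0 < r) by (assert (X := exp_pos s0); lra).
destruct (exists_log z ltac:(lra)) as [theta Etheta]; rewrite Hz in Etheta.
assert (Hlr : s0 <= ln r) by (rewrite <- (ln_exp s0); apply ln_le; [apply exp_pos|exact Hr]).
rewrite Etheta.
assert (Er : Rpower r beta = exp (beta * ln r)) by reflexivity.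
destruct (negative_sector N phi theta e HN He) as [Hdir|(m & Hm & Hc1 & Hc2)].
- eapply Rle_trans; [apply Ray; assumption|].
  rewrite Er; assert (E := exp_pos (beta * ln r)).
  apply Rle_trans with (1 * exp (D * exp (beta * ln r))).
  + rewrite Rmult_1_l; apply exp_le.
    assert (1 <= D) by (unfold D; rewrite <- Rinv_1; apply Rinv_le_contravar; [exact Hk|apply COS_bound]).
    nra.
  + apply Rmult_le_compat_r; [apply Rlt_le, exp_pos|exact (proj1 b1)].
- fold a in Hm, Hc1, Hc2.
  set (cmp := fun w : C => cexp (RtoC (- D) * cexp (RtoC beta * (w - (0, m))))%C).
  assert (Hcmp : forall x y, Cmod (cmp (x, y)) = exp (- D * (exp (beta * x) * cos (beta * (y - m))))).
  { intros x' y; apply Cmod_comparison. }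
  assert (Hcos : forall y, Rabs (y - m) <= a -> kappa <= cos (beta * (y - m))).
  { intros y Hy; apply cos_sector_lower; try assumption; lra. }
  assert (Hcmp1 : forall x y, Rabs (y - m) <= a -> Cmod (cmp (x, y)) <= exp (- exp (beta * x))).
  { intros x' y Hy; rewrite Hcmp; apply exp_le.
    specialize (Hcos y Hy); assert (E := exp_pos (beta * x')).
    assert (exp (beta * x') * 1 <= exp (beta * x') * (D * cos (beta * (y - m)))); [|lra].
    apply Rmult_le_compat_l; [lra|].
    replace 1 with (D * kappa) by (unfold D; field; lra).
    apply Rmult_le_compat_l; lra. }
  assert (Hcmp2 : forall x y, Rabs (y - m) <= a -> Cmod (cmp (x, y)) <= 1).
  { intros x' y Hy; eapply Rle_trans; [now apply Hcmp1|]; rewrite <- exp_0; apply exp_le.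
    assert (E := exp_pos (beta * x')); lra. }
  assert (PL := phragmen_lindelof (fun w => h (cexp w) * cmp w)%C s0 m a gamma 1 B Ha ltac:(lra) Hga ltac:(lra)).
  assert (Hin : Cmod (h (cexp (ln r, theta)) * cmp (ln r, theta)) <= B).
  { apply PL; [| | | |exact Hlr|exact Hm].
    - intros w; apply analytic_mult; [apply (analytic_comp h cexp); [apply Hh|apply analytic_cexp]|apply analytic_comparison].
    - intros s t Hs Ht; rewrite Cmod_mult.
      assert (exp s0 <= exp s) by now apply exp_le.
      apply Rle_trans with (exp (exp (gamma * s)) * 1).
      + apply Rmult_le_compat; try apply Cmod_ge_0; [|now apply Hcmp2].
        rewrite <- Rpower_exp; apply (H2 (exp s)); [lra|rewrite Cmod_cexp; reflexivity].
      + rewrite Rmult_1_r, Rmult_1_l; lra.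
    - intros t Ht; rewrite Cmod_mult; rewrite <- (Rmult_1_r B).
      apply Rmult_le_compat; try apply Cmod_ge_0; [|now apply Hcmp2].
      eapply Rle_trans; [apply Hmax; rewrite Cmod_cexp; reflexivity|exact (proj2 b1)].
    - assert (Side : forall s t, s0 <= s -> Rabs (t - m) <= a -> sin e <= cos (N * t + phi) ->
         Cmod (h (cexp (s, t)) * cmp (s, t)) <= B).
      { intros s t Hs Ht Hst; rewrite Cmod_mult; apply Rle_trans with (2 := proj1 b1).
        apply Rle_trans with (exp (exp (beta * s)) * exp (- exp (beta * s))).
        - apply Rmult_le_compat; try apply Cmod_ge_0; [now apply Ray|now apply Hcmp1].
        - rewrite <- exp_plus; replace (exp (beta * s) + - exp (beta * s)) with 0 by ring; rewrite exp_0; lra. }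
      intros s Hs; split; apply Side; try assumption; try lra;
       [replace (m - a - m) with (- a) by ring; rewrite Rabs_Ropp|replace (m + a - m) with a by ring]; rewrite Rabs_pos_eq; lra. }
  rewrite Cmod_mult, Hcmp in Hin.
  set (q := exp (beta * ln r)) in *.
  assert (Eq : 0 < q) by apply exp_pos.
  assert (L : exp (- (D * q)) <= exp (- D * (q * cos (beta * (theta - m))))).
  { apply exp_le; assert (C1 := COS_bound (beta * (theta - m))).
    assert (D * q * cos (beta * (theta - m)) <= D * q * 1); [|lra].
    apply Rmult_le_compat_l; [nra|lra]. }
  rewrite Er; fold q.
  rewrite exp_Ropp in L.
  assert (E := exp_pos (D * q)).
  assert (G0 := Cmod_ge_0 (h (cexp (ln r, theta)))).
  apply Rmult_le_compat_l with (r := Cmod (h (cexp (ln r, theta)))) in L; [|exact G0].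
  replace (Cmod (h (cexp (ln r, theta)))) with (Cmod (h (cexp (ln r, theta))) * / exp (D * q) * exp (D * q)) by (field; lra).
  apply Rmult_le_compat_r; lra.
Qed.

(* On a good circle [f'/f] is so small that [f] is nearly constant; the maximum principle for
   [f - f z1] and for [f'] then gives the estimate at the centre, whatever the position of the zeros. *)
Lemma log_derivative_positive (f h1 h0 P1 : C -> C) (b : nat -> C) (n : nat) (k0 : C) (c sigma gamma eta : R) :
  (1 <= n)%nat -> holomorphic f -> holomorphic h1 -> holomorphic h0 ->
  (exists p, f p <> 0%C) -> (exists p, h1 p <> 0%C) ->
  0 < sigma -> growth sigma f -> 0 < gamma < INR n -> growth gamma h1 -> growth gamma h0 -> 0 < eta -> 1 < c ->
  (forall z, P1 z = (RtoC c * cpoly b n z + k0)%C) ->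
  (forall z, (C_derive (C_derive f) z + h1 z * cexp (P1 z) * C_derive f z + h0 z * cexp (cpoly b n z) * f z)%C = 0%C) ->
  for_large (fun r => forall z0, Cmod z0 = r -> 2 * eta * r ^ n <= Re (b n * z0 ^ n)%C ->
    Cmod (C_derive f z0) <= Cmod (f z0) / (2 * r)).
Proof.
intros Hn Hf Hh1 Hh0 Hf0 Hh10 Hs Gf Hg G1 G0 Heta Hc HP Hode.
destruct (cpoly_real_part b n eta Hn Heta) as (delta & Hdelta & EP).
set (g1 := (gamma + INR n) / 2); set (g2 := (g1 + INR n) / 2).
destruct (good_circles f h1 sigma gamma g1 delta Hf Hh1 Hf0 Hh10 Hs Gf ltac:(unfold g1; lra) G1 ltac:(lra)) as (K & HK & EG).
(* Up to the constant [e^(Re k0)], [|e^(P1)|] exceeds [|e^(P0)|] by a factor of at least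
   [exp (q r^n)] near [z0]; it beats all other terms, whose exponents are of order below [r^n]. *)
set (q := (c - 1) * eta).
assert (Hq : 0 < q) by (apply Rmult_lt_0_compat; lra).
assert (E1 := growth_near h0 gamma ltac:(lra) G0).
assert (E2 := for_large_ln_dom g2 (K + 1) ltac:(unfold g2, g1; lra) ltac:(lra)).
assert (E3 := for_large_Rpower_dom gamma g2 (Rpower 2 gamma) ltac:(unfold g2, g1; lra)).
assert (E4 := for_large_Rpower_ge g2 (Rabs (Re k0) + 1 + ln 32) ltac:(unfold g2, g1; lra)).
assert (E5 := for_large_Rpower_dom g1 g2 1 ltac:(unfold g2, g1; lra)).
assert (E6 := for_large_Rpower_dom g2 (INR n) (4 / q) ltac:(unfold g2, g1; lra)).
generalize (for_large_and _ _ EP (for_large_and _ _ EG (for_large_and _ _ E1 (for_large_and _ _ E2 (for_large_and _ _ E3 (for_large_and _ _ E4 (for_large_and _ _ E5 (for_large_and _ _ E6 (for_large_ge 1))))))))).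
clear EP EG E1 E2 E3 E4 E5 E6.
apply for_large_imp; intros r (EP & EG & E1 & E2 & E3 & E4 & E5 & E6 & Hr) z0 Hz0 Hre.
destruct (EG z0 Hz0) as (t & Ht & Hcirc).
assert (lr : 0 <= ln r) by (rewrite <- ln_1; apply ln_le; lra).
assert (E6' : 4 * Rpower r g2 <= q * r ^ n).
{ rewrite Rpower_pow in E6 by lra.
  apply Rmult_le_compat_l with (r := q) in E6; [|lra].
  replace (q * (4 / q * Rpower r g2)) with (4 * Rpower r g2) in E6 by (field; lra); exact E6. }
(* 32 suffices: an arc has angle at most 8 and [t <= r], so [f] differs from [f z1] by at most
   [M / 4] on the circle. Then [M <= 16 |f z0|], and [M / (32 r)] is at most [|f z0| / (2 r)]. *)
assert (Circ : forall z, Cmod (z - z0) = t -> f z <> 0%C /\ Cmod (C_derive f z) <= / (32 * r) * Cmod (f z)).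
{ intros z Hz; destruct (Hcirc z Hz) as (fz & f1 & f2 & hl); split; [exact fz|].
  assert (HRe : eta * r ^ n <= Re (cpoly b n z)).
  { rewrite <- (Rmult_1_l (Re (cpoly b n z))); apply (EP z0 1 Hz0 Rabs_R1); lra. }
  set (u := Re (cpoly b n z)) in *.
  assert (Hu : 0 <= u).
  { eapply Rle_trans; [|exact HRe]; apply Rmult_le_pos; [lra|apply pow_le; lra]. }
  assert (Hz2 := disc_annulus z0 z r delta ltac:(lra) ltac:(lra) Hz0 ltac:(lra)).
  assert (B1 := E1 z Hz2).
  set (X := Rpower 2 gamma * Rpower r gamma) in *.
  assert (X0 : 0 <= X) by (unfold X; apply Rmult_le_pos; apply Rlt_le, Rpower_pos).
  assert (Ff : 0 < Cmod (f z)) by now apply Cmod_gt_0.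
  assert (Hmain : Cmod (h1 z) * exp (c * u + Re k0) * Cmod (C_derive f z) <= Cmod (C_derive (C_derive f) z) + Cmod (h0 z) * exp u * Cmod (f z)).
  { assert (E := Hode z); rewrite <- Cplus_assoc, (Cplus_comm (h1 z * _ * _)), Cplus_assoc in E.
    apply Cmod_le_of_sum_zero in E; rewrite !Cmod_mult, !Cmod_cexp, HP in E; fold u in E.
    replace (Re (RtoC c * cpoly b n z + k0)) with (c * u + Re k0) in E
      by (unfold u; rewrite <- Re_scal; destruct (RtoC c * cpoly b n z)%C, k0; reflexivity).
    exact E. }
  rewrite Rpower_as_exp in f2.
  assert (Hup : Cmod (C_derive (C_derive f) z) + Cmod (h0 z) * exp u * Cmod (f z) <= exp (K * ln r + (X + u) + 1) * Cmod (f z)).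
  { apply Rle_trans with ((exp (K * ln r) + exp (X + u)) * Cmod (f z)).
    - rewrite Rmult_plus_distr_r; apply Rplus_le_compat; [exact f2|].
      apply Rmult_le_compat_r; [lra|]; rewrite exp_plus; apply Rmult_le_compat_r; [apply Rlt_le, exp_pos|exact B1].
    - apply Rmult_le_compat_r; [lra|]; apply exp_add_le; [apply Rmult_le_pos; lra|lra]. }
  assert (Hlow : exp (- Rpower r g1 + (c * u + Re k0)) * Cmod (C_derive f z) <= Cmod (h1 z) * exp (c * u + Re k0) * Cmod (C_derive f z)).
  { apply Rmult_le_compat_r; [apply Cmod_ge_0|]; rewrite exp_plus; apply Rmult_le_compat_r; [apply Rlt_le, exp_pos|exact hl]. }
  set (Y := - Rpower r g1 + (c * u + Re k0)) in *.
  apply Rmult_le_reg_l with (exp Y); [apply exp_pos|].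
  eapply Rle_trans; [exact Hlow|]; eapply Rle_trans; [exact Hmain|]; eapply Rle_trans; [exact Hup|].
  rewrite <- Rmult_assoc; apply Rmult_le_compat_r; [lra|].
  replace (/ (32 * r)) with (exp (- (ln 32 + ln r))).
  2: { rewrite <- ln_mult, exp_Ropp, exp_ln by lra; reflexivity. }
  rewrite <- exp_plus; apply exp_le; unfold Y.
  assert (Hk := Rle_abs (- Re k0)); rewrite Rabs_Ropp in Hk.
  assert (Hcu : q * r ^ n <= (c - 1) * u).
  { unfold q; rewrite Rmult_assoc; apply Rmult_le_compat_l; lra. }
  lra. }
assert (Ht0 : 0 <= t) by nra.
destruct (circle_max (fun w => f (z0 + w)%C) t Ht0) as (w1 & Hw1 & Hmax1).
{ intros w; apply (analytic_comp f (fun w => z0 + w)%C); [apply Hf|apply analytic_plus; [apply analytic_const|apply analytic_id]]. }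
set (z1 := (z0 + w1)%C) in *.
assert (Hz1 : Cmod (z1 - z0) = t) by (unfold z1; replace (z0 + w1 - z0)%C with w1 by ring; exact Hw1).
set (M := Cmod (f z1)) in *.
assert (HM : 0 < M) by (apply Cmod_gt_0, (proj1 (Circ z1 Hz1))).
assert (Hmax : forall z, Cmod (z - z0) = t -> Cmod (f z) <= M).
{ intros z Hz; specialize (Hmax1 _ Hz); now replace (z0 + (z - z0))%C with z in Hmax1 by ring. }
set (eps := / (32 * r)) in *.
assert (Heps : 0 < eps) by (apply Rinv_0_lt_compat; lra).
assert (Hd : forall z, Cmod (z - z0) = t -> Cmod (C_derive f z) <= eps * M).
{ intros z Hz; eapply Rle_trans; [apply Circ, Hz|]; apply Rmult_le_compat_l; [lra|now apply Hmax]. }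
assert (Htr : t <= r) by nra.
(* The mean value inequality for [f (z0 + t e^w)] as a function of [w] on a vertical segment, which
   parametrises the arc from [z1] to [z]. *)
assert (Hvar : forall z, Cmod (z - z0) = t -> Cmod (f z - f z1) <= M / 4).
{ intros z Hz.
  destruct (polar (z - z0)) as (th & Hth & Eth); destruct (polar (z1 - z0)) as (th1 & Hth1 & Eth1).
  rewrite Hz in Eth; rewrite Hz1 in Eth1.
  set (g := fun w : C => f (z0 + RtoC t * cexp w)%C).
  assert (Gz : g (0, th) = f z) by (unfold g; rewrite <- Eth; f_equal; ring).
  assert (Gz1 : g (0, th1) = f z1) by (unfold g; rewrite <- Eth1; f_equal; ring).
  assert (B := mvt_bound g (fun w => t * cexp w * C_derive f (z0 + t * cexp w))%C (0, th1) (0, th - th1) (t * (eps * M))).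
  assert (Sum : ((0, th1) + (0, (th - th1)%R))%C = (0, th)) by (unfold Cplus; simpl; f_equal; ring).
  rewrite Sum, Gz, Gz1 in B.
  assert (OnC : forall x, 0 <= x <= 1 -> Cmod (RtoC t * cexp ((0, th1) + RtoC x * (0, (th - th1)%R))) = t).
  { intros x Hx; rewrite Cmod_mult, Cmod_R, Cmod_cexp, Rabs_pos_eq by exact Ht0; simpl.
    replace (0 + (x * 0 - 0 * (th - th1))) with 0 by ring; rewrite exp_0; ring. }
  eapply Rle_trans; [apply B|].
  - intros x Hx; unfold g.
    eapply cdiff_eq; [apply (cdiff_comp f (fun w => z0 + t * cexp w)%C); [apply analytic_cdiff, Hf|]|].
    + apply cdiff_plus; [apply cdiff_const|apply cdiff_scal, cdiff_cexp].
    + ring.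
  - intros x Hx; rewrite Cmod_mult, OnC by exact Hx; apply Rmult_le_compat_l; [exact Ht0|].
    apply Hd; replace (z0 + t * cexp ((0, th1) + x * (0, (th - th1)%R)) - z0)%C with
      (t * cexp ((0, th1) + x * (0, (th - th1)%R)))%C by ring; now apply OnC.
  - assert (A : Cmod (0, th - th1) <= 8).
    { eapply Rle_trans; [apply Cmod_le_Re_Im|]; simpl; rewrite Rabs_R0, Rplus_0_l.
      assert (P4 := PI_4); apply Rabs_le; lra. }
    assert (A1 : t * (eps * M) <= r * (eps * M)) by (apply Rmult_le_compat_r; [nra|exact Htr]).
    assert (A2 : r * (eps * M) = M / 32) by (unfold eps; field; lra).
    assert (A3 := Cmod_ge_0 (0, th - th1)).
    apply Rle_trans with (M / 32 * 8); [|lra].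
    apply Rmult_le_compat; try lra.
    apply Rmult_le_pos; [exact Ht0|nra]. }
assert (F0 : Cmod (f z0 - f z1) <= M / 4).
{ apply (max_principle_disc z0 t (M / 4) (fun z => f z - f z1)%C); [|exact Hvar|rewrite Cmod_self; exact Ht0].
  intros z _; apply analytic_minus; [apply Hf|apply analytic_const]. }
assert (F1 : Cmod (C_derive f z0) <= eps * M).
{ apply (max_principle_disc z0 t (eps * M) (C_derive f)); [|exact Hd|rewrite Cmod_self; exact Ht0].
  intros z _; apply analytic_derive, Hf. }
assert (F2 := Cmod_triangle_sub (f z1) (f z0)); rewrite Cmod_sub_sym in F2; fold M in F2.
eapply Rle_trans; [exact F1|].
replace (Cmod (f z0) / (2 * r)) with (eps * (16 * Cmod (f z0))) by (unfold eps; field; lra).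
apply Rmult_le_compat_l; lra.
Qed.

(** * Growth of solutions along rays *)

Lemma gronwall_linear (E E1 : R -> R) (R0 : R) : 0 < R0 ->
  (forall s, R0 <= s -> is_derive E s (E1 s)) -> (forall s, R0 <= s -> E1 s <= E s / s) ->
  forall r, R0 <= r -> E r <= E R0 * (r / R0).
Proof.
intros HR HE HE1 r Hr.
assert (HD : forall s, R0 <= s -> is_derive (fun s => E s / s) s ((E1 s * s - E s * 1) / s ^ 2)).
{ intros s Hs; apply (is_derive_div E (fun s => s)); [now apply HE|exact (is_derive_id (K := R_AbsRing) s)|lra]. }
destruct (MVT_gen (fun s => E s / s) R0 r (fun s => (E1 s * s - E s * 1) / s ^ 2)) as [x [Hx Ex]].
- intros s Hs; rewrite Rmin_left, Rmax_right in Hs by lra; apply HD; lra.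
- intros s Hs; rewrite Rmin_left, Rmax_right in Hs by lra.
  apply continuity_pt_filterlim, (ex_derive_continuous (fun s => E s / s)); eexists; apply HD; lra.
- rewrite Rmin_left, Rmax_right in Hx by lra.
  assert (Hd : (E1 x * x - E x * 1) / x ^ 2 <= 0).
  { assert (H := HE1 x ltac:(lra)); apply Rmult_le_compat_r with (r := x) in H; [|lra].
    replace (E x / x * x) with (E x) in H by (field; lra).
    assert (0 < x ^ 2) by (apply pow_lt; lra).
    apply Rle_div_l; lra. }
  assert (H : E r / r <= E R0 / R0) by nra.
  apply Rmult_le_compat_r with (r := r) in H; [|lra].
  replace (E r / r * r) with (E r) in H by (field; lra).
  replace (E R0 * (r / R0)) with (E R0 / R0 * r) by (field; lra); exact H.
Qed.

(** The square of the modulus is differentiable even at zeros of [F]; the imaginary part is treated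
    as the real part of [- Ci * F]. *)
Lemma is_derive_Cmod_sqr_path (F : C -> C) (z u l : C) (t : R) :
  cdiff F (z + RtoC t * u)%C l ->
  is_derive (fun s : R => Cmod (F (z + RtoC s * u)%C) ^ 2) t (2 * Re (Cconj (F (z + RtoC t * u)) * (u * l))%C).
Proof.
intros H.
assert (A := is_derive_Re_path F z u l t H).
assert (B := is_derive_Re_path (fun w => - Ci * F w)%C z u (- Ci * l)%C t (cdiff_scal _ _ _ _ H)).
apply (is_derive_ext (fun s : R => Re (F (z + RtoC s * u)%C) ^ 2 + Re (- Ci * F (z + RtoC s * u))%C ^ 2)).
{ intros s; rewrite Cmod_sqr; destruct (F (z + s * u)%C); simpl; ring. }
evar_last.
- apply (is_derive_plus (V := R_NormedModule)).
  + apply (is_derive_pow (fun s : R => Re (F (z + RtoC s * u)%C)) 2 t _ A).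
  + apply (is_derive_pow (fun s : R => Re (- Ci * F (z + RtoC s * u))%C) 2 t _ B).
- unfold plus; simpl; destruct (F (z + t * u)%C), u, l; simpl; ring.
Qed.

Lemma Re_conj_mult_le (a b : C) : Re (Cconj a * b)%C <= Cmod a * Cmod b.
Proof.
eapply Rle_trans; [apply Rle_abs|]; eapply Rle_trans; [apply re_le_Cmod|].
rewrite Cmod_mult, Cmod_conj; lra.
Qed.

Lemma sqr_le_sqrt (x M r R0 : R) : 0 <= x -> 0 <= M -> 1 <= R0 <= r -> x ^ 2 <= M ^ 2 * (r / R0) -> x <= M * sqrt r.
Proof.
intros Hx HM Hr H; apply Rsqr_incr_0_var; [|apply Rmult_le_pos; [exact HM|apply sqrt_pos]].
rewrite Rsqr_mult, Rsqr_sqrt by lra; unfold Rsqr.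
replace (x * x) with (x ^ 2) by ring; eapply Rle_trans; [exact H|].
replace (M * M) with (M ^ 2) by ring; apply Rmult_le_compat_l; [apply pow2_ge_0|].
apply Rle_div_l; nra.
Qed.

(** [(|f|^2)' <= 2 |f| |f'| <= |f|^2 / r], so [|f|^2] grows at most linearly; hence the square
    root. *)
Lemma ray_growth_positive (f : C -> C) (u : C) (R0 M : R) : holomorphic f -> 1 <= R0 -> Cmod u = 1 ->
  Cmod (f (RtoC R0 * u)%C) <= M ->
  (forall r, R0 <= r -> Cmod (C_derive f (RtoC r * u)%C) <= Cmod (f (RtoC r * u)%C) / (2 * r)) ->
  forall r, R0 <= r -> Cmod (f (RtoC r * u)%C) <= M * sqrt r.
Proof.
intros Hf HR Hu HM Hd r Hr.
assert (M0 : 0 <= M) by (eapply Rle_trans; [apply Cmod_ge_0|exact HM]).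
assert (P0 : forall s : R, (0 + RtoC s * u)%C = (RtoC s * u)%C) by (intros; ring).
apply (sqr_le_sqrt _ M r R0); [apply Cmod_ge_0|exact M0|lra|].
eapply Rle_trans.
- apply (gronwall_linear (fun s : R => Cmod (f (RtoC s * u)%C) ^ 2)
   (fun s => 2 * Re (Cconj (f (RtoC s * u)) * (u * C_derive f (RtoC s * u)))%C) R0); [lra| | |exact Hr].
  + intros s Hs.
    assert (X := is_derive_Cmod_sqr_path f 0 u (C_derive f (0 + RtoC s * u)) s (analytic_cdiff _ _ (Hf _))).
    rewrite P0 in X; apply is_derive_ext with (2 := X); intros x; now rewrite P0.
  + intros s Hs.
    assert (A := Re_conj_mult_le (f (RtoC s * u)%C) (u * C_derive f (RtoC s * u))%C).
    rewrite Cmod_mult, Hu, Rmult_1_l in A.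
    assert (B := Hd s Hs); assert (F0 := Cmod_ge_0 (f (RtoC s * u)%C)).
    assert (D : Cmod (f (RtoC s * u)%C) * Cmod (C_derive f (RtoC s * u)%C) <=
      Cmod (f (RtoC s * u)%C) * (Cmod (f (RtoC s * u)%C) / (2 * s))) by (apply Rmult_le_compat_l; assumption).
    replace (Cmod (f (RtoC s * u)%C) ^ 2 / s) with (2 * (Cmod (f (RtoC s * u)%C) * (Cmod (f (RtoC s * u)%C) / (2 * s)))) by (field; lra).
    lra.
- cbv beta; apply Rmult_le_compat_r; [apply Rdiv_le_0_compat; lra|].
  apply pow_incr; split; [apply Cmod_ge_0|exact HM].
Qed.

(* Energy estimate for [y'' = A y' + B y] along a ray on which [A] and [B] are [O(r^-2)]:
   [E = |y / r|^2 + |y'|^2] satisfies [E' <= E / r]. *)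
Lemma ray_growth_negative (f A B : C -> C) (u : C) (R0 M : R) : holomorphic f -> 1 <= R0 -> Cmod u = 1 ->
  Cmod (f (RtoC R0 * u)%C) <= M -> Cmod (C_derive f (RtoC R0 * u)%C) <= M ->
  (forall z, C_derive (C_derive f) z = (A z * C_derive f z + B z * f z)%C) ->
  (forall r, R0 <= r -> Cmod (A (RtoC r * u)%C) <= / (8 * r ^ 2) /\ Cmod (B (RtoC r * u)%C) <= / (8 * r ^ 2)) ->
  forall r, R0 <= r -> Cmod (C_derive f (RtoC r * u)%C) <= 2 * M * sqrt r.
Proof.
intros Hf HR Hu HM1 HM2 Hode HAB r Hr.
assert (M0 : 0 <= M) by (eapply Rle_trans; [apply Cmod_ge_0|exact HM1]).
assert (P0 : forall s : R, (0 + RtoC s * u)%C = (RtoC s * u)%C) by (intros; ring).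
set (y := fun s : R => Cmod (f (RtoC s * u)%C)).
set (v := fun s : R => Cmod (C_derive f (RtoC s * u)%C)).
set (y2 := fun s : R => 2 * Re (Cconj (f (RtoC s * u)) * (u * C_derive f (RtoC s * u)))%C).
set (v2 := fun s : R => 2 * Re (Cconj (C_derive f (RtoC s * u)) * (u * C_derive (C_derive f) (RtoC s * u)))%C).
assert (Dy : forall s : R, is_derive (fun s => y s ^ 2) s (y2 s)).
{ intros s; assert (X := is_derive_Cmod_sqr_path f 0 u (C_derive f (0 + RtoC s * u)) s (analytic_cdiff _ _ (Hf _))).
  rewrite P0 in X; apply is_derive_ext with (2 := X); intros x; unfold y; now rewrite P0. }
assert (Dv : forall s : R, is_derive (fun s => v s ^ 2) s (v2 s)).
{ intros s; assert (X := is_derive_Cmod_sqr_path (C_derive f) 0 u (C_derive (C_derive f) (0 + RtoC s * u)) s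
    (analytic_cdiff _ _ (analytic_derive _ _ (Hf _)))).
  rewrite P0 in X; apply is_derive_ext with (2 := X); intros x; unfold v; now rewrite P0. }
assert (y0 : forall s, 0 <= y s) by (intros; apply Cmod_ge_0).
assert (v0 : forall s, 0 <= v s) by (intros; apply Cmod_ge_0).
assert (HE := gronwall_linear (fun s => y s ^ 2 / s ^ 2 + v s ^ 2)
  (fun s => (y2 s * s ^ 2 - y s ^ 2 * (2 * s)) / (s ^ 2) ^ 2 + v2 s) R0 ltac:(lra)).
assert (HE' : y r ^ 2 / r ^ 2 + v r ^ 2 <= (y R0 ^ 2 / R0 ^ 2 + v R0 ^ 2) * (r / R0)).
{ apply HE; [| |exact Hr].
  - intros s Hs; apply (is_derive_plus (V := R_NormedModule)); [|apply Dv].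
    apply (is_derive_div (fun s => y s ^ 2) (fun s => s ^ 2)); [apply Dy| |apply pow_nonzero; lra].
    evar_last; [apply (is_derive_pow (fun s : R => s) 2 s 1); exact (is_derive_id (K := R_AbsRing) s)|simpl; ring].
  - intros s Hs.
    assert (Hs2 : 0 < s ^ 2) by (apply pow_lt; lra).
    assert (B1 : y2 s <= 2 * (y s * v s)).
    { unfold y2, y, v; assert (T := Re_conj_mult_le (f (RtoC s * u)%C) (u * C_derive f (RtoC s * u))%C).
      rewrite Cmod_mult, Hu, Rmult_1_l in T; lra. }
    destruct (HAB s Hs) as [HA HB].
    set (k := / (8 * s ^ 2)) in *.
    assert (B2 : v2 s <= 2 * (v s * (k * v s + k * y s))).
    { unfold v2; assert (T := Re_conj_mult_le (C_derive f (RtoC s * u)%C) (u * C_derive (C_derive f) (RtoC s * u))%C).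
      rewrite Cmod_mult, Hu, Rmult_1_l, Hode in T; fold (v s) in T.
      assert (T2 := Cmod_triangle (A (RtoC s * u)%C * C_derive f (RtoC s * u)%C) (B (RtoC s * u)%C * f (RtoC s * u)%C)).
      rewrite !Cmod_mult in T2; fold (v s) (y s) in T2.
      assert (T3 : Cmod (A (RtoC s * u)%C) * v s <= k * v s) by (apply Rmult_le_compat_r; [apply v0|exact HA]).
      assert (T4 : Cmod (B (RtoC s * u)%C) * y s <= k * y s) by (apply Rmult_le_compat_r; [apply y0|exact HB]).
      rewrite Hode; apply Rmult_le_compat_l; [lra|]; eapply Rle_trans; [exact T|].
      apply Rmult_le_compat_l; [apply v0|]; lra. }
    (* In terms of [p] and [w = v s] the claim reduces to [3 p^2 - (9/4) p w + (3/4) w^2 >= 0], a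
       positive definite form. *)
    set (p := y s / s).
    assert (Ep : y s = p * s) by (unfold p; field; lra).
    assert (p0 : 0 <= p) by (unfold p; apply Rdiv_le_0_compat; [apply y0|lra]).
    rewrite Ep in B1, B2 |- *.
    set (w := v s) in *; assert (w0 : 0 <= w) by apply v0.
    replace ((y2 s * s ^ 2 - (p * s) ^ 2 * (2 * s)) / (s ^ 2) ^ 2) with (y2 s / s ^ 2 - 2 * p ^ 2 / s) by (field; lra).
    replace (((p * s) ^ 2 / s ^ 2 + w ^ 2) / s) with (p ^ 2 / s + w ^ 2 / s) by (field; lra).
    assert (B1' : y2 s / s ^ 2 <= 2 * p * w / s).
    { replace (2 * p * w / s) with (2 * (p * s * w) / s ^ 2) by (field; lra).
      apply Rmult_le_compat_r; [apply Rlt_le, Rinv_0_lt_compat; lra|exact B1]. }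
    assert (B2' : v2 s <= (w ^ 2 / 4 + w * p / 4) / s).
    { eapply Rle_trans; [exact B2|].
      replace (2 * (w * (k * w + k * (p * s)))) with ((w ^ 2 / 4 * / s + w * p / 4) / s) by (unfold k; field; lra).
      apply Rmult_le_compat_r; [apply Rlt_le, Rinv_0_lt_compat; lra|].
      assert (/ s <= 1) by (rewrite <- Rinv_1; apply Rinv_le_contravar; lra).
      assert (0 <= w ^ 2 / 4) by (assert (T := pow2_ge_0 w); lra). nra. }
    apply Rle_trans with ((2 * p * w - 2 * p ^ 2 + (w ^ 2 / 4 + w * p / 4)) / s); [lra|].
    replace (p ^ 2 / s + w ^ 2 / s) with ((p ^ 2 + w ^ 2) / s) by (field; lra).
    apply Rmult_le_compat_r; [apply Rlt_le, Rinv_0_lt_compat; lra|].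
    assert (T1 := pow2_ge_0 (2 * p - w)); assert (T2 := pow2_ge_0 p); assert (T3 := pow2_ge_0 w); lra. }
apply (sqr_le_sqrt _ (2 * M) r R0); [apply Cmod_ge_0|lra|lra|].
fold (v r).
assert (Hy : y R0 ^ 2 / R0 ^ 2 <= M ^ 2).
{ assert (0 < R0 ^ 2) by (apply pow_lt; lra). apply Rle_div_l; [lra|].
  assert (y R0 ^ 2 <= M ^ 2) by (apply pow_incr; split; [apply y0|exact HM1]).
  assert (1 <= R0 ^ 2) by nra. assert (T := pow2_ge_0 M). nra. }
assert (Hv : v R0 ^ 2 <= M ^ 2) by (apply pow_incr; split; [apply v0|exact HM2]).
assert (Hyr : 0 <= y r ^ 2 / r ^ 2) by (apply Rdiv_le_0_compat; [apply pow2_ge_0|apply pow_lt; lra]).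
apply Rle_trans with ((y R0 ^ 2 / R0 ^ 2 + v R0 ^ 2) * (r / R0)); [lra|].
apply Rmult_le_compat_r; [apply Rdiv_le_0_compat; lra|].
replace ((2 * M) ^ 2) with (4 * M ^ 2) by ring; assert (T := pow2_ge_0 M); lra.
Qed.

(** Cauchy estimate on discs of radius 1; the additional 1 in the exponent absorbs the constants. *)
Lemma growth_derive (f : C -> C) (s : R) : holomorphic f -> 0 < s -> growth s f -> growth (s + 1) (C_derive f).
Proof.
intros Hf Hs [R0 H].
assert (E1 := for_large_Rpower_dom s (s + 1) (2 * Rpower 2 s) ltac:(lra)).
assert (E2 := for_large_Rpower_ge (s + 1) (2 * ln 8) ltac:(lra)).
generalize (for_large_and _ _ E1 (for_large_and _ _ E2 (for_large_ge (Rmax 2 (R0 + 1))))).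
apply for_large_imp; intros r (h1 & h2 & Hr) z Hz.
assert (m1 := Rmax_spec 2 (R0 + 1)).
eapply Rle_trans; [apply (cauchy_estimate f z 1 (exp (Rpower 2 s * Rpower r s))); [lra|intros; apply Hf|]|].
- intros w Hw.
  assert (T1 := Cmod_dist_bounds z w).
  assert (T2 := Cmod_triangle_sub z (z - w)); replace (z - (z - w))%C with w in T2 by ring.
  rewrite (Cmod_sub_sym z w) in T2.
  apply Rle_trans with (1 := H (Cmod w) ltac:(lra) w eq_refl); apply exp_le.
  rewrite Rpower_mult_distr by lra; apply Rle_Rpower_l; lra.
- rewrite Rdiv_1_r; replace 8 with (exp (ln 8)) by (apply exp_ln; lra).
  rewrite <- exp_plus; apply exp_le; lra.
Qed.

Lemma sqrt_exp (s : R) : sqrt (exp s) = exp (s / 2).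
Proof.
replace (exp s) with (exp (s / 2) * exp (s / 2)) by (rewrite <- exp_plus; f_equal; field).
apply sqrt_square, Rlt_le, exp_pos.
Qed.

(** Where [u = Re P0] is negative, [c u <= u], so up to a constant both exponentials are at most
    [exp (- eta r^n)] and beat [exp (r^gamma)]. The bound [1 / (8 r^2)] is the one required by
    [ray_growth_negative]. *)
Lemma ode_coefficients_negative (h1 h0 P1 : C -> C) (b : nat -> C) (n : nat) (k0 : C) (c gamma eta : R) :
  (1 <= n)%nat -> 0 < gamma < INR n -> growth gamma h1 -> growth gamma h0 -> 0 < eta -> 1 <= c ->
  (forall z, P1 z = (RtoC c * cpoly b n z + k0)%C) ->
  for_large (fun r => forall z, Cmod z = r -> 2 * eta * r ^ n <= - Re (b n * z ^ n)%C ->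
    Cmod (- (h1 z * cexp (P1 z)))%C <= / (8 * r ^ 2) /\ Cmod (- (h0 z * cexp (cpoly b n z)))%C <= / (8 * r ^ 2)).
Proof.
intros Hn Hg G1 G0 Heta Hc HP.
destruct (cpoly_real_part b n eta Hn Heta) as (delta & Hdelta & EP).
set (g1 := (gamma + INR n) / 2).
assert (E2 := for_large_ln_dom g1 2 ltac:(unfold g1; lra) ltac:(lra)).
assert (E3 := for_large_Rpower_dom gamma g1 1 ltac:(unfold g1; lra)).
assert (E4 := for_large_Rpower_ge g1 (Rabs (Re k0) + ln 8) ltac:(unfold g1; lra)).
assert (E5 := for_large_Rpower_dom g1 (INR n) (3 / eta) ltac:(unfold g1; lra)).
generalize (for_large_and _ _ EP (for_large_and _ _ G1 (for_large_and _ _ G0 (for_large_and _ _ E2 (for_large_and _ _ E3 (for_large_and _ _ E4 (for_large_and _ _ E5 (for_large_ge 1)))))))).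
apply for_large_imp; clear EP E2 E3 E4 E5; intros r (EP & B1 & B0 & E2 & E3 & E4 & E5 & Hr) z Hz Hre.
assert (HRe : eta * r ^ n <= -1 * Re (cpoly b n z)).
{ apply (EP z (-1) Hz); [rewrite Rabs_left; lra|lra|rewrite Cmod_self; nra]. }
set (u := Re (cpoly b n z)) in *.
assert (E5' : 3 * Rpower r g1 <= eta * r ^ n).
{ rewrite Rpower_pow in E5 by lra.
  apply Rmult_le_compat_l with (r := eta) in E5; [|lra].
  replace (eta * (3 / eta * Rpower r g1)) with (3 * Rpower r g1) in E5 by (field; lra); exact E5. }
assert (Hu : u <= 0) by (assert (T := Rpower_pos r g1); lra).
assert (Hcu : c * u <= u) by nra.
assert (Hk := Rle_abs (Re k0)); assert (Hk0 := Rabs_pos (Re k0)).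
assert (Ex : / (8 * r ^ 2) = exp (- (ln 8 + 2 * ln r))).
{ rewrite exp_Ropp, exp_plus, exp_ln by lra; do 2 f_equal.
  replace (2 * ln r) with (ln r + ln r) by ring; rewrite exp_plus, exp_ln by lra; ring. }
rewrite Ex, !Cmod_opp, !Cmod_mult, !Cmod_cexp, HP.
replace (Re (RtoC c * cpoly b n z + k0)) with (c * u + Re k0)
  by (unfold u; rewrite <- Re_scal; destruct (RtoC c * cpoly b n z)%C, k0; reflexivity).
fold u; split.
- apply Rle_trans with (exp (Rpower r gamma) * exp (c * u + Re k0)).
  + apply Rmult_le_compat_r; [apply Rlt_le, exp_pos|now apply B1].
  + rewrite <- exp_plus; apply exp_le; lra.
- apply Rle_trans with (exp (Rpower r gamma) * exp u).
  + apply Rmult_le_compat_r; [apply Rlt_le, exp_pos|now apply B0].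
  + rewrite <- exp_plus; apply exp_le; lra.
Qed.

(** * A Liouville theorem and the conclusion *)

Lemma sublinear_entire_constant (g : C -> C) (R0 B : R) : holomorphic g -> 0 < R0 ->
  (forall z, R0 <= Cmod z -> Cmod (g z) <= B * sqrt (Cmod z)) -> forall z, g z = g 0%C.
Proof.
intros Hg HR HB.
assert (B0 : 0 <= B).
{ assert (T := HB (RtoC R0)); rewrite Cmod_R, Rabs_pos_eq in T by lra.
  assert (S := sqrt_lt_R0 R0 HR); assert (N := Cmod_ge_0 (g (RtoC R0))); specialize (T (Rle_refl _)); nra. }
assert (D0 : forall z, C_derive g z = 0%C).
{ intros z; apply NNPP; intros Hn.
  assert (Hq : 0 < Cmod (C_derive g z)) by now apply Cmod_gt_0.
  set (q := Cmod (C_derive g z)) in *.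
  assert (Hbq : 0 <= 16 * B / q) by (apply Rdiv_le_0_compat; lra).
  (* [rho >= |z|] gives [T <= 2 rho], and the square makes the Cauchy bound [16 B / sqrt rho]
     smaller than the supposed derivative [q]. *)
  set (rho := Rmax (Rmax (Cmod z) R0) ((16 * B / q + 1) ^ 2)).
  assert (m1 := Rmax_spec (Rmax (Cmod z) R0) ((16 * B / q + 1) ^ 2)); fold rho in m1.
  assert (m3 := Rmax_spec (Cmod z) R0).
  set (T := Cmod z + rho).
  assert (Hz0 := Cmod_ge_0 z).
  assert (Big : forall w, Cmod (w - 0) <= T -> Cmod (g w) <= B * sqrt T).
  { apply max_principle_disc; [intros; apply Hg|].
    intros w Hw; replace (w - 0)%C with w in Hw by ring.
    rewrite <- Hw; apply HB; rewrite Hw; unfold T; lra. }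
  assert (CE := cauchy_estimate g z rho (B * sqrt T) ltac:(lra) (fun w _ => Hg w)).
  assert (CE' : q <= 8 * (B * sqrt T) / rho).
  { apply CE; intros w Hw; apply Big; replace (w - 0)%C with ((w - z) + z)%C by ring.
    eapply Rle_trans; [apply Cmod_triangle|unfold T; lra]. }
  set (sr := sqrt rho).
  assert (Hsr : sr * sr = rho) by (apply sqrt_sqrt; lra).
  assert (Hsr0 : 0 < sr) by (apply sqrt_lt_R0; lra).
  assert (HT : sqrt T <= 2 * sr).
  { rewrite <- (sqrt_square (2 * sr)) by lra; apply sqrt_le_1_alt; unfold T; lra. }
  assert (Hs1 : 16 * B / q + 1 <= sr).
  { rewrite <- (sqrt_pow2 (16 * B / q + 1)) by lra; apply sqrt_le_1_alt; exact (proj2 m1). }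
  assert (X : 8 * (B * sqrt T) / rho <= 16 * B / sr).
  { rewrite <- Hsr; replace (16 * B / sr) with (8 * (B * (2 * sr)) / (sr * sr)) by (field; lra).
    apply Rmult_le_compat_r; [apply Rlt_le, Rinv_0_lt_compat; nra|].
    apply Rmult_le_compat_l; [lra|]; apply Rmult_le_compat_l; lra. }
  assert (Y : 16 * B / sr < q).
  { apply Rlt_div_l; [lra|]. assert (16 * B = 16 * B / q * q) by (field; lra). nra. }
  lra. }
intros z; apply (zero_derive_const g 0 (Cmod z + 1)).
- intros w _; rewrite <- (D0 w); apply analytic_cdiff, Hg.
- replace (z - 0)%C with z by ring; lra.
Qed.

(** The sectors around the critical rays are made as thin as the growth exponent [sigma + 1] of [f']
    demands, so that any finite order of [f] can be handled. *)
Lemma finite_order_solution_constant (f h1 h0 P1 : C -> C) (b : nat -> C) (n : nat) (k0 : C) (c sigma gamma : R) :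
  (1 <= n)%nat -> b n <> 0%C -> holomorphic f -> holomorphic h1 -> holomorphic h0 ->
  (exists p, f p <> 0%C) -> (exists p, h1 p <> 0%C) ->
  0 < sigma -> growth sigma f -> 0 < gamma < INR n -> growth gamma h1 -> growth gamma h0 -> 1 < c ->
  (forall z, P1 z = (RtoC c * cpoly b n z + k0)%C) ->
  (forall z, (C_derive (C_derive f) z + h1 z * cexp (P1 z) * C_derive f z + h0 z * cexp (cpoly b n z) * f z)%C = 0%C) ->
  forall z, f z = f 0%C.
Proof.
intros Hn Hbn Hf Hh1 Hh0 Hf0 Hh10 Hs Gf Hg G1 G0 Hc HP Hode.
assert (P := PI_RGT_0).
set (N := INR n) in *.
assert (HN : 0 < N) by lra.
assert (HB0 : 0 < Cmod (b n)) by now apply Cmod_gt_0.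
(* Makes both [e] and [(sigma + 1) a] less than [PI / 4], where [a = e / N] is the half opening of
   the sectors. *)
set (e := PI * N / (4 * (sigma + 1) + 4 * N)).
assert (He : 0 < e < PI / 2).
{ split; [apply Rdiv_lt_0_compat; nra|]; apply Rlt_div_l; nra. }
assert (se : 0 < sin e) by (apply sin_gt_0; lra).
assert (se1 : sin e <= 1) by apply SIN_bound.
set (a := e / N).
assert (Ha : 0 < a) by (apply Rdiv_lt_0_compat; lra).
assert (Hsa : (sigma + 1) * a < PI / 2).
{ replace ((sigma + 1) * a) with (PI * (sigma + 1) / (4 * (sigma + 1) + 4 * N)) by (unfold a, e; field; lra).
  apply Rlt_div_l; nra. }
set (eta := Cmod (b n) * sin e / 2).
assert (Heta : 0 < eta) by (apply Rdiv_lt_0_compat; [nra|lra]).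
destruct (leading_term_polar (b n) n) as [phi Hphi]; fold N in Hphi.
destruct (log_derivative_positive f h1 h0 P1 b n k0 c sigma gamma eta Hn Hf Hh1 Hh0 Hf0 Hh10 Hs Gf Hg G1 G0 Heta Hc HP Hode) as [R1 H1].
destruct (ode_coefficients_negative h1 h0 P1 b n k0 c gamma eta Hn Hg G1 G0 Heta ltac:(lra) HP) as [R2 H2].
destruct (growth_derive f sigma Hf Hs Gf) as [R3 H3].
set (R0 := Rmax (Rmax 1 R1) (Rmax R2 R3)).
assert (m1 := Rmax_spec (Rmax 1 R1) (Rmax R2 R3)); fold R0 in m1.
assert (m3 := Rmax_spec 1 R1); assert (m5 := Rmax_spec R2 R3).
destruct (circle_max f R0 ltac:(lra) Hf) as [za [_ Hma]].
destruct (circle_max (C_derive f) R0 ltac:(lra) (fun z => analytic_derive f z (Hf z))) as [zb [_ Hmb]].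
set (M := Cmod (f za) + Cmod (C_derive f zb) + 1).
assert (pa := Cmod_ge_0 (f za)); assert (pb := Cmod_ge_0 (C_derive f zb)).
(* The decay due to [1 / (2 r)] is given up in [Ray], but it is needed at the end to make a constant
   [f'] vanish. *)
assert (Pos : forall u, Cmod u = 1 -> 2 * eta <= Re (b n * u ^ n)%C ->
   forall r, R0 <= r -> Cmod (C_derive f (RtoC r * u)%C) <= M * sqrt r / (2 * r)).
{ intros u Hu Hre r Hr.
  assert (Hd : forall r, R0 <= r -> Cmod (C_derive f (RtoC r * u)%C) <= Cmod (f (RtoC r * u)%C) / (2 * r)).
  { intros r' Hr'; apply H1; [lra|rewrite Cmod_mult, Hu, Cmod_R, Rabs_pos_eq; lra|].
    replace (b n * (RtoC r' * u) ^ n)%C with (RtoC (r' ^ n) * (b n * u ^ n))%C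
      by (rewrite Cpow_mult_l, RtoC_pow; ring).
    rewrite Re_scal; assert (0 < r' ^ n) by (apply pow_lt; lra); nra. }
  assert (B := ray_growth_positive f u R0 M Hf ltac:(lra) Hu).
  eapply Rle_trans; [apply Hd, Hr|].
  apply Rmult_le_compat_r; [apply Rlt_le, Rinv_0_lt_compat; lra|].
  apply B; [|exact Hd|exact Hr].
  eapply Rle_trans; [apply Hma; rewrite Cmod_mult, Hu, Cmod_R, Rabs_pos_eq; lra|unfold M; lra]. }
assert (Ray : forall u, Cmod u = 1 -> 2 * eta <= Rabs (Re (b n * u ^ n)%C) ->
   forall r, R0 <= r -> Cmod (C_derive f (RtoC r * u)%C) <= 2 * M * sqrt r).
{ intros u Hu Hre r Hr.
  assert (S0 := sqrt_pos r).
  unfold Rabs in Hre; destruct (Rcase_abs (Re (b n * u ^ n))) as [h|h].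
  - assert (OnC : Cmod (RtoC R0 * u) = R0) by (rewrite Cmod_mult, Hu, Cmod_R, Rabs_pos_eq; lra).
    apply (ray_growth_negative f (fun z => - (h1 z * cexp (P1 z)))%C (fun z => - (h0 z * cexp (cpoly b n z)))%C u R0 M);
      try assumption; try lra.
    + eapply Rle_trans; [apply Hma, OnC|unfold M; lra].
    + eapply Rle_trans; [apply Hmb, OnC|unfold M; lra].
    + intros z; assert (E := Hode z).
      replace (C_derive (C_derive f) z) with
        ((C_derive (C_derive f) z + h1 z * cexp (P1 z) * C_derive f z + h0 z * cexp (cpoly b n z) * f z)
         - h1 z * cexp (P1 z) * C_derive f z - h0 z * cexp (cpoly b n z) * f z)%C by ring.
      rewrite E; ring.
    + intros s Hs1; apply H2; [lra|rewrite Cmod_mult, Hu, Cmod_R, Rabs_pos_eq; lra|].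
      replace (b n * (RtoC s * u) ^ n)%C with (RtoC (s ^ n) * (b n * u ^ n))%C
        by (rewrite Cpow_mult_l, RtoC_pow; ring).
      rewrite Re_scal; assert (0 < s ^ n) by (apply pow_lt; lra); nra.
  - eapply Rle_trans; [apply Pos; try assumption; lra|].
    apply Rle_div_l; [lra|].
    assert (1 <= 2 * (2 * r)) by lra. assert (0 <= M * sqrt r) by (apply Rmult_le_pos; [unfold M; lra|lra]). nra. }
set (s0 := ln R0).
assert (Hs0 : exp s0 = R0) by (apply exp_ln; lra).
assert (Hs00 : 0 <= s0) by (unfold s0; rewrite <- ln_1; apply ln_le; lra).
assert (RayE : forall s t, s0 <= s -> sin e <= Rabs (cos (N * t + phi)) ->
  Cmod (C_derive f (cexp (s, t))) <= 2 * M * exp (s / 2)).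
{ intros s t Hst Ht; rewrite cexp_log, <- sqrt_exp.
  apply Ray; [rewrite Cmod_cexp; apply exp_0| |rewrite <- Hs0; now apply exp_le].
  rewrite Hphi, exp_0, pow1, Rmult_1_r, Rabs_mult, (Rabs_pos_eq (Cmod (b n))) by lra.
  unfold eta; replace (2 * (Cmod (b n) * sin e / 2)) with (Cmod (b n) * sin e) by field.
  apply Rmult_le_compat_l; lra. }
assert (All : forall z, R0 <= Cmod z -> Cmod (C_derive f z) <= 2 * M * sqrt (Cmod z)).
{ intros z Hz.
  destruct (exists_log z ltac:(lra)) as [theta Eth].
  set (s := ln (Cmod z)) in *.
  assert (Hss : s0 <= s) by (unfold s, s0; apply ln_le; lra).
  replace (sqrt (Cmod z)) with (exp (s / 2)) by (rewrite <- sqrt_exp; unfold s; rewrite exp_ln by lra; reflexivity).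
  rewrite Eth.
  destruct (critical_sector N phi theta e HN He) as [Hdir|(m & Hm & Hc1 & Hc2)]; [now apply RayE|].
  fold a in Hm, Hc1, Hc2.
  (* In the logarithmic coordinate [e^(- w / 2)] divides by the square root of [r], so that the
     sides of the sector get a constant bound. *)
  set (G := fun w : C => (C_derive f (cexp w) * cexp (RtoC (- / 2) * w))%C).
  assert (Hcmp : forall x t, Cmod (cexp (RtoC (- / 2) * (x, t))) = exp (- (x / 2))).
  { intros x t; rewrite Cmod_cexp, Re_scal; simpl; f_equal; field. }
  assert (Hin : Cmod (G (s, theta)) <= 2 * M).
  { apply (phragmen_lindelof G s0 m a (sigma + 1) 1 (2 * M) Ha ltac:(lra) Hsa ltac:(unfold M; lra)); try assumption.
    - intros w; apply analytic_mult.
      + apply (analytic_comp (C_derive f) cexp); [apply analytic_derive, Hf|apply analytic_cexp].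
      + apply (analytic_comp cexp (fun w => RtoC (- / 2) * w)%C); [apply analytic_cexp|].
        apply analytic_mult; [apply analytic_const|apply analytic_id].
    - intros x t Hx Ht; unfold G; rewrite Cmod_mult, Hcmp, Rmult_1_l.
      rewrite <- (Rmult_1_r (exp (exp ((sigma + 1) * x)))).
      apply Rmult_le_compat; try apply Cmod_ge_0; [apply Rlt_le, exp_pos| |].
      + rewrite <- Rpower_exp; apply (H3 (exp x)); [|rewrite Cmod_cexp; reflexivity].
        assert (exp s0 <= exp x) by now apply exp_le. lra.
      + rewrite <- exp_0; apply exp_le; lra.
    - intros t Ht; unfold G; rewrite Cmod_mult, Hcmp, <- (Rmult_1_r (2 * M)).
      apply Rmult_le_compat; try apply Cmod_ge_0; [apply Rlt_le, exp_pos| |].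
      + eapply Rle_trans; [apply Hmb; rewrite Cmod_cexp; exact Hs0|unfold M; lra].
      + rewrite <- exp_0; apply exp_le; lra.
    - assert (Side : forall x t, s0 <= x -> sin e <= Rabs (cos (N * t + phi)) -> Cmod (G (x, t)) <= 2 * M).
      { intros x t Hx Ht; unfold G; rewrite Cmod_mult, Hcmp.
        apply Rle_trans with (2 * M * exp (x / 2) * exp (- (x / 2))).
        - apply Rmult_le_compat_r; [apply Rlt_le, exp_pos|now apply RayE].
        - rewrite Rmult_assoc, <- exp_plus; replace (x / 2 + - (x / 2)) with 0 by ring; rewrite exp_0; lra. }
      intros x Hx; split; now apply Side. }
  unfold G in Hin; rewrite Cmod_mult, Hcmp, exp_Ropp in Hin.
  assert (E := exp_pos (s / 2)).
  now apply le_mul_of_div_le in Hin. }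
assert (Const := sublinear_entire_constant (C_derive f) R0 (2 * M) (fun z => analytic_derive f z (Hf z)) ltac:(lra) All).
assert (Zero : C_derive f 0%C = 0%C).
{ apply NNPP; intros Hne.
  assert (Hq : 0 < Cmod (C_derive f 0)) by now apply Cmod_gt_0.
  set (q := Cmod (C_derive f 0)) in *.
  (* A direction in which the leading term of [P0] is real and positive, so that the decay in [Pos]
     applies. *)
  set (u := cexp (0, - phi / N)).
  assert (Hu : Cmod u = 1) by (unfold u; rewrite Cmod_cexp; apply exp_0).
  assert (Hre : 2 * eta <= Re (b n * u ^ n)%C).
  { unfold u; rewrite Hphi, exp_0, pow1, Rmult_1_r.
    replace (N * (- phi / N) + phi) with 0 by (field; lra); rewrite cos_0; unfold eta; nra. }
  set (r := Rmax R0 ((M / q) ^ 2)).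
  assert (r1 := Rmax_spec R0 ((M / q) ^ 2)); fold r in r1.
  assert (B := Pos u Hu Hre r (proj1 r1)); rewrite Const in B; fold q in B.
  set (sr := sqrt r) in *.
  assert (Hsr : sr * sr = r) by (apply sqrt_sqrt; lra).
  assert (Hsr0 : 0 < sr) by (apply sqrt_lt_R0; lra).
  assert (Mq : 0 <= M / q) by (apply Rdiv_le_0_compat; unfold M; lra).
  assert (Hs1 : M / q <= sr).
  { rewrite <- (sqrt_pow2 (M / q)) by exact Mq; apply sqrt_le_1_alt, r1. }
  rewrite <- Hsr in B; replace (M * sr / (2 * (sr * sr))) with (M / (2 * sr)) in B by (field; lra).
  apply Rle_div_r in B; [|lra].
  assert (E : M = M / q * q) by (field; lra). nra. }
intros z; apply (zero_derive_const f 0 (Cmod z + 1)).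
- intros w _; rewrite <- Zero, <- (Const w); apply analytic_cdiff, Hf.
- replace (z - 0)%C with z by ring; lra.
Qed.

Theorem theorem4 (n : nat) (a b : nat -> C) (h1 h0 : C -> C) (c : R) :
  (1 <= n)%nat ->
  a n <> 0%C -> b n <> 0%C ->
  entire h1 -> entire h0 ->
  (exists z, h1 z <> 0%C) -> (exists z, h0 z <> 0%C) ->
  Rbar_lt (order h1) (INR n) -> Rbar_lt (order h0) (INR n) ->
  1 <= c ->
  (exists K : C, forall z : C, (cpoly a n z - RtoC c * cpoly b n z)%C = K) ->
  fabry_gaps h1 ->
  Rbar_lt (order h1) (lower_order h0) ->
  forall f f' f'' : C -> C,
    (forall z, @is_derive C_AbsRing C_NormedModule f z (f' z)) ->
    (forall z, @is_derive C_AbsRing C_NormedModule f' z (f'' z)) ->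
    (forall z, (f'' z + h1 z * cexp (cpoly a n z) * f' z
                + h0 z * cexp (cpoly b n z) * f z)%C = 0%C) ->
    (exists z w, f z <> f w) ->
    order f = p_infty.
Proof.
intros Hn _ Hbn He1 He0 Hh10 _ Ho1 Ho0 Hc [k0 Hk] _ Hlow f f' f'' Df Df' Hode [z1 [z2 Hz12]].
assert (Hf : holomorphic f) by (intros z; apply (analytic_of_derive f f'); intros w; apply cdiff_is_derive, Df).
assert (Ef : forall z, C_derive f z = f' z) by (intros z; apply is_C_derive_unique, Df).
assert (Ef2 : forall z, C_derive (C_derive f) z = f'' z).
{ intros z; apply cdiff_C_derive, (cdiff_ext_loc f' _ _ _ 1); [lra|intros; now rewrite Ef|apply cdiff_is_derive, Df']. }
assert (Hh1 := entire_analytic _ He1); assert (Hh0 := entire_analytic _ He0).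
assert (Hf0 : exists p, f p <> 0%C).
{ apply NNPP; intros H; apply Hz12.
  assert (A : forall p, f p = 0%C) by (intros p; apply NNPP; intros Hp; apply H; now exists p).
  now rewrite !A. }
assert (Hode' : forall z, (C_derive (C_derive f) z + h1 z * cexp (cpoly a n z) * C_derive f z
   + h0 z * cexp (cpoly b n z) * f z)%C = 0%C) by (intros z; rewrite Ef, Ef2; apply Hode).
assert (HP : forall z, cpoly a n z = (RtoC c * cpoly b n z + k0)%C) by (intros z; rewrite <- (Hk z); ring).
apply NNPP; intros Hfin.
assert (HA : exists A : R, Rbar_lt (order f) A).
{ destruct (order f) as [o| |]; [exists (o + 1); simpl; lra|now destruct Hfin|exists 0; exact I]. }
destruct HA as [A HA].
destruct (order_lt_growth f A Hf HA) as (s & Hs & Gs).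
(* The exponent [s] may be 0, whereas the estimates work with a positive one. *)
assert (Gf := growth_le f s (s + 1) ltac:(lra) Gs).
destruct (order_lt_growth h0 (INR n) Hh0 Ho0) as (g0 & Hg0 & G0).
destruct (Rle_lt_or_eq_dec _ _ Hc) as [Hc1|<-].
- destruct (order_lt_growth h1 (INR n) Hh1 Ho1) as (g1 & Hg1 & G1).
  assert (HN : 0 < INR n) by (apply lt_0_INR; lia).
  (* A common exponent for both coefficients; [n / 2] makes it positive. *)
  set (g := Rmax (INR n / 2) (Rmax g0 g1)).
  assert (m1 := Rmax_spec (INR n / 2) (Rmax g0 g1)); fold g in m1.
  assert (m3 := Rmax_spec g0 g1).
  assert (Hg : 0 < g < INR n) by (split; [lra|unfold g; repeat apply Rmax_lub_lt; lra]).
  assert (Cst := finite_order_solution_constant f h1 h0 (cpoly a n) b n k0 c (s + 1) g Hn Hbn Hf Hh1 Hh0 Hf0 Hh10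
    ltac:(lra) Gf Hg (growth_le h1 g1 g ltac:(lra) G1) (growth_le h0 g0 g ltac:(lra) G0) Hc1 HP Hode').
  apply Hz12; now rewrite (Cst z1), (Cst z2).
(* Room for the exponents [rho(h1) < beta < beta1 < beta2 < mu(h0)]: the coefficient bound loses a
   little from [beta] to [beta1], and [beta2] exceeds [beta1] in order to beat the constants [B] and
   [D]. *)
- destruct (Rbar_lt_between _ _ Hlow) as (beta & Hb1 & Hb2).
  destruct (Rbar_lt_between _ _ Hb2) as (beta2 & Hb3 & Hb4); simpl in Hb3.
  destruct (order_lt_growth h1 beta Hh1 Hb1) as (g1 & Hg1 & G1).
  assert (G1' := growth_le h1 g1 beta ltac:(lra) G1).
  assert (Large := lower_order_gt_large h0 beta2 Hh0 ltac:(lra) Hb4).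
  set (beta1 := (beta + beta2) / 2).
  (* The lower growth of [h0] cannot exceed its upper growth; this places [beta1] below [g0], as
     [sector_growth] requires. *)
  assert (Hlt : beta2 < g0).
  { apply Rnot_le_lt; intros Hle.
    destruct (for_large_and _ _ Large (for_large_and _ _ G0 (for_large_ge 1))) as [r Hr].
    destruct (Hr (Rmax r 1) (Rmax_l _ _)) as ((z & Hz & L) & U & R1).
    specialize (U z Hz).
    assert (X : exp (Rpower (Rmax r 1) g0) <= exp (Rpower (Rmax r 1) beta2)) by (apply exp_le, Rle_Rpower; lra).
    lra. }
  destruct (sector_growth h0 (b n) n beta1 g0 Hn Hh0 Hbn ltac:(unfold beta1; lra) ltac:(lra) G0) as (B & D & HB & EB).
  { intros eta Heta; apply (coefficient_bound f h1 h0 (cpoly a n) b n k0 (s + 1) beta beta1 eta); try assumption; try lra.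
    - unfold beta1; lra.
    - intros z; rewrite HP; ring. }
  assert (E1 := for_large_Rpower_dom beta1 beta2 (2 * D) ltac:(unfold beta1; lra)).
  assert (E2 := for_large_Rpower_ge beta2 (2 * ln B) ltac:(lra)).
  destruct (for_large_and _ _ Large (for_large_and _ _ EB (for_large_and _ _ E1 E2))) as [r Hr].
  destruct (Hr r (Rle_refl r)) as ((z & Hz & L) & U & F1 & F2).
  specialize (U z Hz).
  assert (X : B * exp (D * Rpower r beta1) <= exp (Rpower r beta2)).
  { rewrite <- (exp_ln B) by exact HB; rewrite <- exp_plus; apply exp_le; lra. }
  lra.
Qed.
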